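(* Assume (E3), with exponent $\beta>1/2$. Let $\alpha>1/2$ and let $L>0$ satisfy $L^2\ge \pi^{-1}2^{1+(\alpha-1)_+}\Gamma(2\alpha+1)$, where $(x)_+=\max(x,0)$. Then there exist positive constants $c_1,c_2$ depending only on $\alpha$, $\beta$ and $f_\zeta$ such that for all $n$ large enough $$\inf_{\tilde F}\mathrm{Risk}_2[\tilde F;\mathcal F_\alpha(L)]\ge c_1\,L^{(2\beta-1)/(2\alpha+2\beta)}\,\phi(n),$$ $$\inf_{\tilde F}\mathrm{Risk}_\epsilon[\tilde F;\mathcal F_\alpha(L)]\ge c_2\,L^{(2\beta-1)/(2\alpha+2\beta)}\,\phi\big(n/\ln\epsilon^{-1}\big),$$ where $\phi(z)=z^{-(2\alpha+1)/(4\alpha+4\beta)}$ and the infima are over all possible estimators $\tilde F$ of $F(t_0)$.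
   Context: Model: $X_1,\dots,X_n$ are i.i.d. with distribution function $F$ on $\mathbb R$; one observes $Y_j=X_j+\zeta_j$, $j=1,\dots,n$, where the $\zeta_j$ are i.i.d., independent of the $X_j$, with a known Lebesgue density $f_\zeta$. For a function $g$ on $\mathbb R$, $\hat g(\omega)=\int_{-\infty}^{\infty} g(x)e^{i\omega x}\,dx$. It is assumed that $|\hat f_\zeta(\omega)|\neq 0$ for all $\omega\in\mathbb R$. The point $t_0\in\mathbb R$ is given; an estimator of $F(t_0)$ is any measurable function $\tilde F=\tilde F(Y_1,\dots,Y_n)$. Class $\mathcal F_\alpha(L)$: all distributions $F$ on $\mathbb R$ having a Lebesgue density $f$ with $\frac1{2\pi}\int_{-\infty}^\infty|\hat f(\omega)|^2(1+\omega^2)^\alpha\,d\omega\le L^2$. Risks: $\mathrm{Risk}_2[\tilde F;\mathcal F]=\sup_{F\in\mathcal F}\{E|\tilde F-F(t_0)|^2\}^{1/2}$, and for $\epsilon\in(0,1/2)$, $\mathrm{Risk}_\epsilon[\tilde F;\mathcal F]=\min\{\delta:\sup_{F\in\mathcal F}P[|\tilde F-F(t_0)|>\delta]\le\epsilon\}$. (E3): $\hat f_\zeta$ is twice differentiable, and there exist real numbers $\beta>1/2$, $C_\zeta>0$, $\omega_*>0$ such that $(1+\omega^2)^{\beta/2}\max_{j=0,1,2}|\hat f_\zeta^{(j)}(\omega)|\le C_\zeta$ for all $|\omega|\ge\omega_*$. *)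

(* Defs.v *)
From HB Require Import structures.
From mathcomp Require Import all_boot all_order all_algebra.
From mathcomp Require Import complex.
From mathcomp Require Import all_classical all_reals all_analysis.

Set Implicit Arguments.
Unset Strict Implicit.
Unset Printing Implicit Defensive.

Import Order.TTheory GRing.Theory Num.Theory.
Import numFieldNormedType.Exports.

Local Open Scope classical_set_scope.
Local Open Scope ring_scope.

Definition has_density (R : realType) (mu : probability R R) (f : R -> R) : Prop :=
  [/\ measurable_fun [set: R] f,
      (forall x, 0 <= f x) &
      forall A : set R, measurable A ->
        mu A = (\int[lebesgue_measure]_(x in A) (f x)%:E)%E].

Definition Gamma (R : realType) (s : R) : R :=
  \int[lebesgue_measure]_(x in `[0, +oo[) (x `^ (s - 1) * expR (- x)).

(* Sign convention e^{+i omega x} and no normalising constant.  The integral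
   of a complex-valued function is taken componentwise; it is only meaningful
   for integrable [g], e.g. densities. *)
Definition fourier (R : realType) (g : R -> R) (omega : R) : R[i] :=
  Complex (\int[lebesgue_measure]_(x in [set: R]) (g x * cos (omega * x)))
          (\int[lebesgue_measure]_(x in [set: R]) (g x * sin (omega * x))).

Definition cmod (R : realType) (z : R[i]) : R :=
  Num.sqrt (complex.Re z ^+ 2 + complex.Im z ^+ 2).

(* Differentiation of complex-valued functions of a real variable; R[i] is not
   a normed module over R in the library, hence the componentwise form. *)
Definition cderivable (R : realType) (h : R -> R[i]) (omega : R) : Prop :=
  derivable (fun x => complex.Re (h x)) omega 1 /\
  derivable (fun x => complex.Im (h x)) omega 1.

Definition cderive1 (R : realType) (h : R -> R[i]) (omega : R) : R[i] :=
  Complex (derive1 (fun x => complex.Re (h x)) omega)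
          (derive1 (fun x => complex.Im (h x)) omega).

Definition condE3 (R : realType) (beta : R) (fzeta : R -> R) : Prop :=
  let fhat := fourier fzeta in
  (forall omega, cderivable fhat omega /\ cderivable (cderive1 fhat) omega) /\
  (2^-1 < beta /\
   exists Czeta omega_star : R, 0 < Czeta /\ 0 < omega_star /\
     forall omega, omega_star <= `|omega| ->
       (1 + omega ^+ 2) `^ (beta / 2) *
         \big[Num.max/0]_(j < 3) cmod (iter j (@cderive1 R) fhat omega)
       <= Czeta).

(* A distribution function F is represented by its probability measure. *)
Definition distr_fun (R : realType) (mu : probability R R) (t : R) : R :=
  fine (mu `]-oo, t]%classic).

Definition sobolev_class (R : realType) (alpha L : R) : set (probability R R) :=
  [set mu | exists f : R -> R, has_density mu f /\
    ((2 * pi)^-1%:E *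
      \int[lebesgue_measure]_(omega in [set: R])
        (cmod (fourier f omega) ^+ 2 * (1 + omega ^+ 2) `^ alpha)%:E
     <= (L ^+ 2)%:E)%E].

Section iid_sample.
Context d (T : measurableType d) (R : realType).

Definition tcons n (x : T * n.-tuple T) : n.+1.-tuple T := [tuple of x.1 :: x.2].

Lemma measurable_tcons n : measurable_fun [set: T * n.-tuple T] (@tcons n).
Proof. exact: measurable_cons. Qed.

HB.instance Definition _ n := isMeasurableFun.Build _ _ _ _ (@tcons n)
  (@measurable_tcons n).

(* The n-fold product measure. *)
Fixpoint iid (P : probability T R) (n : nat) : probability (n.-tuple T) R :=
  match n with
  | 0 => \d_ [tuple]
  | n'.+1 => distribution (P \x iid P n')%E (@tcons n')
  end.

End iid_sample.

(* The sample space carries the pairs (X_j, zeta_j), j = 1..n, i.i.d. with law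
   mu (x) Q; the observations are Y_j = X_j + zeta_j. *)
Definition model (R : realType) (Q mu : probability R R) (n : nat) :
    probability (n.-tuple (R * R)%type) R :=
  iid (mu \x Q)%E n.

Definition observations (R : realType) (n : nat) (w : n.-tuple (R * R)%type) :
  n.-tuple R := [tuple of map (fun p => p.1 + p.2) w].

Definition estimator (R : realType) (n : nat) : Type :=
  {mfun n.-tuple R >-> R}.

Definition Risk2 (R : realType) (Q : probability R R) (t0 : R) (n : nat)
    (Ft : estimator R n) (FF : set (probability R R)) : \bar R :=
  ereal_sup [set ('E_(model Q mu n)[fun w =>
      (`|Ft (observations w) - distr_fun mu t0| ^+ 2)%R] `^ 2^-1%R)%E | mu in FF].

(* The set of admissible delta is closed, so that its infimum is its minimum
   when it is nonempty; the infimum is +oo when it is empty. *)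
Definition Risk_eps (R : realType) (Q : probability R R) (t0 eps : R) (n : nat)
    (Ft : estimator R n) (FF : set (probability R R)) : \bar R :=
  ereal_inf [set delta%:E | delta in [set delta : R |
    (ereal_sup [set model Q mu n
        [set w | (delta < `|Ft (observations w) - distr_fun mu t0|)%R]
      | mu in FF] <= eps%:E)%E]].

Definition phi (R : realType) (alpha beta z : R) : R :=
  z `^ (- ((2 * alpha + 1) / (4 * alpha + 4 * beta))).

(* Main.v *)
Require Import Defs.
From HB Require Import structures.
From mathcomp Require Import all_boot all_order all_algebra.
From mathcomp Require Import complex.
From mathcomp Require Import all_classical all_reals all_analysis.
From mathcomp Require Import measurable_realfun.
From mathcomp Require Import ring lra.

Set Implicit Arguments.
Unset Strict Implicit.
Unset Printing Implicit Defensive.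

Import Order.TTheory GRing.Theory Num.Theory.
Import numFieldNormedType.Exports.

Local Open Scope classical_set_scope.
Local Open Scope ring_scope.

(** The bound comes from three laws of the class whose distribution functions
    at [t0] differ by the announced rate, while samples of size [n] do not tell
    the corresponding observations apart.

    The hypotheses.  The base law is a Cauchy law of scale [lam] centred at
    [t0].  It is perturbed by [sg * a * w], [sg] in {0, 1, -1}, where [w =
    wave N] is the sine transform of a bump carried by the frequencies
    [[N, 2 * N]].  The wave is odd, hence has integral 0, and two integrations
    by parts give |w x| <= 5 N / (1 + x^2) ([wave_decay]), so that for small [a]
    the Cauchy density absorbs it and the perturbed functions are densities
    ([dens_prob]).  Its integral over the half-line is at least 1/120, whatever
    [N] ([wave_half_ge]), so the perturbation moves the distribution function
    at [t0] by at least a / 120.  The transform of the perturbation is bounded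
    and vanishes at frequencies above 2 N, so its squared Sobolev norm is of
    order a^2 N^(2 alpha + 1); that of the Cauchy law is small for large [lam]
    ([sobolev_dens]).  The lower bound assumed on L^2 serves to choose [lam]
    independently of [L] ([base_scale_exists]).

    The observations.  Convolution with the noise multiplies the bump by the
    noise transform, which is O(N^-beta) with its first derivative on
    [[N, 2 * N]].  By Plancherel, applied to the filtered wave W and to z W(z)
    ([band_wave_L2]), the integral of (1 + z^2) W(z)^2 is O(N^(1 - 2 beta)).
    The density of the unperturbed observation is at least a multiple of
    1 / (1 + z^2) ([conv_cdens0_ge]), so the chi-square distance between a
    perturbed and the base observation is O(a^2 N^(1 - 2 beta))
    ([chi_square_le]).

    The rate.  Take [a] proportional to L N^-(alpha + 1/2), which keeps the
    Sobolev norm below L, and N^(2 alpha + 2 beta) proportional to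
    L^2 n / ln (1 / eps).  Then n times the chi-square distance is
    ln (1 / eps) / 4, so the likelihood ratio of a sample has second moment at
    most eps^(-1/4), and [a] is L^((2 beta - 1) / (2 alpha + 2 beta)) times
    phi (n / ln (1 / eps)), up to a constant.

    The test.  Let A_sg be the event that the estimator is within a / 360 of
    the value belonging to the hypothesis [sg].  The three events are disjoint.
    If each A_sg had probability at least 1 - eps under its own law, A_1 or
    A_(-1) would have probability at most eps / 2 under the base law, and a
    change of law with second moment eps^(-1/4) cannot raise this to 1 - eps
    ([likelihood_test_le], [no_good_test]).  So under one of the three laws the
    error exceeds a / 360 with probability more than eps ([three_point]), which
    bounds [Risk_eps]; [Risk2] follows by Markov's inequality with eps = 1 / e.

    The facts of Fourier analysis are obtained by regularisation: with a factor
    exp (- d |x|) the integrals can be exchanged by Fubini, a product of two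
    cosines integrates to Poisson kernels of mass 2 pi ([cosT_pairing]), and d
    tends to 0 at the end. *)

(** * Invariance of Lebesgue measure *)

Section invariance.
Context {R : realType}.
Local Notation mu := (@lebesgue_measure R).

Lemma ge0_integral_comp_pres (phi : R -> R) (f : R -> \bar R) :
  measurable_fun [set: R] phi ->
  (forall A, measurable A -> mu (phi @^-1` A) = mu A) ->
  measurable_fun [set: R] f -> (forall x, 0 <= f x)%E ->
  (\int[mu]_x f (phi x) = \int[mu]_x f x)%E.
Proof.
move=> mphi mu_phi mf f0.
have h := @ge0_integral_pushforward _ _ (measurableTypeR R) (measurableTypeR R)
  R phi mphi mu setT f measurableT mf
  (fun y _ => f0 y).
rewrite preimage_setT in h; rewrite -[LHS]h; apply: eq_measure_integral => A mA _.
exact: mu_phi.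
Qed.

Lemma Rintegral_comp_pres (phi : R -> R) (f : R -> R) :
  measurable_fun [set: R] phi ->
  (forall A, measurable A -> mu (phi @^-1` A) = mu A) ->
  measurable_fun [set: R] f ->
  \int[mu]_x f (phi x) = \int[mu]_x f x.
Proof.
move=> mphi mu_phi mf; rewrite /Rintegral; congr fine.
rewrite integralE [in RHS]integralE; congr (_ - _)%E.
- have h := ge0_integral_comp_pres (f := (EFin \o f)^\+%E) mphi mu_phi.
  apply: (etrans _ (h _ _)) => //; first by apply: eq_integral => x _; rewrite funeposE [in RHS]funeposE.
  by apply: measurable_funepos; exact/measurable_EFinP.
- have h := ge0_integral_comp_pres (f := (EFin \o f)^\-%E) mphi mu_phi.
  apply: (etrans _ (h _ _)) => //; first by apply: eq_integral => x _; rewrite funenegE [in RHS]funenegE.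
  by apply: measurable_funeneg; exact/measurable_EFinP.
Qed.

Lemma measurable_addr (c : R) : measurable_fun [set: R] (fun x : R => x + c).
Proof. exact: measurable_funD. Qed.

Lemma lebesgue_measure_addr (c : R) (A : set R) : measurable A ->
  mu ((fun x => x + c) @^-1` A) = mu A.
Proof.
move=> mA; have m := measurable_addr c.
apply/esym.
rewrite -[RHS]/(pushforward mu ((fun x => x + c) : _ -> measurableTypeR R) A).
apply: lebesgue_measure_unique => // _ [[a b]] _ <-.
transitivity (mu `]a - c, b - c]%classic); last first.
  congr (mu _); apply/seteqP; split => x /=; rewrite !in_itv/= ltrBlDr lerBrDr => //.
by rewrite /= !lebesgue_measure_itv/= !lte_fin ltrD2r; case: ifPn => // _;
  congr (_%:E); ring.
Qed.

Lemma lebesgue_measure_oppr (A : set R) : measurable A ->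
  mu (-%R @^-1` A) = mu A.
Proof. by move=> mA; rewrite -[RHS]lebesgue_measureN. Qed.

Lemma Rintegral_addr (c : R) (f : R -> R) : measurable_fun [set: R] f ->
  \int[mu]_x f (x + c) = \int[mu]_x f x.
Proof.
by apply: Rintegral_comp_pres; [exact: measurable_addr|exact: lebesgue_measure_addr].
Qed.

Lemma ge0_integral_addr (c : R) (f : R -> \bar R) : measurable_fun [set: R] f ->
  (forall x, 0 <= f x)%E -> (\int[mu]_x f (x + c)%R = \int[mu]_x f x)%E.
Proof.
by apply: ge0_integral_comp_pres; [exact: measurable_addr|exact: lebesgue_measure_addr].
Qed.

Lemma Rintegral_oppr (f : R -> R) : measurable_fun [set: R] f ->
  \int[mu]_x f (- x) = \int[mu]_x f x.
Proof.
by apply: Rintegral_comp_pres; [exact: measurable_funN|exact: lebesgue_measure_oppr].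
Qed.

Lemma ge0_integral_oppr (f : R -> \bar R) : measurable_fun [set: R] f ->
  (forall x, 0 <= f x)%E -> (\int[mu]_x f (- x)%R = \int[mu]_x f x)%E.
Proof.
by apply: ge0_integral_comp_pres; [exact: measurable_funN|exact: lebesgue_measure_oppr].
Qed.

Lemma integrable_oppr (f : R -> R) : mu.-integrable setT (EFin \o f) ->
  mu.-integrable setT (EFin \o (fun x => f (- x))).
Proof.
move=> /integrableP[mf foo]; apply/integrableP; split.
  move/measurable_EFinP in mf; apply/measurable_EFinP.
  exact: (measurableT_comp mf (measurable_funN (@measurable_id _ _ _))).
by rewrite (ge0_integral_oppr (f := fun x => `|(f x)%:E|%E))//;
  exact: measurableT_comp.
Qed.

Lemma ge0_integral_split0 (f : R -> R) : measurable_fun [set: R] f ->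
  (forall x, 0 <= f x) ->
  (\int[mu]_x (f x)%:E = \int[mu]_(x in `[0%R, +oo[) (f x)%:E +
     \int[mu]_(x in `[0%R, +oo[) (f (- x))%:E)%E.
Proof.
move=> mf f0.
have -> : [set: R] = `[0%R, +oo[%classic `|` `]-oo, 0%R[%classic.
  by rewrite -setCitvr setUv.
rewrite ge0_integral_setU//=; first last.
- by rewrite -setCitvr; exact/disj_setPCl.
- by move=> x _; rewrite lee_fin.
- by apply/measurable_EFinP; exact: measurable_funTS.
congr (_ + _)%E.
rewrite integral_itv_bndo_bndc; last by apply/measurable_EFinP; exact: measurable_funTS.
rewrite [RHS](@ge0_integration_by_substitution0 R (fun x => (f (- x))%:E)) //.
- by apply: eq_integral => x _; rewrite opprK.
- apply/measurable_EFinP.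
  exact: (measurableT_comp mf (measurable_funN (@measurable_id _ _ _))).
- by move=> r; rewrite lee_fin.
Qed.

Lemma Rintegral_split0 (f : R -> R) : mu.-integrable setT (EFin \o f) ->
  \int[mu]_x f x = \int[mu]_(x in `[0, +oo[) f x + \int[mu]_(x in `[0, +oo[) f (- x).
Proof.
move=> fi.
have mf : measurable_fun [set: R] f by apply/measurable_EFinP; case/integrableP: fi.
have sub (A : set R) : measurable A -> mu.-integrable A (EFin \o f).
  by move=> mA; exact: integrableS fi.
have -> : [set: R] = `[0, +oo[%classic `|` `]-oo, 0[%classic.
  by rewrite -setCitvr setUv.
rewrite Rintegral_setU//=; last 2 first.
- by rewrite -setCitvr setUv.
- by rewrite -setCitvr; exact/disj_setPCl.
congr (_ + _).
rewrite Rintegral_mkcond -Rintegral_oppr; last first.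
  by apply/(measurable_restrictT _ _).1 => //; exact: measurable_funTS.
rewrite -Rintegral_itv_obnd_cbnd; last first.
  by apply: (@integrableS _ _ _ _ setT) => //; exact: (integrable_oppr fi).
rewrite [RHS]Rintegral_mkcond; apply: eq_Rintegral => x _.
by rewrite !patchE !mem_setE !in_itv/= andbT oppr_lt0.
Qed.

End invariance.

(** * The Poisson kernel *)

Section calculus.
Context {R : realType}.
Local Notation mu := (@lebesgue_measure R).

Lemma is_derive_continuous (F f : R -> R) :
  (forall x : R, is_derive x 1 F (f x)) -> continuous F.
Proof.
move=> dF x; apply/differentiable_continuous/derivable1_diffP.
exact: (@ex_derive _ _ _ _ _ _ _ (dF x)).
Qed.

Lemma ge0_FTC2y (f F : R -> R) (a l : R) :
  (forall x, a <= x -> 0 <= f x) -> continuous f ->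
  (forall x : R, is_derive x 1 F (f x)) -> F x @[x --> +oo] --> l ->
  (\int[mu]_(x in `[a, +oo[) (f x)%:E = (l - F a)%:E)%E.
Proof.
move=> f0 cf dF Fl; rewrite EFinB; apply: ge0_continuous_FTC2y => //.
- exact: continuous_subspaceT.
- by apply: cvg_at_right_filter; apply: (is_derive_continuous dF).
- by move=> x _; rewrite derive1E; apply: (@derive_val _ _ _ _ _ _ _ (dF x)).
Qed.

Lemma FTC2 (f F : R -> R) (a b : R) : a < b -> continuous f ->
  (forall x : R, is_derive x 1 F (f x)) ->
  \int[mu]_(x in `[a, b]) f x = F b - F a.
Proof.
move=> ab cf dF; have cF := is_derive_continuous dF.
rewrite /Rintegral (@continuous_FTC2 _ f F)//.
- exact: continuous_subspaceT.
- split.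
  + by move=> x _; apply: (@ex_derive _ _ _ _ _ _ _ (dF x)).
  + by apply: cvg_at_right_filter; exact: cF.
  + by apply: cvg_at_left_filter; exact: cF.
- by move=> x _; rewrite derive1E; apply: (@derive_val _ _ _ _ _ _ _ (dF x)).
Qed.

Lemma ge0_fin_integrable (D : set R) (f : R -> R) (r : R) : measurable D ->
  measurable_fun D f -> (forall x, D x -> 0 <= f x) ->
  (\int[mu]_(x in D) (f x)%:E = r%:E)%E -> mu.-integrable D (EFin \o f).
Proof.
move=> mD mf f0 fr; apply/integrableP; split; first exact/measurable_EFinP.
under eq_integral => x /[!inE] Dx do rewrite /= ger0_norm ?f0//.
by rewrite fr ltry.
Qed.

Lemma cvg_bounded_expR (B : R -> R) (d K : R) : 0 < d ->
  (forall x, `|B x| <= K) -> expR (- (d * x)) * B x @[x --> +oo] --> 0.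
Proof.
move=> d0 BK.
have e0 : expR (- (d * x)) @[x --> +oo] --> (0:R).
  apply: (@cvg_comp _ _ _ (fun x => d * x) (fun x => expR (- x)) _ _ _ _ (@cvgr_expR R)).
  by apply: gt0_cvgMry.
have K0 : 0 <= K := le_trans (normr_ge0 _) (BK 0).
have Ke : K * expR (- (d * x)) @[x --> +oo] --> (0:R).
  by have := cvgM (cvg_cst K) e0; rewrite mulr0; apply.
apply: (@squeeze_cvgr _ _ _ _ (fun x => - (K * expR (- (d * x)))) (fun x => K * expR (- (d * x)))).
- near=> x; rewrite -ler_norml normrM (gtr0_norm (expR_gt0 _)) mulrC.
  by rewrite ler_wpM2r ?expR_ge0.
- by have := @cvgN _ R^o _ _ _ _ _ Ke; rewrite oppr0; apply.
- exact: Ke.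
Unshelve. all: by end_near. Qed.

End calculus.

Section kernel.
Context {R : realType}.
Local Notation mu := (@lebesgue_measure R).

(** The Fourier transform of [abel d]; it has integral [2 * pi] and is [2 * pi] times
    the Cauchy density of scale [d]. *)
Definition poisson (d u : R) : R := 2 * d / (d ^+ 2 + u ^+ 2).

Definition abel (d x : R) : R := expR (- (d * `|x|)).

Variable d : R.
Hypothesis d0 : 0 < d.

Lemma sqrD_gt0 (u : R) : 0 < d ^+ 2 + u ^+ 2.
Proof. by rewrite ltr_pwDl ?exprn_gt0 ?sqr_ge0. Qed.

(** The summand 1 makes the integrand non-negative, so that the primitive can be
    evaluated at infinity without an integrability proof; integrability and the
    cosine integral are then read off from this formula. *)
Lemma integral_expR_cos1_half (u th : R) :
  (\int[mu]_(x in `[0%R, +oo[) (expR (- (d * x)) * (1 + cos (u * x + th)))%:E =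
   (d^-1 + (d * cos th - u * sin th) / (d ^+ 2 + u ^+ 2))%:E)%E.
Proof.
have q0 := sqrD_gt0 u; have qn0 := lt0r_neq0 q0; have dn0 := lt0r_neq0 d0.
pose F x : R := expR (- (d * x)) *
  (- d^-1 + (u * sin (u * x + th) - d * cos (u * x + th)) / (d ^+ 2 + u ^+ 2)).
have dF (x : R) : is_derive x 1 F (expR (- (d * x)) * (1 + cos (u * x + th))).
  apply: is_derive_eq; rewrite /GRing.scale/= !mulr1.
  by field; rewrite qn0 dn0.
transitivity ((0 - F 0)%:E); last first.
  by rewrite /F !mulr0 oppr0 expR0 !add0r; congr (_%:E); field; rewrite qn0 dn0.
apply: ge0_FTC2y.
- by move=> x _; rewrite mulr_ge0 ?expR_ge0// -lerBlDl sub0r cos_geN1.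
- by apply: is_derive_continuous => x; exact: is_deriveM.
- apply: (@cvg_bounded_expR _ _ d (d^-1 + (`|u| + d) / (d ^+ 2 + u ^+ 2)) d0) => x.
  rewrite (le_trans (ler_normD _ _))// lerD//.
    by rewrite normrN ger0_norm// invr_ge0 ltW.
  rewrite normrM (gtr0_norm (_ : 0 < (d ^+ 2 + u ^+ 2)^-1)) ?invr_gt0//.
  rewrite ler_pM2r ?invr_gt0// (le_trans (ler_normB _ _))// !normrM.
  rewrite (gtr0_norm d0) lerD// ler_piMr ?normr_ge0 ?(ltW d0)//.
    by rewrite ler_norml sin_geN1 sin_le1.
  by rewrite ler_norml cos_geN1 cos_le1.
Qed.

Lemma integrable_expR_cos1_half (u th : R) :
  mu.-integrable `[0, +oo[ (EFin \o (fun x => expR (- (d * x)) * (1 + cos (u * x + th)))).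
Proof.
apply: ge0_fin_integrable (integral_expR_cos1_half u th); first by [].
- apply: measurable_funTS; apply: continuous_measurable_fun.
  by apply: is_derive_continuous => x; exact: is_deriveM.
- by move=> x _; rewrite mulr_ge0 ?expR_ge0// -lerBlDl sub0r cos_geN1.
Qed.

Lemma measurable_expRM : measurable_fun [set: R] (fun x => expR (- (d * x))).
Proof.
by apply: measurableT_comp => //; apply: measurable_funN; exact: measurable_funM.
Qed.

Lemma integrable_expR_half : mu.-integrable `[0, +oo[ (EFin \o (fun x => expR (- (d * x)))).
Proof.
apply: le_integrable (integrable_expR_cos1_half 0 0) => //.
  by apply/measurable_EFinP; apply: measurable_funTS; exact: measurable_expRM.
move=> x _; rewrite /= lee_fin mul0r addr0 cos0 normrM ler_peMr ?normr_ge0//.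
by rewrite ger0_norm; lra.
Qed.

Lemma Rintegral_expR_half : \int[mu]_(x in `[0, +oo[) expR (- (d * x)) = d^-1.
Proof.
have := integral_expR_cos1_half 0 0.
under eq_integral => x _ do rewrite mul0r addr0 cos0 mulrC EFinM.
rewrite integralZl//; last exact: integrable_expR_half.
rewrite cos0 mul0r mulr1 expr0n/= addr0 subr0 /Rintegral.
have : (\int[mu]_(x in `[0%R, +oo[) (expR (- (d * x)))%:E \is a fin_num)%E.
  by apply: integrable_fin_num => //; exact: integrable_expR_half.
move=> /fineK <- /=; rewrite -EFinM => -[h].
have dn0 := lt0r_neq0 d0.
apply: (mulfI (_ : (1 + 1) != 0 :> R)); first by rewrite -mulr2n pnatr_eq0.
by rewrite h; field.
Qed.

Lemma Rintegral_expR_cos_half (u th : R) :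
  \int[mu]_(x in `[0, +oo[) (expR (- (d * x)) * cos (u * x + th)) =
  (d * cos th - u * sin th) / (d ^+ 2 + u ^+ 2).
Proof.
transitivity (\int[mu]_(x in `[0, +oo[)
  (expR (- (d * x)) * (1 + cos (u * x + th)) - expR (- (d * x)))).
  by apply: eq_Rintegral => x _; ring.
rewrite RintegralB//; [|exact: integrable_expR_cos1_half|exact: integrable_expR_half].
by rewrite Rintegral_expR_half /Rintegral integral_expR_cos1_half/=; ring.
Qed.

Lemma measurable_abel : measurable_fun [set: R] (abel d).
Proof.
by apply: measurableT_comp => //; apply: measurable_funN; exact: measurable_funM.
Qed.

Lemma abel_ge0 x : 0 <= abel d x. Proof. exact: expR_ge0. Qed.

Lemma abel_le1 x : abel d x <= 1.
Proof. by rewrite -expR0 ler_expR oppr_le0 mulr_ge0// ltW. Qed.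

Lemma integrable_abel : mu.-integrable setT (EFin \o abel d).
Proof.
apply: (@ge0_fin_integrable _ _ _ (d^-1 + d^-1)) => //.
- exact: measurable_abel.
- by move=> x _; exact: abel_ge0.
rewrite ge0_integral_split0; [|exact: measurable_abel|exact: abel_ge0].
have h : (\int[mu]_(x in `[0%R, +oo[) (abel d x)%:E = d^-1%:E)%E.
  rewrite -Rintegral_expR_half /Rintegral fineK; last first.
    by apply: integrable_fin_num => //; exact: integrable_expR_half.
  apply: eq_integral => x; rewrite inE/= in_itv/= andbT => x0.
  by rewrite /abel ger0_norm.
rewrite EFinD h; congr (_ + _)%E.
by under eq_integral => x _ do rewrite /abel normrN; exact: h.
Qed.

Lemma integrable_abelM (f : R -> R) : measurable_fun [set: R] f ->
  (forall x, `|f x| <= 1) -> mu.-integrable setT (EFin \o (fun x => abel d x * f x)).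
Proof.
move=> mf f1; apply: le_integrable integrable_abel => //.
  by apply/measurable_EFinP; apply: measurable_funM => //; exact: measurable_abel.
by move=> x _; rewrite /= lee_fin normrM ler_piMr.
Qed.

Lemma measurable_cos_affine (u th : R) : measurable_fun [set: R] (fun x => cos (u * x + th)).
Proof.
by apply: continuous_measurable_fun; apply: is_derive_continuous => x; exact: is_derive1_comp.
Qed.

Lemma cos_norm_le1 (x : R) : `|cos x| <= 1.
Proof. by rewrite ler_norml cos_geN1 cos_le1. Qed.

Lemma integrable_mul_cos (f : R -> R) (w eta : R) : mu.-integrable setT (EFin \o f) ->
  mu.-integrable setT (EFin \o (fun x => f x * cos (w * x + eta))).
Proof.
move=> fi; have mf : measurable_fun [set: R] f by apply/measurable_EFinP; case/integrableP: fi.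
apply: le_integrable fi => //.
  by apply/measurable_EFinP; apply: measurable_funM => //; exact: measurable_cos_affine.
by move=> x _; rewrite /= lee_fin normrM ler_piMr// cos_norm_le1.
Qed.

Lemma Rintegral_abel_cos (u th : R) :
  \int[mu]_x (abel d x * cos (u * x + th)) = cos th * poisson d u.
Proof.
rewrite Rintegral_split0; last first.
  apply: integrable_abelM; first exact: measurable_cos_affine.
  by move=> x; exact: cos_norm_le1.
transitivity (\int[mu]_(x in `[0, +oo[) (expR (- (d * x)) * cos (u * x + th)) +
    \int[mu]_(x in `[0, +oo[) (expR (- (d * x)) * cos (u * x + (- th)))).
  apply: f_equal2; apply: eq_Rintegral => x; rewrite inE/= in_itv/= andbT => x0.
    by rewrite /abel ger0_norm.
  by rewrite /abel normrN ger0_norm// -cosN; congr (_ * cos _); ring.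
rewrite !Rintegral_expR_cos_half cosN sinN /poisson.
have q0 := lt0r_neq0 (sqrD_gt0 u).
by field; rewrite q0.
Qed.

Lemma poisson_ge0 u : 0 <= poisson d u.
Proof. by rewrite divr_ge0 ?mulr_ge0 ?(ltW d0)// ltW// sqrD_gt0. Qed.

Lemma continuous_poisson : continuous (poisson d).
Proof.
move=> x; apply: cvgM; first exact: cvg_cst.
apply: cvgV; first exact: lt0r_neq0 (sqrD_gt0 x).
by apply: cvgD; [exact: cvg_cst|exact: sqr_continuous].
Qed.

Lemma measurable_poisson : measurable_fun [set: R] (poisson d).
Proof. exact: continuous_measurable_fun continuous_poisson. Qed.

Lemma integral_poisson (w : R) : (\int[mu]_s (poisson d (s - w))%:E = (2 * pi)%:E)%E.
Proof.
rewrite (@ge0_integral_addr R (- w) (EFin \o poisson d)); last 2 first.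
- by apply/measurable_EFinP; exact: measurable_poisson.
- by move=> x; rewrite lee_fin poisson_ge0.
rewrite (ge0_integral_split0 measurable_poisson poisson_ge0).
under [X in (_ + X)%E]eq_integral => x _ do rewrite /poisson sqrrN -/(poisson d x).
suff -> : (\int[mu]_(x in `[0%R, +oo[) (poisson d x)%:E = pi%:E)%E.
  by rewrite -EFinD; congr (_%:E); ring.
have dn0 := lt0r_neq0 d0.
transitivity ((pi - 2 * atan (d^-1 * 0))%:E); last by rewrite mulr0 atan0 mulr0 subr0.
apply: (@ge0_FTC2y _ _ (fun x => 2 * atan (d^-1 * x))) => //.
- by move=> x _; exact: poisson_ge0.
- exact: continuous_poisson.
- move=> x.
  have [h] : (d ^+ 2 + x ^+ 2 != 0) /\ (1 + (d^-1 * x) ^+ 2 != 0).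
    split; first exact: lt0r_neq0 (sqrD_gt0 x).
    by rewrite lt0r_neq0// ltr_pwDl// sqr_ge0.
  move=> h2; apply: is_derive_eq; rewrite /GRing.scale/= /poisson.
  by field; rewrite dn0 h.
- have : atan (d^-1 * x) @[x --> +oo] --> (pi / 2 : R).
    apply: (@cvg_comp _ _ _ (fun x => d^-1 * x) atan _ _ _ _ (@cvgy_atan R)).
    by apply: gt0_cvgMry; rewrite ?invr_gt0 //; exact: cvg_id.
  move=> h; have := cvgM (cvg_cst (2:R)) h.
  by rewrite (_ : 2 * (pi / 2) = pi :> R); [apply|field].
Qed.

End kernel.

(** * Monotonicity, Fubini and Abel summation *)

Section monotone.
Context d (T : measurableType d) (R : realType) (m : {measure set T -> \bar R}).

(** The integral of a non-negative function is a supremum over the simple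
    functions below it, whence monotonicity without any measurability. *)
Lemma ge0_le_integral_nomeas (D : set T) (f g : T -> \bar R) :
  (forall x, D x -> 0 <= f x)%E -> (forall x, D x -> f x <= g x)%E ->
  (\int[m]_(x in D) f x <= \int[m]_(x in D) g x)%E.
Proof.
move=> f0 fg.
have g0 x : D x -> (0 <= g x)%E by move=> Dx; exact: le_trans (f0 _ Dx) (fg _ Dx).
rewrite integral_mkcond [leRHS]integral_mkcond.
rewrite !ge0_integralTE; [|by move=> x; exact: erestrict_ge0..].
apply: ereal_sup_le => _ [h /= hf <-]; exists h => //= x.
apply: (le_trans (hf x)); rewrite !patchE; case: ifPn => // /[!inE] Dx.
exact: fg.
Qed.
End monotone.

Section real_fubini.
Context d1 d2 (T1 : measurableType d1) (T2 : measurableType d2) (R : realType).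
Variables (m1 : {sigma_finite_measure set T1 -> \bar R})
          (m2 : {sigma_finite_measure set T2 -> \bar R}).

Lemma measurable_Rintegral_param (k : T1 * T2 -> R) : measurable_fun setT k ->
  measurable_fun setT (fun x => \int[m2]_y k (x, y)).
Proof.
move=> mk.
have mEk : measurable_fun setT (EFin \o k) by exact/measurable_EFinP.
have -> : (fun x => \int[m2]_y k (x, y)) = fine \o (fun x =>
    (\int[m2]_y (EFin \o k)^\+ (x, y) - \int[m2]_y (EFin \o k)^\- (x, y))%E).
  apply/funext => x; rewrite /Rintegral /=; congr fine.
  rewrite integralE; congr (_ - _)%E; apply: eq_integral => y _.
    by rewrite !funeposE.
  by rewrite !funenegE.
apply: measurableT_comp => //; apply: emeasurable_funB.
  apply: (@measurable_fun_fubini_tonelli_F _ _ _ _ _ m2) => //.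
  exact: measurable_funepos.
apply: (@measurable_fun_fubini_tonelli_F _ _ _ _ _ m2) => //.
exact: measurable_funeneg.
Qed.

Variables (p : T1 -> R) (q : T2 -> R) (b : T1 * T2 -> R).
Hypotheses (ip : m1.-integrable setT (EFin \o p))
           (iq : m2.-integrable setT (EFin \o q))
           (mb : measurable_fun setT b) (b1 : forall z, `|b z| <= 1).

Let mp : measurable_fun setT p.
Proof. by apply/measurable_EFinP; case/integrableP: ip. Qed.
Let mq : measurable_fun setT q.
Proof. by apply/measurable_EFinP; case/integrableP: iq. Qed.

Let k z := p z.1 * (q z.2 * b z).

Let mk : measurable_fun setT k.
Proof.
apply: measurable_funM.
  exact: (measurableT_comp mp (@measurable_fst _ _ _ _)).
apply: measurable_funM => //.
exact: (measurableT_comp mq (@measurable_snd _ _ _ _)).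
Qed.

Lemma integrable_tensor : (m1 \x m2)%E.-integrable setT (EFin \o k).
Proof.
apply/integrable12ltyP; first exact/measurable_EFinP.
apply: (@le_lt_trans _ _ (\int[m1]_x (`|p x|%:E * \int[m2]_y `|q y|%:E))%E).
  apply: ge0_le_integral_nomeas => [x _|x _]; first exact: integral_ge0.
  rewrite -ge0_integralZl//; last exact/measurable_EFinP/measurableT_comp.
  apply: ge0_le_integral_nomeas => y _; first by rewrite abse_ge0.
  rewrite /k /= !normrM lee_fin ler_wpM2l ?normr_ge0//.
  by rewrite ler_piMr ?normr_ge0.
rewrite ge0_integralZr//; last first.
- by apply: integral_ge0.
- exact/measurable_EFinP/measurableT_comp.
rewrite lte_mul_pinfty//.
- exact: integral_ge0.
- by case/integrableP: ip => ? h; rewrite ge0_fin_numE//; exact: integral_ge0.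
- by case/integrableP: iq.
Qed.

Let iqb x : m2.-integrable setT (EFin \o (fun y => q y * b (x, y))).
Proof.
apply: le_integrable iq => //.
  apply/measurable_EFinP; apply: measurable_funM => //.
  exact: (measurableT_comp mb (measurable_pair1 x)).
by move=> y _; rewrite /= lee_fin normrM ler_piMr.
Qed.

Let ipb y : m1.-integrable setT (EFin \o (fun x => p x * b (x, y))).
Proof.
apply: le_integrable ip => //.
  apply/measurable_EFinP; apply: measurable_funM => //.
  exact: (measurableT_comp mb (measurable_pair2 y)).
by move=> x _; rewrite /= lee_fin normrM ler_piMr.
Qed.

Let innerE x : (p x * \int[m2]_y (q y * b (x, y)))%:E = (\int[m2]_y (k (x, y))%:E)%E.
Proof.
rewrite -RintegralZl// /Rintegral fineK//.
apply: integrable_fin_num => //.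
have := integrableZl measurableT (p x) (iqb x).
by apply: eq_integrable.
Qed.

Lemma integrable_inner :
  m1.-integrable setT (EFin \o (fun x => p x * \int[m2]_y (q y * b (x, y)))).
Proof.
have := integrable_fubini_F integrable_tensor.
by apply: eq_integrable => // x _; rewrite /= innerE.
Qed.

(** All exchanges of real-valued integrals below have this form: two integrable
    factors and a bounded kernel, most often a cosine. *)
Lemma Rfubini : \int[m1]_x (p x * \int[m2]_y (q y * b (x, y))) =
  \int[m2]_y (q y * \int[m1]_x (p x * b (x, y))).
Proof.
rewrite /Rintegral; congr fine.
under eq_integral => x _ do rewrite innerE.
rewrite (Fubini integrable_tensor); apply: eq_integral => y _.
rewrite -[RHS]/((q y * \int[m1]_x (p x * b (x, y)))%:E) -RintegralZl// /Rintegral fineK.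
  by apply: eq_integral => x _; rewrite /k /=; congr (_%:E); ring.
apply: integrable_fin_num => //.
have := integrableZl measurableT (q y) (ipb y).
by apply: eq_integrable.
Qed.

End real_fubini.

Section abel_summation.
Context {R : realType}.
Local Notation mu := (@lebesgue_measure R).

Definition abel_scale (n : nat) : R := n.+1%:R^-1.

Lemma abel_scale_gt0 n : 0 < abel_scale n. Proof. by rewrite invr_gt0. Qed.

Lemma cvg_abel_scale : abel_scale n @[n --> \oo] --> 0.
Proof. exact: cvg_harmonic. Qed.

Lemma cvg_abel_pt (x : R) : abel (abel_scale n) x @[n --> \oo] --> (1:R).
Proof.
rewrite -expR0; apply: (@cvg_comp _ _ _ (fun n => - (abel_scale n * `|x|)) expR _ (nbhs 0)).
  have := cvgM cvg_abel_scale (cvg_cst `|x|); rewrite mul0r => h.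
  by have := @cvgN _ R^o _ _ _ _ _ (h _ _); rewrite oppr0; apply.
exact: continuous_expR.
Qed.

(** Removes the regularising factor at the end of a computation, by dominated
    convergence. *)
Lemma cvg_abel (D : set R) (f : R -> R) : measurable D ->
  mu.-integrable D (EFin \o f) ->
  \int[mu]_(x in D) (abel (abel_scale n) x * f x) @[n --> \oo] --> \int[mu]_(x in D) f x.
Proof.
move=> mD fi.
have mf : measurable_fun D f by apply/measurable_EFinP; case/integrableP: fi.
apply: fine_cvg; rewrite fineK; last by apply: integrable_fin_num.
apply: (@dominated_cvg _ _ _ mu D mD
  (fun n x => (abel (abel_scale n) x * f x)%:E) (EFin \o f) (fun x => (`|f x|)%:E)) => //.
- move=> n; apply/measurable_EFinP; apply: measurable_funM => //.
  apply: measurable_funTS; exact: measurable_abel.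
- move=> x Dx; apply: cvg_EFin; first by apply: nearW.
  have := cvgM (@cvg_abel_pt x) (cvg_cst (f x)); rewrite mul1r; apply.
- exact: integrable_norm.
- move=> n x Dx; rewrite /= lee_fin normrM ger0_norm ?abel_ge0//.
  by rewrite ler_piMl// abel_le1// abel_scale_gt0.
Qed.

End abel_summation.

(** * Cosine transforms *)

Section real_linearity.
Context {R : realType}.
Local Notation mu := (@lebesgue_measure R).

Lemma integrable_addf (f g : R -> R) : mu.-integrable setT (EFin \o f) ->
  mu.-integrable setT (EFin \o g) -> mu.-integrable setT (EFin \o (fun x => f x + g x)).
Proof. by move=> fi gi; have := integrableD measurableT fi gi; apply: eq_integrable. Qed.

Lemma integrable_scalef (r : R) (f : R -> R) : mu.-integrable setT (EFin \o f) ->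
  mu.-integrable setT (EFin \o (fun x => r * f x)).
Proof. by move=> fi; have := integrableZl measurableT r fi; apply: eq_integrable. Qed.

Lemma Rintegral_addf (f g : R -> R) : mu.-integrable setT (EFin \o f) ->
  mu.-integrable setT (EFin \o g) ->
  \int[mu]_x (f x + g x) = \int[mu]_x f x + \int[mu]_x g x.
Proof. by move=> fi gi; rewrite RintegralD. Qed.

Lemma Rintegral_scalef (r : R) (f : R -> R) : mu.-integrable setT (EFin \o f) ->
  \int[mu]_x (r * f x) = r * \int[mu]_x f x.
Proof. by move=> fi; rewrite RintegralZl. Qed.

End real_linearity.

Section cosine_transform.
Context {R : realType}.
Local Notation mu := (@lebesgue_measure R).

(** The phases [th = 0] and [th = - (pi / 2)] give the cosine and the sine transform. *)
Definition cosT (chi : R -> R) (th x : R) : R :=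
  \int[mu]_s (chi s * cos (s * x + th)).

(** The regularised correlation of two cosines, of frequencies [s] and [w] and phases
    [th] and [eta]; see [Rintegral_abel_coscos]. *)
Definition coskernel (d th eta s w : R) : R :=
  2^-1 * (cos (th - eta) * poisson d (s - w) + cos (th + eta) * poisson d (s + w)).

(** Dominates [coskernel] for all phases, and has mass [2 * pi] in either frequency. *)
Definition poisson_sym (d s w : R) : R :=
  2^-1 * (poisson d (s - w) + poisson d (s + w)).

Lemma measurable_cos2 (th : R) :
  measurable_fun [set: R * R] (fun z : R * R => cos (z.2 * z.1 + th)).
Proof.
apply: (measurableT_comp (continuous_measurable_fun (@continuous_cos R))).
apply: measurable_funD => //; apply: measurable_funM.
  exact: measurable_snd.
exact: measurable_fst.
Qed.

Lemma measurable_cosT (chi : R -> R) (th : R) : measurable_fun [set: R] chi ->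
  measurable_fun [set: R] (cosT chi th).
Proof.
move=> mchi.
apply: (@measurable_Rintegral_param _ _ (measurableTypeR R) (measurableTypeR R) R mu
  (fun z => chi z.2 * cos (z.2 * z.1 + th))).
apply: measurable_funM; last exact: measurable_cos2.
exact: (measurableT_comp mchi (@measurable_snd _ _ _ _)).
Qed.

Lemma cos_mul (a b : R) : cos a * cos b = 2^-1 * (cos (a - b) + cos (a + b)).
Proof. by rewrite cosB cosD; field. Qed.

Lemma Rintegral_abel_coscos (d th eta s w : R) : 0 < d ->
  \int[mu]_x (abel d x * (cos (s * x + th) * cos (w * x + eta))) =
  coskernel d th eta s w.
Proof.
move=> d0.
have i (u ph : R) : mu.-integrable setT (EFin \o (fun x => abel d x * cos (u * x + ph))).
  apply: integrable_abelM => //; first exact: measurable_cos_affine.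
  by move=> x; exact: cos_norm_le1.
transitivity (\int[mu]_x (2^-1 * (abel d x * cos ((s - w) * x + (th - eta)) +
    abel d x * cos ((s + w) * x + (th + eta))))).
  apply: eq_Rintegral => x _; rewrite cos_mul.
  rewrite (_ : s * x + th - (w * x + eta) = (s - w) * x + (th - eta)); last by ring.
  rewrite (_ : s * x + th + (w * x + eta) = (s + w) * x + (th + eta)); last by ring.
  by ring.
rewrite (@Rintegral_scalef R 2^-1 (fun x => abel d x * cos ((s - w) * x + (th - eta)) +
    abel d x * cos ((s + w) * x + (th + eta)))); last exact: integrable_addf.
by rewrite Rintegral_addf// !Rintegral_abel_cos.
Qed.

Lemma poisson_sym_ge0 (d s w : R) : 0 < d -> 0 <= poisson_sym d s w.
Proof. by move=> d0; rewrite mulr_ge0 ?invr_ge0// addr_ge0 ?poisson_ge0. Qed.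

Lemma poisson_symC (d s w : R) : poisson_sym d s w = poisson_sym d w s.
Proof. by rewrite /poisson_sym /poisson -(opprB s w) sqrrN (addrC s w). Qed.

Lemma coskernel_le (d th eta s w : R) : 0 < d ->
  `|coskernel d th eta s w| <= poisson_sym d s w.
Proof.
move=> d0; rewrite normrM ger0_norm ?invr_ge0// ler_wpM2l ?invr_ge0//.
rewrite (le_trans (ler_normD _ _))// lerD// normrM (ger0_norm (poisson_ge0 _ _))//;
  by rewrite ler_piMl ?poisson_ge0// cos_norm_le1.
Qed.

Lemma measurable_poisson_sym (d w : R) : 0 < d ->
  measurable_fun [set: R] (fun s => poisson_sym d s w).
Proof.
move=> d0; apply: measurable_funM => //; apply: measurable_funD.
  by apply: (measurableT_comp (measurable_poisson d0)); exact: measurable_funB.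
by apply: (measurableT_comp (measurable_poisson d0)); exact: measurable_funD.
Qed.

Lemma integral_poisson_sym (d w : R) : 0 < d ->
  (\int[mu]_s (poisson_sym d s w)%:E = (2 * pi)%:E)%E.
Proof.
move=> d0; rewrite /poisson_sym.
have m1 : measurable_fun [set: R] (fun s => poisson d (s - w)).
  by apply: (measurableT_comp (measurable_poisson d0)); exact: measurable_funB.
have m2 : measurable_fun [set: R] (fun s => poisson d (s + w)).
  by apply: (measurableT_comp (measurable_poisson d0)); exact: measurable_funD.
under eq_integral => s _ do rewrite EFinM EFinD.
rewrite ge0_integralZl//; last 2 first.
- by apply: emeasurable_funD; exact/measurable_EFinP.
- by move=> x _; rewrite adde_ge0// lee_fin poisson_ge0.
rewrite ge0_integralD//; last 4 first.
- by move=> x _; rewrite lee_fin poisson_ge0.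
- exact/measurable_EFinP.
- by move=> x _; rewrite lee_fin poisson_ge0.
- exact/measurable_EFinP.
rewrite (integral_poisson d0).
have -> : (\int[mu]_x (poisson d (x + w))%:E = (2 * pi)%:E)%E.
  by rewrite -(integral_poisson d0 (- w)); apply: eq_integral => x _; rewrite opprK.
by rewrite -EFinD -EFinM; congr (_%:E); field.
Qed.

Variable chi : R -> R.
Hypothesis ichi : mu.-integrable setT (EFin \o chi).

Let mchi : measurable_fun [set: R] chi.
Proof. by apply/measurable_EFinP; case/integrableP: ichi. Qed.

Lemma integrable_cosT_term (th x : R) :
  mu.-integrable setT (EFin \o (fun s => chi s * cos (s * x + th))).
Proof.
by have := integrable_mul_cos x th ichi; apply: eq_integrable => // s _; rewrite /= (mulrC x).
Qed.

(** Exchanging the integrals turns the pairing of a transform with a cosine into an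
    average of [chi] against kernels that concentrate at [w] and [- w]. *)
Lemma cosT_pairing (d th eta w : R) : 0 < d ->
  \int[mu]_x (abel d x * (cosT chi th x * cos (w * x + eta))) =
  \int[mu]_s (chi s * coskernel d th eta s w).
Proof.
move=> d0.
pose b (z : R * R) := cos (z.2 * z.1 + th) * cos (w * z.1 + eta).
have mb : measurable_fun [set: R * R] b.
  apply: measurable_funM; first exact: measurable_cos2.
  exact: (measurableT_comp (measurable_cos_affine w eta) (@measurable_fst _ _ _ _)).
have b1 z : `|b z| <= 1.
  by rewrite normrM -[leRHS]mulr1 ler_pM// cos_norm_le1.
have := @Rfubini _ _ (measurableTypeR R) (measurableTypeR R) R mu mu (abel d) chi b
  (integrable_abel d0) ichi mb b1.
rewrite /b /= => h.
transitivity (\int[mu]_x (abel d x *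
  \int[mu]_s (chi s * (cos (s * x + th) * cos (w * x + eta))))).
  apply: eq_Rintegral => x _; congr (_ * _).
  rewrite mulrC -Rintegral_scalef; last exact: integrable_cosT_term.
  by apply: eq_Rintegral => s _; ring.
rewrite h; apply: eq_Rintegral => s _.
by rewrite -Rintegral_abel_coscos.
Qed.

Lemma integrable_abel_cosT (d th : R) : 0 < d ->
  mu.-integrable setT (EFin \o (fun x => abel d x * cosT chi th x)).
Proof.
move=> d0; apply: (@integrable_inner _ _ (measurableTypeR R) (measurableTypeR R) R mu mu
  (abel d) chi (fun z => cos (z.2 * z.1 + th)) (integrable_abel d0) ichi).
  exact: measurable_cos2.
by move=> z; exact: cos_norm_le1.
Qed.

End cosine_transform.

(** * Fourier inversion bound and Plancherel inequality *)

Section double_integral.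
Context d1 d2 (T1 : measurableType d1) (T2 : measurableType d2) (R : realType).
Variables (m1 : {sigma_finite_measure set T1 -> \bar R})
          (m2 : {sigma_finite_measure set T2 -> \bar R}).

Lemma ge0_double_integralD (f g : T1 * T2 -> \bar R) :
  measurable_fun setT f -> measurable_fun setT g ->
  (forall z, 0 <= f z)%E -> (forall z, 0 <= g z)%E ->
  (\int[m1]_s \int[m2]_t (f (s, t) + g (s, t)) =
   \int[m1]_s \int[m2]_t f (s, t) + \int[m1]_s \int[m2]_t g (s, t))%E.
Proof.
move=> mf mg f0 g0; rewrite -ge0_integralD//.
- apply: eq_integral => s _; apply: ge0_integralD => //.
  + exact: (measurableT_comp mf (measurable_pair1 s)).
  + exact: (measurableT_comp mg (measurable_pair1 s)).
- by move=> x _; exact: integral_ge0.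
- exact: (measurable_fun_fubini_tonelli_F (m2 := m2)).
- by move=> x _; exact: integral_ge0.
- exact: (measurable_fun_fubini_tonelli_F (m2 := m2)).
Qed.

End double_integral.

Section norm_integral.
Context d (T : measurableType d) (R : realType) (m : {measure set T -> \bar R}).

Lemma normr_Rintegral_le (f : T -> R) : measurable_fun setT f ->
  ((`|\int[m]_x f x|)%:E <= \int[m]_x (`|f x|)%:E)%E.
Proof.
move=> mf; have := le_abse_integral m measurableT ((measurable_EFinP _ _).2 mf).
apply: le_trans; rewrite /Rintegral.
by case: (integral _ _ _) => [r| |] //=; rewrite normr0 leey.
Qed.

Lemma ge0_integral_scale_norm (r : R) (f : T -> R) : measurable_fun setT f -> 0 <= r ->
  (r%:E * \int[m]_x (`|f x|)%:E = \int[m]_x (r * `|f x|)%:E)%E.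
Proof.
move=> mf r0; rewrite -ge0_integralZl_EFin//.
by apply/measurable_EFinP; exact: measurableT_comp.
Qed.

End norm_integral.

Section fourier_bounds.
Context {R : realType}.
Local Notation mu := (@lebesgue_measure R).

Lemma measurable_coskernel (d th eta w : R) : 0 < d ->
  measurable_fun [set: R] (fun s => coskernel d th eta s w).
Proof.
move=> d0; apply: measurable_funM => //; apply: measurable_funD; apply: measurable_funM => //.
  by apply: (measurableT_comp (measurable_poisson d0)); exact: measurable_funB.
by apply: (measurableT_comp (measurable_poisson d0)); exact: measurable_funD.
Qed.

Lemma integrable_poisson_sym (d w : R) : 0 < d ->
  mu.-integrable setT (EFin \o (fun s => poisson_sym d s w)).
Proof.
move=> d0; apply: ge0_fin_integrable (integral_poisson_sym w d0) => //.
  exact: measurable_poisson_sym.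
by move=> x _; exact: poisson_sym_ge0.
Qed.

Lemma poisson_far (d r u : R) : 0 < d -> 0 < r -> r <= `|u| -> poisson d u <= 2 * d / r ^+ 2.
Proof.
move=> d0 r0 ru; rewrite /poisson ler_pM2l ?mulr_gt0// lef_pV2 ?posrE ?sqrD_gt0 ?exprn_gt0//.
have : r ^+ 2 <= u ^+ 2 by rewrite -[u ^+ 2]real_normK ?num_real// ler_sqr ?nnegrE ?(ltW r0).
by have := exprn_gt0 2 d0; lra.
Qed.

(** Near [w] and [- w] the function is bounded by [b] and the kernel has mass at most
    [2 * pi]; further away the kernel is O(d). *)
Lemma Rintegral_coskernel_bound (chi : R -> R) (d th eta w b r : R) :
  0 < d -> 0 < r -> 0 <= b ->
  mu.-integrable setT (EFin \o chi) ->
  (forall s, `|s - w| < r \/ `|s + w| < r -> `|chi s| <= b) ->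
  `| \int[mu]_s (chi s * coskernel d th eta s w) | <=
    2 * pi * b + 2 * d / r ^+ 2 * \int[mu]_s `|chi s|.
Proof.
move=> d0 r0 b0 ichi chib.
have mchi : measurable_fun [set: R] chi by apply/measurable_EFinP; case/integrableP: ichi.
have i1 := integrable_scalef b (integrable_poisson_sym w d0).
have ini : mu.-integrable setT (EFin \o (fun s => `|chi s|)) by exact: (integrable_norm ichi).
have i2 := integrable_scalef (2 * d / r ^+ 2) ini.
have pt s : `|chi s * coskernel d th eta s w| <=
    b * poisson_sym d s w + 2 * d / r ^+ 2 * `|chi s|.
  have c0 : 0 <= 2 * d / r ^+ 2 by rewrite divr_ge0 ?mulr_ge0 ?exprn_ge0 ?ltW.
  rewrite normrM; have [near|far] := boolP ((`|s - w| < r) || (`|s + w| < r)).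
    rewrite (@le_trans _ _ (b * poisson_sym d s w))//; last by rewrite lerDl mulr_ge0.
    by rewrite ler_pM// ?coskernel_le//; apply: chib; exact/orP.
  rewrite (@le_trans _ _ (2 * d / r ^+ 2 * `|chi s|))//; last first.
    by rewrite lerDr mulr_ge0// poisson_sym_ge0.
  rewrite mulrC ler_wpM2r ?normr_ge0// (le_trans (coskernel_le _ _ _ _ d0))//.
  move: far; rewrite negb_or -!leNgt => /andP[h1 h2].
  have := poisson_far d0 r0 h1; have := poisson_far d0 r0 h2.
  by rewrite /poisson_sym; lra.
have i12 := integrable_addf i1 i2.
have ii : mu.-integrable setT (EFin \o (fun s => chi s * coskernel d th eta s w)).
  apply: le_integrable i12 => //.
    by apply/measurable_EFinP; apply: measurable_funM => //; exact: measurable_coskernel.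
  by move=> s _; rewrite /= lee_fin (le_trans (pt s))// ler_norm.
rewrite (le_trans (le_normr_Rintegral _ ii))//.
rewrite (@le_trans _ _ (\int[mu]_s (b * poisson_sym d s w + 2 * d / r ^+ 2 * `|chi s|)))//.
  by apply: le_Rintegral => //; exact: (integrable_norm ii).
rewrite (Rintegral_addf i1 i2) (Rintegral_scalef _ (integrable_poisson_sym w d0)).
rewrite (Rintegral_scalef _ ini) lerD2r.
by rewrite /Rintegral integral_poisson_sym//= mulrC.
Qed.

(** A form of Fourier inversion: the transform of [cosT chi th] at [w] depends on
    [chi] near [w] and [- w] only. *)
Lemma cosT_fourier_bound (chi : R -> R) (th eta w b r : R) :
  0 < r -> 0 <= b ->
  mu.-integrable setT (EFin \o chi) ->
  mu.-integrable setT (EFin \o cosT chi th) ->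
  (forall s, `|s - w| < r \/ `|s + w| < r -> `|chi s| <= b) ->
  `| \int[mu]_x (cosT chi th x * cos (w * x + eta)) | <= 2 * pi * b.
Proof.
move=> r0 b0 ichi iT chib.
have iTc := integrable_mul_cos w eta iT.
have cv := cvg_abel measurableT iTc.
have cvn := cvg_norm cv.
have cu : 2 * pi * b + 2 * abel_scale n / r ^+ 2 * \int[mu]_s `|chi s| @[n --> \oo]
    --> (2 * pi * b : R).
  rewrite -[X in _ --> X]addr0; apply: cvgD; first exact: cvg_cst.
  pose K := 2 / r ^+ 2 * \int[mu]_s `|chi s|.
  have := cvgM (@cvg_abel_scale R) (cvg_cst K); rewrite mul0r => h.
  rewrite [X in X @ _ --> _](_ : _ = (fun n => abel_scale n * K)); first exact: (h _ _).
  by apply/funext => n; rewrite /K; ring.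
apply: ler_cvg_to (cvn _) cu _; apply: nearW => n.
rewrite cosT_pairing ?abel_scale_gt0//.
by apply: Rintegral_coskernel_bound; rewrite ?abel_scale_gt0.
Qed.

End fourier_bounds.

Section plancherel.
Context {R : realType}.
Local Notation mu := (@lebesgue_measure R).
Variables (u : R -> R) (th : R).
Hypotheses (iu : mu.-integrable setT (EFin \o u))
  (iu2 : mu.-integrable setT (EFin \o (fun s => u s ^+ 2))).

Let mmu : measurable_fun [set: R] u.
Proof. by apply/measurable_EFinP; case/integrableP: iu. Qed.

Let S := \int[mu]_s (u s ^+ 2).

Let SE : (\int[mu]_s (u s ^+ 2)%:E = S%:E)%E.
Proof. by rewrite /S /Rintegral fineK//; exact: integrable_fin_num. Qed.

Lemma measurable_poisson_sym2 (d : R) : 0 < d ->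
  measurable_fun [set: R * R] (fun z : R * R => poisson_sym d z.1 z.2).
Proof.
move=> d0; apply: measurable_funM => //; apply: measurable_funD.
  apply: (measurableT_comp (measurable_poisson d0)); apply: measurable_funB.
    exact: measurable_fst.
  exact: measurable_snd.
apply: (measurableT_comp (measurable_poisson d0)); apply: measurable_funD.
  exact: measurable_fst.
exact: measurable_snd.
Qed.

Lemma measurable_coskernel2 (d : R) : 0 < d ->
  measurable_fun [set: R * R] (fun z : R * R => coskernel d th th z.2 z.1).
Proof.
move=> d0; apply: measurable_funM => //; apply: measurable_funD;
  apply: measurable_funM => //; apply: (measurableT_comp (measurable_poisson d0)).
  by apply: measurable_funB; [exact: measurable_snd|exact: measurable_fst].
by apply: measurable_funD; [exact: measurable_snd|exact: measurable_fst].
Qed.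

Let half (d : R) : 0 < d -> (\int[mu]_s \int[mu]_t
   (2^-1 * (u s ^+ 2 * poisson_sym d s t))%:E = (pi * S)%:E)%E.
Proof.
move=> d0.
transitivity (\int[mu]_s ((u s ^+ 2)%:E * pi%:E))%E; last first.
  rewrite ge0_integralZr//; last 3 first.
  - by apply/measurable_EFinP; exact: measurable_funX.
  - by move=> x _; rewrite lee_fin sqr_ge0.
  - by rewrite lee_fin pi_ge0.
  by rewrite SE -EFinM mulrC.
apply: eq_integral => s _.
under eq_integral => t _ do rewrite mulrA EFinM poisson_symC.
rewrite ge0_integralZl//; last 3 first.
- by apply/measurable_EFinP; exact: measurable_poisson_sym.
- by move=> x _; rewrite lee_fin poisson_sym_ge0.
- by rewrite lee_fin mulr_ge0 ?sqr_ge0 ?invr_ge0.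
by rewrite integral_poisson_sym// -!EFinM; congr (_%:E); field.
Qed.

(** The left-hand side is a quadratic form in [u] with Poisson kernels as
    coefficients.  As [2 * u s * u t <= u s ^+ 2 + u t ^+ 2] and the kernels have
    mass [2 * pi], it is bounded as in the Schur test. *)
Lemma abel_cosT_sqr_le (d : R) : 0 < d ->
  (\int[mu]_x (abel d x * cosT u th x ^+ 2)%:E <= (2 * pi * S)%:E)%E.
Proof.
move=> d0.
have iaT := integrable_abel_cosT iu th d0.
pose A := \int[mu]_x ((abel d x * cosT u th x) * cosT u th x).
have mc : measurable_fun [set: R * R] (fun z : R * R => cos (z.2 * z.1 + th)).
  exact: measurable_cos2.
have c1 (z : R * R) : `|cos (z.2 * z.1 + th)| <= 1 by exact: cos_norm_le1.
have iA := @integrable_inner _ _ (measurableTypeR R) (measurableTypeR R) R mu mu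
  _ _ _ iaT iu mc c1.
have fA := @Rfubini _ _ (measurableTypeR R) (measurableTypeR R) R mu mu
  _ _ _ iaT iu mc c1.
pose f1 (z : R * R) := 2^-1 * (u z.1 ^+ 2 * poisson_sym d z.1 z.2).
pose f2 (z : R * R) := 2^-1 * (u z.2 ^+ 2 * poisson_sym d z.1 z.2).
have f10 z : 0 <= f1 z by rewrite mulr_ge0 ?invr_ge0// mulr_ge0 ?sqr_ge0 ?poisson_sym_ge0.
have f20 z : 0 <= f2 z by rewrite mulr_ge0 ?invr_ge0// mulr_ge0 ?sqr_ge0 ?poisson_sym_ge0.
have mf1 : measurable_fun [set: R * R] f1.
  apply: measurable_funM => //; apply: measurable_funM; last exact: measurable_poisson_sym2.
  by apply: measurable_funX; exact: (measurableT_comp mmu (@measurable_fst _ _ _ _)).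
have mf2 : measurable_fun [set: R * R] f2.
  apply: measurable_funM => //; apply: measurable_funM; last exact: measurable_poisson_sym2.
  by apply: measurable_funX; exact: (measurableT_comp mmu (@measurable_snd _ _ _ _)).
have total : (\int[mu]_s \int[mu]_t (f1 (s, t) + f2 (s, t))%:E = (2 * pi * S)%:E)%E.
  have h := @ge0_double_integralD _ _ (measurableTypeR R) (measurableTypeR R) R mu mu
    (EFin \o f1) (EFin \o f2) ((measurable_EFinP _ _).2 mf1) ((measurable_EFinP _ _).2 mf2)
    f10 f20.
  rewrite (_ : (2 * pi * S)%:E = ((pi * S)%:E + (pi * S)%:E)%E); last first.
    by rewrite -EFinD; congr (_%:E); ring.
  apply: (etrans h); apply: f_equal2; first exact: half.
  rewrite (@fubini_tonelli _ _ (measurableTypeR R) (measurableTypeR R) R mu mu (EFin \o f2)).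
  - rewrite -(half d0); apply: eq_integral => s _; apply: eq_integral => t _.
    by rewrite /= /f2/= poisson_symC.
  - exact/measurable_EFinP.
  - by move=> x; rewrite lee_fin.
have innerE s : \int[mu]_x ((abel d x * cosT u th x) * cos (s * x + th)) =
    \int[mu]_t (u t * coskernel d th th t s).
  rewrite -(cosT_pairing iu th th s d0).
  by apply: eq_Rintegral => x _; rewrite mulrA.
have -> : (\int[mu]_x (abel d x * cosT u th x ^+ 2)%:E = A%:E)%E.
  rewrite /A /Rintegral fineK; last first.
    by apply: integrable_fin_num => //; exact: iA.
  by apply: eq_integral => x _; congr (_%:E); ring.
have -> : A = \int[mu]_s (u s * \int[mu]_t (u t * coskernel d th th t s)).
  rewrite /A; transitivity (\int[mu]_s (u s *
    \int[mu]_x ((abel d x * cosT u th x) * cos (s * x + th)))).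
    exact: fA.
  by apply: eq_Rintegral => s _; rewrite innerE.
rewrite -total.
have mI s : measurable_fun [set: R] (fun t => u t * coskernel d th th t s).
  by apply: measurable_funM; [exact: mmu|exact: measurable_coskernel].
have mB : measurable_fun [set: R] (fun s => u s * \int[mu]_t (u t * coskernel d th th t s)).
  apply: measurable_funM; first exact: mmu.
  apply: (@measurable_Rintegral_param _ _ (measurableTypeR R) (measurableTypeR R) R mu
    (fun z => u z.2 * coskernel d th th z.2 z.1)).
  apply: measurable_funM.
    exact: (measurableT_comp mmu (@measurable_snd _ _ _ _)).
  exact: measurable_coskernel2.
apply: (le_trans _ (le_trans (normr_Rintegral_le mu mB) _)).
  by rewrite lee_fin ler_norm.
apply: ge0_le_integral_nomeas => [s _|s _]; first by rewrite lee_fin.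
rewrite normrM EFinM.
apply: (le_trans (lee_wpmul2l _ (normr_Rintegral_le mu (mI s)))); first by rewrite lee_fin.
rewrite (ge0_integral_scale_norm mu (mI s) (normr_ge0 _)).
apply: ge0_le_integral_nomeas => t _; first by rewrite lee_fin mulr_ge0.
rewrite lee_fin /f1 /f2 /= normrM mulrA.
apply: (@le_trans _ _ (`|u s| * `|u t| * poisson_sym d s t)).
  by rewrite ler_wpM2l ?mulr_ge0// poisson_symC coskernel_le.
rewrite (_ : _ + _ = (2^-1 * (u s ^+ 2 + u t ^+ 2)) * poisson_sym d s t); last by ring.
rewrite ler_wpM2r ?poisson_sym_ge0//.
have := sqr_ge0 (`|u s| - `|u t|).
by rewrite -(real_normK (num_real (u s))) -(real_normK (num_real (u t))); lra.
Qed.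

(** The bound of [abel_cosT_sqr_le] does not depend on [d], and the regularised
    integrals increase to the left-hand side when [d] decreases to 0. *)
Lemma plancherel_le : (\int[mu]_x (cosT u th x ^+ 2)%:E <= (2 * pi * S)%:E)%E.
Proof.
have mT := measurable_cosT th mmu.
have cv : (\int[mu]_x (abel (abel_scale n) x * cosT u th x ^+ 2)%:E)%E @[n --> \oo] -->
    (\int[mu]_x (cosT u th x ^+ 2)%:E)%E.
  rewrite (_ : (\int[mu]_x (cosT u th x ^+ 2)%:E)%E = (\int[mu]_x
      (limn (fun n => (abel (abel_scale n) x * cosT u th x ^+ 2)%:E)))%E); last first.
    apply: eq_integral => x _; apply/esym/cvg_lim => //.
    apply: cvg_EFin; first by apply: nearW.
    have := cvgM (@cvg_abel_pt R x) (cvg_cst (cosT u th x ^+ 2)); rewrite mul1r.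
    by apply.
  apply: cvg_monotone_convergence => //.
  - move=> n; apply/measurable_EFinP; apply: measurable_funM; first exact: measurable_abel.
    exact: measurable_funX.
  - by move=> n x _; rewrite lee_fin mulr_ge0 ?abel_ge0 ?sqr_ge0.
  - move=> x _ n m nm; rewrite lee_fin ler_wpM2r ?sqr_ge0// ler_expR lerN2 ler_wpM2r//.
    by rewrite lef_pV2 ?posrE// ler_nat.
rewrite -(cvg_lim _ cv)//; apply: lime_le; first by apply/cvg_ex; eexists; exact: cv.
by apply: nearW => n; apply: abel_cosT_sqr_le; exact: abel_scale_gt0.
Qed.

End plancherel.

(** * Transforms of functions carried by a frequency band *)

Section band.
Context {R : realType}.
Local Notation mu := (@lebesgue_measure R).
Variable N : R.
Hypothesis N0 : 0 < N.

Definition band (v : R -> R) : R -> R := v \_ `[N, 2 * N].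

Lemma bandE v s : band v s = if (N <= s <= 2 * N) then v s else 0.
Proof.
by rewrite /band patchE mem_setE in_itv.
Qed.

Let N2 : N < 2 * N. Proof. by rewrite ltr_pMl// ltr1n. Qed.

Lemma Rintegral_band_mul (v c : R -> R) :
  \int[mu]_s (band v s * c s) = \int[mu]_(s in `[N, 2 * N]) (v s * c s).
Proof.
rewrite [RHS]Rintegral_mkcond; apply: eq_Rintegral => s _.
by rewrite /band !patchE; case: ifPn => //; rewrite mul0r.
Qed.

Lemma integrable_band_bound (v : R -> R) (B : R) : measurable_fun [set: R] v ->
  (forall s, N <= s <= 2 * N -> `|v s| <= B) ->
  mu.-integrable setT (EFin \o band v).
Proof.
move=> mv vB.
have -> : EFin \o band v = (EFin \o v) \_ `[N, 2 * N].
  by rewrite restrict_EFin.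
apply/integrable_restrict => //; rewrite setTI.
apply/integrableP; split.
  by apply/measurable_EFinP; exact: measurable_funTS.
apply: (@le_lt_trans _ _ (\int[mu]_(s in `[N, (2 * N)%R]) (cst B%:E) s)%E).
  apply: ge0_le_integral_nomeas => s /=; first by [].
  by rewrite in_itv/= => h; rewrite lee_fin; exact: vB.
rewrite integral_cst//= lebesgue_measure_itv/= lte_fin N2 -EFinD -EFinM.
exact: ltry.
Qed.

Lemma measurable_band (v : R -> R) : measurable_fun [set: R] v ->
  measurable_fun [set: R] (band v).
Proof.
by move=> mv; apply/(measurable_restrictT _ _).1 => //; exact: measurable_funTS.
Qed.

Lemma Rintegral_band_le (v : R -> R) (B : R) : measurable_fun [set: R] v ->
  (forall s, N <= s <= 2 * N -> `|v s| <= B) ->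
  `|\int[mu]_s band v s| <= N * B.
Proof.
move=> mv vB; have iv := integrable_band_bound mv vB.
rewrite (le_trans (le_normr_Rintegral _ iv))//.
have iB : mu.-integrable setT (EFin \o band (cst B)).
  by apply: (@integrable_band_bound _ `|B|).
apply: (@le_trans _ _ (\int[mu]_s band (cst B) s)).
  apply: le_Rintegral => //; first exact: (integrable_norm iv).
  by move=> s _; rewrite !bandE; case: ifPn => [/vB//|]; rewrite normr0.
have := Rintegral_band_mul (cst B) (cst 1).
under eq_Rintegral do rewrite mulr1.
move=> ->; rewrite (@eq_Rintegral _ _ _ _ _ (cst B)); last by move=> s _; rewrite mulr1.
have -> : \int[mu]_(x in `[N, 2 * N]) cst B x = B * fine (mu `[N, 2 * N]) by exact: Rintegral_cst.
rewrite lebesgue_measure_itv/= lte_fin N2/=.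
by rewrite (_ : B * (2 * N - N) = N * B); last ring.
Qed.

Lemma cosT_band_le (v : R -> R) (B th x : R) : measurable_fun [set: R] v ->
  (forall s, N <= s <= 2 * N -> `|v s| <= B) ->
  `|cosT (band v) th x| <= N * B.
Proof.
move=> mv vB.
have mvc : measurable_fun [set: R] (fun s => v s * cos (s * x + th)).
  apply: measurable_funM => //; have := measurable_cos_affine x th.
  by under [X in measurable_fun _ X -> _]eq_fun do rewrite mulrC.
have := @Rintegral_band_le (fun s => v s * cos (s * x + th)) B mvc.
rewrite (_ : \int[mu]_s band _ s = cosT (band v) th x).
  apply => s /vB h; rewrite normrM (le_trans _ h)// ler_piMr//.
  exact: cos_norm_le1.
apply: eq_Rintegral => s _; rewrite !bandE.
by case: ifPn => //; rewrite mul0r.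
Qed.

(** Multiplication of a transform by [x] is differentiation of the amplitude, with a
    phase shift; the boundary terms vanish with [v]. *)
Lemma cosT_by_parts (v v' : R -> R) (th x : R) :
  (forall s : R, is_derive s 1 v (v' s)) -> continuous v' ->
  v N = 0 -> v (2 * N) = 0 ->
  x * cosT (band v) th x = cosT (band v') (th + pi / 2) x.
Proof.
move=> dv cv' vN v2N.
have cv := is_derive_continuous dv.
have mv := continuous_measurable_fun cv.
have mv' := continuous_measurable_fun cv'.
pose F (s : R) := v s * sin (s * x + th).
pose f (s : R) := v' s * sin (s * x + th) + x * (v s * cos (s * x + th)).
have dF (s : R) : is_derive s 1 F (f s).
  apply: is_derive_eq; rewrite /GRing.scale/= !mulr1 /f; ring.
have cc (g : R -> R) : continuous g -> continuous (fun s : R => g (s * x + th)).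
  move=> cg s; apply: (@continuous_comp _ _ _ (fun s : R => s * x + th) g); last exact: cg.
  by apply: cvgD; [apply: cvgM; [exact: cvg_id|exact: cvg_cst]|exact: cvg_cst].
have cs := cc _ (@continuous_sin R); have co := cc _ (@continuous_cos R).
have c1 : continuous (fun s => v' s * sin (s * x + th)) by move=> s; apply: cvgM; [exact: cv'|exact: cs].
have c2 : continuous (fun s => x * (v s * cos (s * x + th))).
  by move=> s; apply: cvgM; [exact: cvg_cst|apply: cvgM; [exact: cv|exact: co]].
have c3 : continuous (fun s => v s * cos (s * x + th)) by move=> s; apply: cvgM; [exact: cv|exact: co].
have cf : continuous f by move=> s; apply: cvgD; [exact: c1|exact: c2].
have int_c (g : R -> R) : continuous g -> mu.-integrable `[N, 2 * N] (EFin \o g).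
  move=> cg; apply: continuous_compact_integrable; first exact: segment_compact.
  exact: continuous_subspaceT.
have := FTC2 N2 cf dF; rewrite /F vN v2N !mul0r subr0.
rewrite RintegralD//; [|exact: int_c|exact: int_c].
rewrite RintegralZl//; last exact: int_c.
move=> h; rewrite /cosT !Rintegral_band_mul.
transitivity (- \int[mu]_(s in `[N, 2 * N]) (v' s * sin (s * x + th))).
  by apply/eqP; rewrite -addr_eq0 addrC; apply/eqP.
rewrite -mulN1r -RintegralZl//; last exact: int_c.
apply: eq_Rintegral => s _; rewrite addrA cosDpihalf; ring.
Qed.

End band.

(** * The perturbing wave *)

Section bump.
Context {R : realType}.
Local Notation mu := (@lebesgue_measure R).
Variable N : R.
Hypothesis N1 : 1 <= N.

Let N0 : 0 < N. Proof. exact: lt_le_trans N1. Qed.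
Let Nn0 : N != 0. Proof. exact: lt0r_neq0. Qed.

(** The double zeros at [N] and [2 * N] leave no boundary terms in two integrations by
    parts; the scaling makes the k-th derivative O(N^-k). *)
Definition bump (s : R) : R := ((s - N) * (2 * N - s)) ^+ 2 / N ^+ 4.
Definition bump1 (s : R) : R :=
  2 * ((s - N) * (2 * N - s)) * ((2 * N - s) - (s - N)) / N ^+ 4.
Definition bump2 (s : R) : R :=
  (2 * ((2 * N - s) - (s - N)) ^+ 2 - 4 * ((s - N) * (2 * N - s))) / N ^+ 4.

Lemma is_derive_bump (s : R) : is_derive s 1 bump (bump1 s).
Proof. by apply: is_derive_eq; rewrite /GRing.scale/= /bump1; field. Qed.

Lemma is_derive_bump1 (s : R) : is_derive s 1 bump1 (bump2 s).
Proof. by apply: is_derive_eq; rewrite /GRing.scale/= /bump2; field. Qed.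

Lemma continuous_bump : continuous bump.
Proof. exact: is_derive_continuous is_derive_bump. Qed.

Lemma continuous_bump1 : continuous bump1.
Proof. exact: is_derive_continuous is_derive_bump1. Qed.

Lemma continuous_bump2 : continuous bump2.
Proof.
have d (s : R) : is_derive s 1 bump2 (- 12 * ((2 * N - s) - (s - N)) / N ^+ 4).
  by apply: is_derive_eq; rewrite /GRing.scale/=; field.
exact: is_derive_continuous d.
Qed.

Lemma bump_ends : [/\ bump N = 0, bump (2 * N) = 0, bump1 N = 0 & bump1 (2 * N) = 0].
Proof.
by rewrite /bump /bump1 !subrr !(mul0r, mulr0) expr0n/= !mul0r.
Qed.

Lemma bump_ge0 s : 0 <= bump s.
Proof. by rewrite divr_ge0 ?sqr_ge0 ?exprn_ge0// ltW. Qed.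

Lemma bump_le1 s : N <= s <= 2 * N -> `|bump s| <= 1.
Proof.
move=> /andP[h1 h2]; rewrite ger0_norm ?bump_ge0// ler_pdivrMr ?exprn_gt0// mul1r.
rewrite -[4%N]/(2 * 2)%N exprM ler_sqr ?nnegrE ?sqr_ge0 ?mulr_ge0 ?subr_ge0// expr2.
by rewrite ler_pM ?subr_ge0//; lra.
Qed.

Lemma bump1_le s : N <= s <= 2 * N -> `|bump1 s| <= 2 / N.
Proof.
move=> /andP[h1 h2]; rewrite /bump1.
have a0 : 0 <= s - N by lra.
have b0 : 0 <= 2 * N - s by lra.
rewrite normrM (ger0_norm (_ : 0 <= (N ^+ 4)^-1)) ?invr_ge0 ?exprn_ge0 ?(ltW N0)//.
rewrite ler_pdivrMr ?exprn_gt0// (_ : 2 / N * N ^+ 4 = 2 * (N * N) * N); last by field.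
rewrite normrM ger0_norm ?mulr_ge0//.
apply: ler_pM; rewrite ?mulr_ge0// ?ler_pM2l//.
  by rewrite ler_pM//; lra.
by rewrite ler_norml; lra.
Qed.

Lemma bump2_le s : N <= s <= 2 * N -> `|bump2 s| <= 4 / N ^+ 2.
Proof.
move=> /andP[h1 h2]; rewrite /bump2.
have a0 : 0 <= s - N by lra.
have b0 : 0 <= 2 * N - s by lra.
rewrite normrM (ger0_norm (_ : 0 <= (N ^+ 4)^-1)) ?invr_ge0 ?exprn_ge0 ?(ltW N0)//.
rewrite ler_pdivrMr ?exprn_gt0// (_ : 4 / N ^+ 2 * N ^+ 4 = 4 * (N * N)); last by field.
have h : ((2 * N - s) - (s - N)) ^+ 2 <= N * N.
  by rewrite -expr2 -[leLHS]real_normK ?num_real// ler_sqr ?nnegrE ?(ltW N0)// ler_norml; lra.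
have h' : (s - N) * (2 * N - s) <= N * N by rewrite ler_pM//; lra.
have h3 := mulr_ge0 a0 b0.
have h4 := sqr_ge0 ((2 * N - s) - (s - N)).
by rewrite ler_norml; lra.
Qed.

(** The sine transform of the bump, as cos (s x - pi / 2) = sin (s x). *)
Definition wave : R -> R := cosT (band N bump) (- (pi / 2)).

Lemma waveE x : wave x = \int[mu]_s (band N bump s * sin (s * x)).
Proof.
apply: eq_Rintegral => s _; congr (_ * _).
by rewrite cosBpihalf.
Qed.

Lemma waveN x : wave (- x) = - wave x.
Proof.
have mb := continuous_measurable_fun continuous_bump.
rewrite -[RHS]mulN1r !waveE -Rintegral_scalef.
  by apply: eq_Rintegral => s _; rewrite mulrN sinN; ring.
have := integrable_cosT_term (integrable_band_bound N0 mb bump_le1) (- (pi / 2)) x.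
apply: eq_integrable => // s _ /=; congr (_ * _)%:E.
by rewrite cosBpihalf.
Qed.

Lemma integrable_band_bump : mu.-integrable setT (EFin \o band N bump).
Proof.
exact: (integrable_band_bound N0 (continuous_measurable_fun continuous_bump) bump_le1).
Qed.

(** The trivial bound for the size of [wave x], and two integrations by parts for the
    size of [x ^+ 2 * wave x]. *)
Lemma wave_decay x : `|wave x| <= 5 * N / (1 + x ^+ 2).
Proof.
have mb := continuous_measurable_fun continuous_bump.
have mb2 := continuous_measurable_fun continuous_bump2.
have [e1 e2 e3 e4] := bump_ends.
have h0 := cosT_band_le N0 (- (pi / 2)) x mb bump_le1.
have h2 := cosT_band_le N0 (- (pi / 2) + pi / 2 + pi / 2) x mb2 bump2_le.
rewrite -(cosT_by_parts N0 _ _ is_derive_bump1 continuous_bump2 e3 e4) in h2.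
rewrite -(cosT_by_parts N0 _ _ is_derive_bump continuous_bump1 e1 e2) in h2.
rewrite -/wave in h0 h2.
rewrite ler_pdivlMr ?ltr_pwDl ?sqr_ge0//.
rewrite mulrA -expr2 normrM (ger0_norm (sqr_ge0 x)) in h2.
rewrite mulr1 in h0.
have h3 : N * (4 / N ^+ 2) <= 4 * N.
  rewrite (_ : N * (4 / N ^+ 2) = 4 / N); last by field.
  by rewrite ler_pM2l// (le_trans _ N1)// invf_le1.
by rewrite mulrDr mulr1 [_ * x ^+ 2]mulrC; lra.
Qed.

Lemma measurable_wave : measurable_fun [set: R] wave.
Proof.
apply: measurable_cosT; apply: measurable_band.
exact: continuous_measurable_fun continuous_bump.
Qed.

Lemma integrable_wave : mu.-integrable setT (EFin \o wave).
Proof.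
have ip : mu.-integrable setT (EFin \o (fun x => 5 * N / 2 * poisson 1 (x - 0))).
  apply: integrable_scalef; apply: ge0_fin_integrable (integral_poisson ltr01 0) => //.
    by apply: (measurableT_comp (measurable_poisson ltr01)); exact: measurable_funB.
  by move=> x _; rewrite poisson_ge0.
apply: le_integrable ip => //; first by apply/measurable_EFinP; exact: measurable_wave.
move=> x _; rewrite /= lee_fin (le_trans _ (ler_norm _))//.
rewrite (le_trans (wave_decay x))// /poisson subr0 expr1n.
by rewrite (_ : 5 * N / 2 * _ = 5 * N / (1 + x ^+ 2)) //; field; rewrite lt0r_neq0// ltr_pwDl ?sqr_ge0.
Qed.

Lemma Rintegral_wave : \int[mu]_x wave x = 0.
Proof.
have := Rintegral_oppr measurable_wave.
under eq_Rintegral => x _ do rewrite waveN -mulN1r.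
by rewrite (Rintegral_scalef _ integrable_wave) mulN1r; lra.
Qed.

Lemma Rintegral_band_bump : \int[mu]_s band N bump s = N / 30.
Proof.
transitivity (\int[mu]_s (band N bump s * cst 1 s)); first by apply: eq_Rintegral => s _; rewrite mulr1.
rewrite Rintegral_band_mul.
pose P (s : R) := (N ^+ 2 * (s - N) ^+ 3 / 3 - N * (s - N) ^+ 4 / 2 + (s - N) ^+ 5 / 5) / N ^+ 4.
have dP (s : R) : is_derive s 1 P (bump s).
  by apply: is_derive_eq; rewrite /GRing.scale/= /bump; field.
transitivity (\int[mu]_(s in `[N, 2 * N]) bump s); first by apply: eq_Rintegral => s _; rewrite mulr1.
rewrite (FTC2 _ continuous_bump dP); last by rewrite ltr_pMl// ltr1n.
by rewrite /P; field.
Qed.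

(** The regularised integral of sin (s x) over the half-line is [s / (d ^+ 2 + s ^+ 2)]. *)
Lemma wave_abel (d : R) : 0 < d ->
  \int[mu]_(x in `[0, +oo[) (abel d x * wave x) =
  \int[mu]_s (band N bump s * (s / (d ^+ 2 + s ^+ 2))).
Proof.
move=> d0.
pose p := abel d \_ `[0, +oo[.
have ip : mu.-integrable setT (EFin \o p).
  rewrite -restrict_EFin; apply/integrable_restrict => //; rewrite setTI.
  by apply: (@integrableS _ _ _ _ setT) => //; exact: integrable_abel.
have mc := measurable_cos2 (- (pi / 2) : R).
have c1 (z : R * R) : `|cos (z.2 * z.1 + - (pi / 2))| <= 1 by exact: cos_norm_le1.
have h := @Rfubini _ _ (measurableTypeR R) (measurableTypeR R) R mu mu p _ _ ip
  integrable_band_bump mc c1.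
rewrite Rintegral_mkcond.
transitivity (\int[mu]_x (p x * \int[mu]_s (band N bump s * cos (s * x + - (pi / 2))))).
  by apply: eq_Rintegral => x _; rewrite /p !patchE; case: ifPn => //; rewrite mul0r.
rewrite [LHS]h; apply: eq_Rintegral => s _; congr (_ * _).
transitivity (\int[mu]_(x in `[0, +oo[) (expR (- (d * x)) * cos (s * x + - (pi / 2)))).
  rewrite [RHS]Rintegral_mkcond; apply: eq_Rintegral => x _; rewrite /p !patchE.
  case: ifPn => /=; last by rewrite mul0r.
  by rewrite mem_setE in_itv/= andbT => x0; rewrite /abel ger0_norm.
by rewrite (Rintegral_expR_cos_half d0) cosN sinN cos_pihalf sin_pihalf; congr (_ / _); ring.
Qed.

(** In [wave_abel] the factor [s / (d ^+ 2 + s ^+ 2)] is at least [1 / (4 * N)] when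
    [d <= s <= 2 * N], and the bump has integral [N / 30].  The bound is free of [N]:
    stretching the frequencies compresses the wave and raises it by the same factor. *)
Lemma wave_half_ge : 120^-1 <= \int[mu]_(x in `[0, +oo[) wave x.
Proof.
have iw : mu.-integrable `[0, +oo[ (EFin \o wave).
  by apply: (@integrableS _ _ _ _ setT) => //; exact: integrable_wave.
have mI : measurable (`[0, +oo[ : set (measurableTypeR R)) by [].
apply: ler_cvg_to (cvg_cst (120^-1 : R)) (cvg_abel mI iw) _.
apply: nearW => n; rewrite wave_abel ?abel_scale_gt0//.
set d := abel_scale n.
have d0 : 0 < d := abel_scale_gt0 n.
have d1 : d <= 1 by rewrite invf_le1// ler1n.
have -> : 120^-1 = \int[mu]_s ((4 * N)^-1 * band N bump s).
  by rewrite (Rintegral_scalef _ integrable_band_bump) Rintegral_band_bump; field.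
have q (s : R) : 0 < d ^+ 2 + s ^+ 2 by apply: sqrD_gt0.
have mq : measurable_fun [set: R] (fun s => s / (d ^+ 2 + s ^+ 2)).
  apply: continuous_measurable_fun => s; apply: cvgM; first exact: cvg_id.
  apply: cvgV; first exact: lt0r_neq0.
  by apply: cvgD; [exact: cvg_cst|exact: sqr_continuous].
apply: le_Rintegral => //.
- exact: (integrable_scalef _ integrable_band_bump).
- have := integrable_scalef d^-1 integrable_band_bump.
  apply: le_integrable => //.
    apply/measurable_EFinP; apply: measurable_funM => //; apply: measurable_band.
    exact: continuous_measurable_fun continuous_bump.
  move=> s _; rewrite /= lee_fin mulrC !normrM ler_wpM2r//.
  rewrite (gtr0_norm (_ : 0 < d^-1)) ?invr_gt0// normfV (gtr0_norm (q s)).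
  rewrite ler_pdivrMr; last exact: q.
  rewrite -(ler_pM2l d0) mulrA mulfV ?lt0r_neq0// mul1r.
  rewrite -(real_normK (num_real s)).
  have := sqr_ge0 (d - `|s|); have := sqr_ge0 d; have := sqr_ge0 `|s|; lra.
- move=> s _; rewrite mulrC bandE; case: ifPn => [/andP[h1 h2]|]; last by rewrite !mul0r.
  rewrite ler_wpM2l ?bump_ge0// ler_pdivlMr// mulrC ler_pdivrMr ?mulr_gt0//.
  have hs : s * s <= s * (2 * N) by rewrite ler_wpM2l//; lra.
  have ds : d <= s := le_trans d1 (le_trans N1 h1).
  have dd : d * d <= s * s by rewrite ler_pM ?(ltW d0).
  rewrite !expr2; apply: (le_trans (lerD dd hs)).
  have : s * s <= s * (2 * N) := hs; lra.
Qed.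

End bump.

(** * The hypotheses: a Cauchy density perturbed by a wave *)

Section density_probability.
Context {R : realType}.
Local Notation mu := (@lebesgue_measure R).
Variable f : R -> R.
Hypotheses (mf : measurable_fun [set: R] f) (f0 : forall x, 0 <= f x)
  (f1 : (\int[mu]_x (f x)%:E = 1)%E).

Definition density_set (A : set R) : \bar R := (\int[mu]_(x in A) (f x)%:E)%E.

Let dens0 : density_set set0 = 0%E.
Proof. by rewrite /density_set integral_set0. Qed.

Let dens_ge0 A : (0 <= density_set A)%E.
Proof. by apply: integral_ge0 => x _; rewrite lee_fin. Qed.

Let dens_sigma_additive : semi_sigma_additive density_set.
Proof.
move=> F mF tF mUF; rewrite /density_set ge0_integral_bigcup//.
- by apply: is_cvg_ereal_nneg_natsum_cond => n _ _; exact: dens_ge0.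
- by apply/measurable_EFinP; exact: measurable_funTS.
- by move=> x _; rewrite lee_fin.
Qed.

HB.instance Definition _ := isMeasure.Build _ _ _ density_set dens0 dens_ge0
  dens_sigma_additive.

Let dens_setT : density_set setT = 1%E.
Proof. exact: f1. Qed.

HB.instance Definition _ := Measure_isProbability.Build _ _ _ density_set dens_setT.

Lemma density_prob : exists P : probability R R, has_density P f.
Proof. by exists density_set; split. Qed.

End density_probability.

Section cauchy.
Context {R : realType}.
Local Notation mu := (@lebesgue_measure R).
Variable lam : R.
Hypothesis lam0 : 0 < lam.

(** The Cauchy density is its cosine transform, up to a factor, which brings
    [cosT_fourier_bound] to bear on the Cauchy law. *)
Definition half_exp : R -> R := (fun s => expR (- (lam * s))) \_ `[0, +oo[.

Lemma integrable_half_exp : mu.-integrable setT (EFin \o half_exp).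
Proof.
rewrite -restrict_EFin; apply/integrable_restrict => //; rewrite setTI.
exact: integrable_expR_half.
Qed.

Lemma poisson_cosT x : poisson lam x = 2 * cosT half_exp 0 x.
Proof.
have -> : cosT half_exp 0 x = \int[mu]_(s in `[0, +oo[) (expR (- (lam * s)) * cos (x * s + 0)).
  rewrite [RHS]Rintegral_mkcond; apply: eq_Rintegral => s _.
  by rewrite (mulrC s x) /half_exp !patchE; case: ifPn => // _; rewrite mul0r.
by rewrite Rintegral_expR_cos_half// cos0 sin0 /poisson; ring.
Qed.

Lemma integrable_poisson : mu.-integrable setT (EFin \o poisson lam).
Proof.
have := integral_poisson lam0 0; under eq_integral => s _ do rewrite subr0.
apply: ge0_fin_integrable => //; first exact: measurable_poisson.
by move=> x _; exact: poisson_ge0.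
Qed.

(** [cosT_fourier_bound] with a window of width [lam^-1] around [w]: there the
    exponential exceeds its value at |w| by at most a factor e. *)
Lemma poisson_fourier_bound (w eta : R) :
  `| \int[mu]_x (poisson lam x * cos (w * x + eta)) | <=
  4 * pi * (expR 1 * expR (- (lam * `|w|))).
Proof.
have iT : mu.-integrable setT (EFin \o cosT half_exp 0).
  have := integrable_scalef 2^-1 integrable_poisson.
  by apply: eq_integrable => // x _; rewrite /= poisson_cosT; congr (_%:E); field.
have iTc := integrable_mul_cos w eta iT.
have -> : \int[mu]_x (poisson lam x * cos (w * x + eta)) =
    2 * \int[mu]_x (cosT half_exp 0 x * cos (w * x + eta)).
  by rewrite -Rintegral_scalef//; apply: eq_Rintegral => x _; rewrite poisson_cosT mulrA.
rewrite normrM ger0_norm// (_ : 4 * pi * _ = 2 * (2 * pi * (expR 1 * expR (- (lam * `|w|))))); last by ring.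
rewrite ler_pM2l//.
apply: (@cosT_fourier_bound _ _ _ _ _ _ lam^-1); rewrite ?mulr_ge0 ?expR_ge0//.
- by rewrite invr_gt0.
- exact: integrable_half_exp.
move=> s h; rewrite /half_exp patchE; case: ifPn => [|_]; last first.
  by rewrite normr0 mulr_ge0 ?expR_ge0.
rewrite mem_setE in_itv/= andbT => s0; rewrite ger0_norm ?expR_ge0// -expRD ler_expR.
have hw : `|w| - s <= lam^-1.
  have -> : s = `|s| by rewrite ger0_norm.
  case: h => h.
    by have := ler_distD s w 0; rewrite !subr0 distrC; lra.
  by have := ler_distD (- s) w 0; rewrite !subr0 normrN opprK addrC [w + s]addrC; lra.
have : lam * (`|w| - s) <= 1 by rewrite -(mulfV (lt0r_neq0 lam0)) ler_pM2l.
by rewrite mulrBr; lra.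
Qed.

Lemma poisson_ge (x : R) : 1 <= lam -> 2 / lam / (1 + x ^+ 2) <= poisson lam x.
Proof.
move=> l1; rewrite /poisson ler_pdivrMr ?ltr_pwDl ?sqr_ge0//.
rewrite mulrAC ler_pdivlMr ?sqrD_gt0// mulrAC ler_pdivrMr//.
have h : 1 <= lam ^+ 2 by rewrite exprn_ege1.
have := mulr_ge0 (_ : 0 <= lam ^+ 2 - 1) (sqr_ge0 x); rewrite subr_ge0 => /(_ h).
by rewrite !mulrDr !mulrDl !expr2 in h *; lra.
Qed.

End cauchy.

Section hypotheses_densities.
Context {R : realType}.
Local Notation mu := (@lebesgue_measure R).
Variables (lam N a t0 : R).
Hypotheses (lam1 : 1 <= lam) (N1 : 1 <= N) (a0 : 0 <= a)
  (small : a * (5 * N) <= (pi * lam)^-1).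

Let lam0 : 0 < lam. Proof. exact: lt_le_trans lam1. Qed.

(** [sg = 0] is the Cauchy density of scale [lam]; [sg = 1] and [sg = - 1] are the two
    perturbed hypotheses. *)
Definition cdens (sg x : R) : R := (2 * pi)^-1 * poisson lam x + sg * a * wave N x.

Definition dens (sg x : R) : R := cdens sg (x - t0).

Lemma integrable_cdens sg : mu.-integrable setT (EFin \o cdens sg).
Proof.
apply: integrable_addf.
  exact: (integrable_scalef _ (integrable_poisson lam0)).
exact: (integrable_scalef _ (integrable_wave N1)).
Qed.

Lemma measurable_cdens sg : measurable_fun [set: R] (cdens sg).
Proof. by have /integrableP[/measurable_EFinP] := integrable_cdens sg. Qed.

Lemma measurable_dens sg : measurable_fun [set: R] (dens sg).
Proof. exact: (measurableT_comp (measurable_cdens sg) (measurable_addr (- t0))). Qed.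

(** Both summands are controlled by 1 / (1 + x^2), the first from below and the second
    from above; [small] compares the constants. *)
Lemma cdens_ge0 sg x : `|sg| <= 1 -> 0 <= cdens sg x.
Proof.
move=> sg1.
have h1 : `|sg * a * wave N x| <= (pi * lam)^-1 / (1 + x ^+ 2).
  rewrite !normrM (ger0_norm a0).
  apply: (@le_trans _ _ (a * `|wave N x|)).
    by rewrite ler_wpM2r// ler_piMl.
  apply: (@le_trans _ _ (a * (5 * N / (1 + x ^+ 2)))).
    by rewrite ler_wpM2l// wave_decay.
  by rewrite mulrA ler_wpM2r// invr_ge0 addr_ge0// sqr_ge0.
have h2 : (pi * lam)^-1 / (1 + x ^+ 2) <= (2 * pi)^-1 * poisson lam x.
  have := poisson_ge lam0 x lam1.
  have p0 : 0 < (2 * pi : R)^-1 by rewrite invr_gt0 mulr_gt0// pi_gt0.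
  rewrite -(ler_pM2l p0); apply: le_trans.
  have e (p l q : R) : p != 0 -> l != 0 -> q != 0 ->
      (p * l)^-1 / q = (2 * p)^-1 * (2 / l / q).
    by move=> *; field; do !(apply/andP; split).
  by rewrite e// lt0r_neq0 ?pi_gt0// ltr_pwDl// sqr_ge0.
by have := ler_norm (- (sg * a * wave N x)); rewrite normrN /cdens; lra.
Qed.

Lemma dens_ge0 sg x : `|sg| <= 1 -> 0 <= dens sg x.
Proof. exact: cdens_ge0. Qed.

Lemma integral_dens sg : `|sg| <= 1 -> (\int[mu]_x (dens sg x)%:E = 1)%E.
Proof.
move=> sg1; rewrite /dens (ge0_integral_addr (- t0) (f := EFin \o cdens sg)); last 2 first.
- by apply/measurable_EFinP; exact: measurable_cdens.
- by move=> x; rewrite lee_fin cdens_ge0.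
have : (\int[mu]_x (cdens sg x)%:E \is a fin_num)%E.
  by apply: integrable_fin_num => //; exact: integrable_cdens.
move=> /fineK <-; congr EFin.
rewrite -[LHS]/(\int[mu]_x cdens sg x) /cdens Rintegral_addf; last 2 first.
- exact: (integrable_scalef _ (integrable_poisson lam0)).
- exact: (integrable_scalef _ (integrable_wave N1)).
rewrite (Rintegral_scalef _ (integrable_poisson lam0)) (Rintegral_scalef _ (integrable_wave N1)).
rewrite Rintegral_wave// mulr0 addr0.
have := integral_poisson lam0 0; under eq_integral => s _ do rewrite subr0.
by rewrite /Rintegral => -> /=; rewrite mulVf// mulf_neq0 ?lt0r_neq0 ?pi_gt0.
Qed.

Lemma dens_prob sg : `|sg| <= 1 -> exists P : probability R R, has_density P (dens sg).
Proof.
move=> sg1; apply: density_prob; first exact: measurable_dens.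
- by move=> x; exact: dens_ge0.
- exact: integral_dens.
Qed.

(** For |w| > 2 N the bump vanishes near [w] and [- w]. *)
Lemma wave_fourier_bound (w eta : R) :
  `| \int[mu]_x (wave N x * cos (w * x + eta)) | <=
  2 * pi * (if `|w| <= 2 * N then 1 else 0).
Proof.
have N0 : 0 < N by exact: lt_le_trans N1.
have b1 s : `|band N (bump N) s| <= 1.
  by rewrite bandE; case: ifPn => [/(bump_le1 N1)//|_]; rewrite normr0.
case: ifPn => hw; last rewrite -ltNge in hw.
  apply: (@cosT_fourier_bound _ _ _ _ _ _ 1) => //.
  - exact: integrable_band_bump.
  - exact: integrable_wave.
apply: (@cosT_fourier_bound _ _ _ _ _ _ (`|w| - 2 * N)) => //.
- by rewrite subr_gt0.
- exact: integrable_band_bump.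
- exact: integrable_wave.
move=> s h; rewrite bandE; case: ifPn => [/andP[h1 h2]|]; last by rewrite normr0.
have : `|w| - `|s| < `|w| - 2 * N.
  case: h => h.
    by have := ler_distD s w 0; rewrite !subr0 distrC; lra.
  by have := ler_distD (- s) w 0; rewrite !subr0 normrN opprK addrC [w + s]addrC; lra.
by rewrite (ger0_norm (_ : 0 <= s)); lra.
Qed.

Lemma Rintegral_dens_cos (sg w eta : R) :
  \int[mu]_x (dens sg x * cos (w * x + eta)) =
  (2 * pi)^-1 * (\int[mu]_x (poisson lam x * cos (w * x + (w * t0 + eta)))) +
  sg * a * (\int[mu]_x (wave N x * cos (w * x + (w * t0 + eta)))).
Proof.
set th := w * t0 + eta.
have i1 := integrable_mul_cos w th (integrable_poisson lam0).
have i2 := integrable_mul_cos w th (integrable_wave N1).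
rewrite -(Rintegral_scalef _ i1) -(Rintegral_scalef _ i2).
rewrite -Rintegral_addf; [|exact: integrable_scalef|exact: integrable_scalef].
pose g y := cdens sg y * cos (w * y + th).
transitivity (\int[mu]_x g (x + - t0)).
  by apply: eq_Rintegral => x _; rewrite /g /dens /th; congr (_ * cos _); ring.
rewrite Rintegral_addr; first by apply: eq_Rintegral => x _; rewrite /g /cdens; ring.
apply: measurable_funM; [exact: measurable_cdens|exact: measurable_cos_affine].
Qed.

Lemma dens_fourier_bound (sg w eta : R) : `|sg| <= 1 ->
  `|\int[mu]_x (dens sg x * cos (w * x + eta))| <=
  2 * (expR 1 * expR (- (lam * `|w|))) + a * (2 * pi * (if `|w| <= 2 * N then 1 else 0)).
Proof.
move=> sg1; rewrite Rintegral_dens_cos (le_trans (ler_normD _ _))// lerD//.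
  have p0 : 0 < (2 * pi : R)^-1 by rewrite invr_gt0 mulr_gt0// pi_gt0.
  rewrite normrM (gtr0_norm p0).
  apply: (le_trans (ler_wpM2l (ltW p0) (poisson_fourier_bound lam0 _ _))).
  have e (p q : R) : p != 0 -> (2 * p)^-1 * (4 * p * q) = 2 * q by move=> *; field.
  by rewrite e// lt0r_neq0 ?pi_gt0.
rewrite 2!normrM (ger0_norm a0) -mulrA.
set I := \int[mu]_x _; apply: (@le_trans _ _ (a * `|I|)).
  by rewrite ler_piMl ?mulr_ge0.
by rewrite ler_wpM2l// wave_fourier_bound.
Qed.

Lemma cmod_sqr (z : R[i]) : cmod z ^+ 2 = complex.Re z ^+ 2 + complex.Im z ^+ 2.
Proof. by rewrite /cmod sqr_sqrtr// addr_ge0 ?sqr_ge0. Qed.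

Lemma dens_fourier_sqr (sg w : R) : `|sg| <= 1 ->
  cmod (fourier (dens sg) w) ^+ 2 <=
  16 * expR 2 * expR (- (2 * lam * `|w|)) +
  16 * (pi * a) ^+ 2 * (if `|w| <= 2 * N then 1 else 0).
Proof.
move=> sg1; rewrite cmod_sqr /fourier /=.
have hR := dens_fourier_bound w 0 sg1.
have hI := dens_fourier_bound w (- (pi / 2)) sg1.
have eR : \int[mu]_x (dens sg x * cos (w * x + 0)) = \int[mu]_x (dens sg x * cos (w * x)).
  by apply: eq_Rintegral => x _; rewrite addr0.
rewrite eR in hR.
have eI : \int[mu]_x (dens sg x * cos (w * x + - (pi / 2))) = \int[mu]_x (dens sg x * sin (w * x)).
  apply: eq_Rintegral => x _; congr (_ * _).
  by rewrite cosBpihalf.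
rewrite eI in hI.
set X := \int[mu]_x _ in hR *; set Y := \int[mu]_x _ in hI *.
set e := expR 1 * _ in hR hI; set c := if _ then _ else _ in hR hI *.
rewrite -(mulrA 16).
have -> : expR 2 * expR (- (2 * lam * `|w|)) = e ^+ 2 :> R.
  by rewrite /e exprMn !expr2 -!expRD; congr expR; ring.
have cc : c = c * c by rewrite /c; case: ifP; rewrite ?mulr1 ?mulr0.
have h (Z B : R) : `|Z| <= B -> Z ^+ 2 <= B ^+ 2.
  by move=> ZB; rewrite -(real_normK (num_real Z)) ler_sqr ?nnegrE// (le_trans _ ZB).
have {}hR := h _ _ hR; have {}hI := h _ _ hI.
apply: (le_trans (lerD hR hI)).
have -> : 16 * (pi * a) ^+ 2 * c = 16 * (pi * a) ^+ 2 * (c * c) by rewrite -cc.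
by move: (pi : R) => p; have := sqr_ge0 (2 * e - a * (2 * p * c)); lra.
Qed.

End hypotheses_densities.

Section weights.
Context {R : realType}.
Local Notation mu := (@lebesgue_measure R).

Lemma sobolev_weight_le (alpha w : R) : 0 <= alpha ->
  (1 + w ^+ 2) `^ alpha <= 2 `^ alpha * expR (alpha * `|w|).
Proof.
move=> al0; rewrite mulrC [alpha * _]mulrC expRM -powRM ?expR_ge0//.
apply: ge0_ler_powR => //; rewrite ?nnegrE ?addr_ge0 ?sqr_ge0 ?mulr_ge0 ?expR_ge0//.
have := expR_ge1Dxn 1 (normr_ge0 w).
rewrite (_ : 2`! = 2%N)// (real_normK (num_real w)) => h.
by have := sqr_ge0 w; lra.
Qed.

End weights.

(** * Sobolev norm and distribution function of the hypotheses *)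

Section class_membership.
Context {R : realType}.
Local Notation mu := (@lebesgue_measure R).
Variables (lam N a t0 : R).
Hypotheses (lam1 : 1 <= lam) (N1 : 1 <= N) (a0 : 0 <= a).

Let lam0 : 0 < lam. Proof. exact: lt_le_trans lam1. Qed.
Let N0 : 0 < N. Proof. exact: lt_le_trans N1. Qed.

(** On the Cauchy part the weight costs a factor exp (alpha |w|), less than the decay
    exp (- 2 lam |w|); on the wave part, carried by |w| <= 2 N, the weight is at most
    (5 N^2)^alpha. *)
Lemma sobolev_dens (alpha L sg : R) (P : probability R R) : `|sg| <= 1 ->
  0 < alpha -> alpha < 2 * lam ->
  has_density P (dens lam N a t0 sg) ->
  (2 * pi)^-1 * (16 * expR 2 * 2 `^ alpha * (2 / (2 * lam - alpha)) +
    16 * (pi * a) ^+ 2 * (5 * N ^+ 2) `^ alpha * (4 * N)) <= L ^+ 2 ->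
  sobolev_class alpha L P.
Proof.
move=> sg1 al0 al2 dP hL; exists (dens lam N a t0 sg); split => //.
move: hL; rewrite -lee_fin; apply: le_trans.
rewrite EFinM; apply: lee_wpmul2l.
  by rewrite lee_fin invr_ge0 mulr_ge0 ?pi_ge0.
set K1 := 16 * expR 2 * 2 `^ alpha; set K2 := 16 * (pi * a) ^+ 2 * (5 * N ^+ 2) `^ alpha.
have K10 : 0 <= K1 by rewrite !mulr_ge0 ?expR_ge0 ?powR_ge0.
have K20 : 0 <= K2 by rewrite mulr_ge0 ?powR_ge0// mulr_ge0 ?sqr_ge0.
have d0 : 0 < 2 * lam - alpha by rewrite subr_gt0.
pose D : set R := `[- (2 * N), 2 * N]%classic.
have mD : measurable D by exact: measurable_itv.
apply: (@le_trans _ _ (\int[mu]_w (K1%:E * (abel (2 * lam - alpha) w)%:E + K2%:E * (\1_D w)%:E)%E)%E).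
  apply: ge0_le_integral_nomeas => w _.
    by rewrite lee_fin mulr_ge0 ?sqr_ge0 ?powR_ge0.
  rewrite -!EFinM -EFinD lee_fin.
  have h1 := dens_fourier_sqr t0 lam1 N1 a0 w sg1.
  have h2 := sobolev_weight_le w (ltW al0).
  apply: (le_trans (ler_wpM2r (powR_ge0 _ _) h1)); rewrite mulrDl lerD//.
    apply: (@le_trans _ _ (16 * expR 2 * expR (- (2 * lam * `|w|)) * (2 `^ alpha * expR (alpha * `|w|)))).
      by rewrite ler_wpM2l// !mulr_ge0 ?expR_ge0.
    rewrite /K1 /abel (_ : - ((2 * lam - alpha) * `|w|) = - (2 * lam * `|w|) + alpha * `|w|); last by ring.
    by rewrite (expRD (- (2 * lam * `|w|))) le_eqVlt; apply/orP; left; apply/eqP; ring.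
  rewrite /K2 indicE mem_setE in_itv/= -ler_norml.
  case: ifPn => hw; last by rewrite !(mulr0, mul0r).
  rewrite !mulr1; apply: ler_wpM2l; first by rewrite mulr_ge0 ?sqr_ge0.
  apply: ge0_ler_powR; rewrite ?nnegrE ?(ltW al0)//; [by rewrite addr_ge0 ?sqr_ge0|by rewrite mulr_ge0 ?sqr_ge0|].
  have : w ^+ 2 <= (2 * N) ^+ 2 by rewrite -(real_normK (num_real w)) ler_sqr ?nnegrE ?mulr_ge0 ?(ltW N0).
  have : 1 <= N ^+ 2 by rewrite exprn_ege1.
  by rewrite exprMn; lra.
rewrite ge0_integralD//; last 4 first.
- by move=> x _; rewrite -EFinM lee_fin mulr_ge0// abel_ge0.
- by apply/measurable_EFinP; apply: measurable_funM => //; exact: measurable_abel.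
- by move=> x _; rewrite -EFinM lee_fin mulr_ge0.
- by apply/measurable_EFinP; apply: measurable_funM => //; exact: measurable_indic.
rewrite ge0_integralZl//; last 2 first.
- by apply/measurable_EFinP; exact: measurable_abel.
- by move=> x _; rewrite lee_fin abel_ge0.
rewrite ge0_integralZl//; last by apply/measurable_EFinP; exact: measurable_indic.
have -> : (\int[mu]_x (\1_D x)%:E = (4 * N)%:E)%E.
  rewrite integral_indic// setIT.
  transitivity (if ((- (2 * N))%:E < (2 * N)%:E)%E then ((2 * N)%:E - (- (2 * N))%:E)%E else 0%E).
    exact: lebesgue_measure_itv.
  rewrite lte_fin (_ : (- (2 * N) < 2 * N)); last by have := N0; lra.
  by rewrite -EFinB; congr (_%:E); ring.
have -> : (\int[mu]_x (abel (2 * lam - alpha) x)%:E = (2 / (2 * lam - alpha))%:E)%E.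
  have : (\int[mu]_x (abel (2 * lam - alpha) x)%:E \is a fin_num)%E.
    by apply: integrable_fin_num => //; exact: integrable_abel.
  move=> /fineK <-; congr EFin.
  have := Rintegral_abel_cos d0 0 0; rewrite cos0 mul1r /poisson expr0n/= addr0.
  rewrite (_ : 2 * (2 * lam - alpha) / (2 * lam - alpha) ^+ 2 = 2 / (2 * lam - alpha)); last first.
    by field; rewrite lt0r_neq0.
  move=> <-; apply: eq_Rintegral => x _; by rewrite mul0r addr0 cos0 mulr1.
by rewrite -!EFinM -EFinD.
Qed.

(** As the wave is odd, its integral over the left half-line is the opposite of the one
    over the right half-line. *)
Lemma distr_fun_dens (sg : R) (P : probability R R) : has_density P (dens lam N a t0 sg) ->
  distr_fun P t0 = (2 * pi)^-1 * \int[mu]_(x in `]-oo, 0]) poisson lam x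
     - sg * a * \int[mu]_(x in `[0, +oo[) wave N x.
Proof.
move=> [_ _ dP]; rewrite /distr_fun dP// -[LHS]/(\int[mu]_(x in `]-oo, t0]) dens lam N a t0 sg x).
have ip := integrable_poisson lam0; have iw := integrable_wave N1.
have sub (f : R -> R) (A : set R) : measurable A -> mu.-integrable setT (EFin \o f) ->
    mu.-integrable A (EFin \o f).
  by move=> mA fi; apply: (@integrableS _ _ _ _ setT).
transitivity (\int[mu]_(x in `]-oo, 0]) cdens lam N a sg x).
  rewrite Rintegral_mkcond [RHS]Rintegral_mkcond.
  rewrite -[RHS](Rintegral_addr (- t0)); last first.
    by apply/(measurable_restrictT _ _).1 => //; apply: measurable_funTS; exact: measurable_cdens.
  apply: eq_Rintegral => x _; rewrite !patchE !mem_setE !in_itv/= subr_le0.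
  by [].
rewrite /cdens RintegralD//; last 2 first.
- by apply: sub => //; exact: integrable_scalef.
- by apply: sub => //; exact: integrable_scalef.
rewrite RintegralZl//; last by exact: sub.
rewrite RintegralZl//; last by exact: sub.
congr (_ + _); rewrite -mulrN; congr (_ * _).
rewrite Rintegral_mkcond -Rintegral_oppr; last first.
  by apply/(measurable_restrictT _ _).1 => //; apply: measurable_funTS; exact: measurable_wave.
rewrite [in RHS]Rintegral_mkcond -mulN1r -Rintegral_scalef; last first.
  by rewrite -restrict_EFin; apply/integrable_restrict => //; rewrite setTI; exact: sub.
apply: eq_Rintegral => x _; rewrite !patchE !mem_setE !in_itv/= oppr_le0 andbT.
by case: ifP => _; [rewrite (waveN N1) -[LHS]mulN1r|rewrite mulr0].
Qed.

End class_membership.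

(** * Weighted square norm of a filtered wave *)

Section band_plancherel.
Context {R : realType}.
Local Notation mu := (@lebesgue_measure R).
Variable N : R.
Hypothesis N1 : 1 <= N.

Let N0 : 0 < N. Proof. exact: lt_le_trans N1. Qed.

Lemma plancherel_band (v : R -> R) (th B : R) : measurable_fun [set: R] v ->
  (forall s, N <= s <= 2 * N -> `|v s| <= B) ->
  (\int[mu]_x (cosT (band N v) th x ^+ 2)%:E <= (2 * pi * (N * B ^+ 2))%:E)%E.
Proof.
move=> mv vB.
have e2 : (fun s => band N v s ^+ 2) = band N (fun s => v s ^+ 2).
  by apply/funext => s; rewrite !bandE; case: ifP => // _; rewrite expr0n.
have mv2 : measurable_fun [set: R] (fun s => v s ^+ 2) by exact: measurable_funX.
have vB2 s : N <= s <= 2 * N -> `|v s ^+ 2| <= B ^+ 2.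
  move=> /vB h; rewrite normrX ler_sqr// nnegrE.
  exact: le_trans h.
have i2 := integrable_band_bound N0 mv2 vB2.
have iv2 : mu.-integrable setT (EFin \o (fun s => band N v s ^+ 2)) by rewrite e2.
apply: (le_trans (plancherel_le th (integrable_band_bound N0 mv vB) iv2)).
rewrite lee_fin ler_wpM2l ?mulr_ge0 ?pi_ge0// e2.
by apply: le_trans (ler_norm _) _; exact: (Rintegral_band_le N0 mv2 vB2).
Qed.

Variables (C S C' S' : R -> R) (M : R).
Hypotheses (dC : forall s : R, is_derive s 1 C (C' s))
  (dS : forall s : R, is_derive s 1 S (S' s))
  (cC' : continuous C') (cS' : continuous S')
  (CM : forall s, N <= s <= 2 * N -> `|C s| <= M)
  (SM : forall s, N <= s <= 2 * N -> `|S s| <= M)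
  (C'M : forall s, N <= s <= 2 * N -> `|C' s| <= M)
  (S'M : forall s, N <= s <= 2 * N -> `|S' s| <= M).

Let u s := bump N s * C s.
Let v s := bump N s * S s.
Let u' s := bump1 N s * C s + bump N s * C' s.
Let v' s := bump1 N s * S s + bump N s * S' s.

Let dmul (D D' : R -> R) : (forall s : R, is_derive s 1 D (D' s)) ->
  forall s : R, is_derive s 1 (fun s => bump N s * D s) (bump1 N s * D s + bump N s * D' s).
Proof.
move=> dD s; have b := is_derive_bump N1 s; have := dD s => ?.
by apply: is_derive_eq; rewrite /GRing.scale/=; ring.
Qed.

Let cmul (D D' : R -> R) : continuous D -> continuous D' ->
  continuous (fun s => bump1 N s * D s + bump N s * D' s).
Proof.
move=> cD cD' s; apply: cvgD; apply: cvgM.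
- exact: (continuous_bump1 N1).
- exact: cD.
- exact: (continuous_bump N1).
- exact: cD'.
Qed.

Let mulM (D : R -> R) : (forall s, N <= s <= 2 * N -> `|D s| <= M) ->
  forall s, N <= s <= 2 * N -> `|bump N s * D s| <= M.
Proof.
move=> DM s sN; rewrite normrM (le_trans _ (DM s sN))// ler_piMl//.
exact: (bump_le1 N1).
Qed.

Let mulM' (D D' : R -> R) : (forall s, N <= s <= 2 * N -> `|D s| <= M) ->
  (forall s, N <= s <= 2 * N -> `|D' s| <= M) ->
  forall s, N <= s <= 2 * N -> `|bump1 N s * D s + bump N s * D' s| <= 3 * M.
Proof.
move=> DM D'M s sN.
have h1 := mulM D'M sN.
have h2 : `|bump1 N s * D s| <= 2 * M.
  rewrite normrM ler_pM//; last exact: DM.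
  rewrite (le_trans (bump1_le N1 sN))// ler_pdivrMr// ler_peMr//.
by have := ler_normD (bump1 N s * D s) (bump N s * D' s); lra.
Qed.

Let ge0_sub_sqr (A B : R -> R) (K : R) : measurable_fun [set: R] A -> measurable_fun [set: R] B ->
  (\int[mu]_x (A x ^+ 2)%:E <= K%:E)%E -> (\int[mu]_x (B x ^+ 2)%:E <= K%:E)%E ->
  (\int[mu]_x ((A x - B x) ^+ 2)%:E <= (4 * K)%:E)%E.
Proof.
move=> mA mB iA iB.
apply: (@le_trans _ _ (\int[mu]_x (2%:E * (A x ^+ 2)%:E + 2%:E * (B x ^+ 2)%:E))%E).
  apply: ge0_le_integral_nomeas => x _; first by rewrite lee_fin sqr_ge0.
  by rewrite -!EFinM -EFinD lee_fin; have := sqr_ge0 (A x + B x); lra.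
have mA2 : measurable_fun [set: R] (fun x => (A x ^+ 2)%:E).
  by apply/measurable_EFinP; exact: measurable_funX.
have mB2 : measurable_fun [set: R] (fun x => (B x ^+ 2)%:E).
  by apply/measurable_EFinP; exact: measurable_funX.
rewrite ge0_integralD//; last 4 first.
- by move=> x _; rewrite -EFinM lee_fin mulr_ge0 ?sqr_ge0.
- exact: measurable_funeM.
- by move=> x _; rewrite -EFinM lee_fin mulr_ge0 ?sqr_ge0.
- exact: measurable_funeM.
rewrite !ge0_integralZl//; try by [move=> x _; rewrite lee_fin sqr_ge0].
rewrite (_ : (4 * K)%:E = (2%:E * K%:E + 2%:E * K%:E)%E); last first.
  by rewrite -!EFinM -EFinD; congr (_%:E); ring.
by apply: leeD; apply: lee_wpmul2l.
Qed.

Let mu_ : measurable_fun [set: R] u.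
Proof. exact: continuous_measurable_fun (is_derive_continuous (dmul dC)). Qed.
Let mv_ : measurable_fun [set: R] v.
Proof. exact: continuous_measurable_fun (is_derive_continuous (dmul dS)). Qed.
Let cu' : continuous u'.
Proof. exact: cmul (is_derive_continuous dC) cC'. Qed.
Let cv' : continuous v'.
Proof. exact: cmul (is_derive_continuous dS) cS'. Qed.

(** The wave after filtering by the noise: [C + i S] stands for the noise transform, see
    [conv_wave]. *)
Definition band_wave (z : R) : R :=
  cosT (band N (fun s => bump N s * C s)) (- (pi / 2)) z -
  cosT (band N (fun s => bump N s * S s)) 0 z.

Lemma measurable_band_wave : measurable_fun [set: R] band_wave.
Proof.
by apply: measurable_funB; apply: measurable_cosT; apply: measurable_band;
  [exact: mu_|exact: mv_].
Qed.

(** By [cosT_by_parts] the weight [z ^+ 2] costs one derivative of the amplitude, and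
    Plancherel applies to both [band_wave] and [z * band_wave z].  The amplitudes are
    bounded by [M] and [3 * M], whence 80 = 4 * 2 * (1 + 9). *)
Lemma band_wave_L2 : (\int[mu]_z (band_wave z ^+ 2 * (1 + z ^+ 2))%:E <=
  (80 * pi * N * M ^+ 2)%:E)%E.
Proof.
have [e1 e2 _ _] := bump_ends N.
have bp (z : R) : z * band_wave z =
    cosT (band N u') (- (pi / 2) + pi / 2) z - cosT (band N v') (0 + pi / 2) z.
  rewrite /band_wave mulrBr; congr (_ - _).
    by apply: (cosT_by_parts N0 _ _ (dmul dC) cu'); rewrite /u ?e1 ?e2 mul0r.
  by apply: (cosT_by_parts N0 _ _ (dmul dS) cv'); rewrite /v ?e1 ?e2 mul0r.
have m th (w : R -> R) : measurable_fun [set: R] w -> measurable_fun [set: R] (cosT (band N w) th).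
  by move=> mw; apply: measurable_cosT; exact: measurable_band.
have mu' := continuous_measurable_fun cu'.
have mv' := continuous_measurable_fun cv'.
have h1 := ge0_sub_sqr (m _ _ mu_) (m _ _ mv_)
  (plancherel_band (- (pi / 2)) mu_ (mulM CM)) (plancherel_band 0 mv_ (mulM SM)).
have h2 := ge0_sub_sqr (m _ _ mu') (m _ _ mv')
  (plancherel_band (- (pi / 2) + pi / 2) mu' (mulM' CM C'M))
  (plancherel_band (0 + pi / 2) mv' (mulM' SM S'M)).
have mW := measurable_band_wave.
apply: (@le_trans _ _ (\int[mu]_z ((band_wave z ^+ 2)%:E + ((z * band_wave z) ^+ 2)%:E))%E).
  apply: ge0_le_integral_nomeas => z _; first by rewrite lee_fin mulr_ge0 ?addr_ge0 ?sqr_ge0.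
  by rewrite -EFinD lee_fin exprMn; lra.
rewrite ge0_integralD//; last 4 first.
- by move=> z _; rewrite lee_fin sqr_ge0.
- by apply/measurable_EFinP; exact: measurable_funX.
- by move=> z _; rewrite lee_fin sqr_ge0.
- by apply/measurable_EFinP; apply: measurable_funX; exact: measurable_funM.
rewrite (_ : (80 * pi * N * M ^+ 2)%:E =
  ((4 * (2 * pi * (N * M ^+ 2)))%:E + (4 * (2 * pi * (N * (3 * M) ^+ 2)))%:E)%E); last first.
  by rewrite -EFinD; congr (_%:E); ring.
apply: leeD; first exact: h1.
by under eq_integral => z _ do rewrite bp; exact: h2.
Qed.

End band_plancherel.

(** * Integration against a law with a density *)

Section integral_against_density.
Context {R : realType}.
Local Notation mu := (@lebesgue_measure R).
Variables (P : probability R R) (f : R -> R).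
Hypothesis Pf : has_density P f.

Let mf : measurable_fun [set: R] f. Proof. by case: Pf. Qed.
Let f0 x : 0 <= f x. Proof. by case: Pf. Qed.

Lemma density_integral1 : (\int[mu]_x (f x)%:E = 1)%E.
Proof. by case: Pf => _ _ <-//; rewrite probability_setT. Qed.

Lemma density_integrable : mu.-integrable setT (EFin \o f).
Proof. by apply: ge0_fin_integrable density_integral1. Qed.

(** The function [f] agrees almost everywhere with the Radon-Nikodym derivative of [P]. *)
Lemma ge0_integral_density (h : R -> \bar R) :
  measurable_fun setT h -> (forall x, 0 <= h x)%E ->
  (\int[P]_x h x = \int[mu]_x (h x * (f x)%:E))%E.
Proof.
move=> mh h0; have [_ _ PE] := Pf.
(* The same law, carried by the Borel structure on which Lebesgue measure lives. *)
have mid : measurable_fun [set: R] (id : R -> measurableTypeR R) by exact: measurable_id.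
pose X : {mfun R >-> measurableTypeR R} :=
  HB.pack (id : R -> measurableTypeR R) (isMeasurableFun.Build _ _ _ _ _ mid).
pose P' := distribution P X.
have P'E A : measurable A -> P' A = (\int[mu]_(x in A) (f x)%:E)%E by exact: PE.
have dom : P' `<< mu.
  apply/null_content_dominatesP => A mA A0; rewrite P'E//.
  apply: null_set_integral => //.
  by apply/measurable_EFinP; exact: measurable_funTS.

transitivity (\int[P']_x h x)%E; first by rewrite (ge0_integral_distribution X mh h0).
have cov := Radon_Nikodym_SigmaFinite.change_of_variables dom h0 measurableT mh.
rewrite -cov.
have iRN := Radon_Nikodym_SigmaFinite.f_integrable dom.
have mRN := measurable_int _ iRN.
have aeRN : ae_eq mu setT (Radon_Nikodym_SigmaFinite.f P' mu) (EFin \o f).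
  apply: integral_ae_eq => //; first exact/measurable_EFinP.
  by move=> A _ mA; rewrite -(Radon_Nikodym_SigmaFinite.f_integral dom mA); exact: P'E.
apply: ae_eq_integral => //.
- exact: emeasurable_funM.
- by apply: emeasurable_funM => //; exact/measurable_EFinP.
by apply: filterS aeRN => x e Dx; rewrite /= (e Dx).
Qed.

End integral_against_density.

(** * Law of a noisy observation *)

Section convolution.
Context {R : realType}.
Local Notation mu := (@lebesgue_measure R).
Variables (Q : probability R R) (fz : R -> R).
Hypothesis Qf : has_density Q fz.

Let mfz : measurable_fun [set: R] fz. Proof. by case: Qf. Qed.
Let fz0 x : 0 <= fz x. Proof. by case: Qf. Qed.
Let ifz : mu.-integrable setT (EFin \o fz). Proof. exact: density_integrable Qf. Qed.

Definition conv (f : R -> R) (z : R) : R := \int[mu]_y (fz y * f (z - y)).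

Lemma integrable_conv (f : R -> R) (B z : R) : measurable_fun [set: R] f ->
  (forall x, `|f x| <= B) -> mu.-integrable setT (EFin \o (fun y => fz y * f (z - y))).
Proof.
move=> mf fB; have i := integrable_scalef B ifz.
apply: le_integrable i => //.
  apply/measurable_EFinP; apply: measurable_funM => //.
  by apply: (measurableT_comp mf); exact: measurable_funB.
move=> y _; rewrite /= lee_fin normrM mulrC.
apply: le_trans (ler_norm _); rewrite (ger0_norm (fz0 y)).
by apply: ler_wpM2r; [exact: fz0|exact: fB].
Qed.

Lemma measurable_conv_kernel (f : R -> R) : measurable_fun [set: R] f ->
  measurable_fun [set: R * R] (fun z : R * R => fz z.2 * f (z.1 - z.2)).
Proof.
move=> mf; apply: measurable_funM.
  exact: (measurableT_comp mfz (@measurable_snd _ _ _ _)).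
apply: (measurableT_comp mf); apply: measurable_funB.
  exact: measurable_fst.
exact: measurable_snd.
Qed.

Lemma measurable_conv (f : R -> R) : measurable_fun [set: R] f ->
  measurable_fun [set: R] (conv f).
Proof.
move=> mf; apply: (@measurable_Rintegral_param _ _ (measurableTypeR R) (measurableTypeR R)
  R mu (fun z => fz z.2 * f (z.1 - z.2))).
exact: measurable_conv_kernel.
Qed.

Lemma conv_ge0 (f : R -> R) z : (forall x, 0 <= f x) -> 0 <= conv f z.
Proof. by move=> f0; apply: Rintegral_ge0 => y _; rewrite mulr_ge0. Qed.

(** Tonelli and the substitution z = x + y. *)
Lemma law_conv (P : probability R R) (f : R -> R) (B : R) (k : R -> \bar R) :
  has_density P f -> (forall x, `|f x| <= B) ->
  measurable_fun [set: R] k -> (forall x, 0 <= k x)%E ->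
  (\int[P]_x \int[Q]_y k (x + y)%R = \int[mu]_z (k z * (conv f z)%:E))%E.
Proof.
move=> Pf fB mk k0.
have mf : measurable_fun [set: R] f by case: Pf.
have f0 x : 0 <= f x by case: Pf.
have mkxy : measurable_fun [set: R * R] (fun z : R * R => k (z.1 + z.2)).
  apply: (measurableT_comp mk); apply: measurable_funD.
    exact: measurable_fst.
  exact: measurable_snd.
have mkq : measurable_fun [set: R * R] (fun z : R * R => (k (z.1 + z.2)%R * (fz z.2)%:E)%E).
  apply: emeasurable_funM => //; apply/measurable_EFinP.
  exact: (measurableT_comp mfz (@measurable_snd _ _ _ _)).
transitivity (\int[P]_x \int[mu]_y (k (x + y)%R * (fz y)%:E))%E.
  apply: eq_integral => x _; apply: (ge0_integral_density Qf (h := fun y => k (x + y)%R)) => //.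
  by apply: (measurableT_comp mk); exact: measurable_funD.
rewrite (ge0_integral_density Pf); last 2 first.
- apply: (@measurable_fun_fubini_tonelli_F _ _ (measurableTypeR R) (measurableTypeR R) R mu
    (fun z : R * R => (k (z.1 + z.2)%R * (fz z.2)%:E)%E)) => //.
  by move=> z; rewrite mule_ge0// lee_fin.
- by move=> x; apply: integral_ge0 => y _; rewrite mule_ge0// lee_fin.
pose g1 (z : R * R) := (k (z.1 + z.2)%R * (fz z.2)%:E * (f z.1)%:E)%E.
have mg1 : measurable_fun [set: R * R] g1.
  apply: emeasurable_funM => //; apply/measurable_EFinP.
  exact: (measurableT_comp mf (@measurable_fst _ _ _ _)).
have g10 z : (0 <= g1 z)%E by rewrite /g1 !mule_ge0// lee_fin.
transitivity (\int[mu]_x \int[mu]_y g1 (x, y))%E.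
  apply: eq_integral => x _; rewrite -ge0_integralZr//.
  - exact: (measurableT_comp mkq (measurable_pair1 x)).
  - by move=> y _; rewrite mule_ge0// lee_fin.
  - by rewrite lee_fin.
rewrite (@fubini_tonelli _ _ (measurableTypeR R) (measurableTypeR R) R mu mu g1)//.
pose g2 (z : R * R) := (k z.2 * (fz z.1 * f (z.2 - z.1))%R%:E)%E.
have mg2 : measurable_fun [set: R * R] g2.
  apply: emeasurable_funM.
    exact: (measurableT_comp mk (@measurable_snd _ _ _ _)).
  apply/measurable_EFinP; apply: measurable_funM.
    exact: (measurableT_comp mfz (@measurable_fst _ _ _ _)).
  apply: (measurableT_comp mf); apply: measurable_funB.
    exact: measurable_snd.
  exact: measurable_fst.
have g20 z : (0 <= g2 z)%E by rewrite /g2 mule_ge0// lee_fin mulr_ge0.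
transitivity (\int[mu]_y \int[mu]_z g2 (y, z))%E.
  apply: eq_integral => y _.
  rewrite -[RHS](ge0_integral_addr y (f := fun z => g2 (y, z))); last 2 first.
  - exact: (measurableT_comp mg2 (measurable_pair1 y)).
  - by move=> z; exact: g20.
  by apply: eq_integral => x _; rewrite /g1 /g2 /= addrK EFinM muleA.
rewrite (@fubini_tonelli _ _ (measurableTypeR R) (measurableTypeR R) R mu mu g2)//.
apply: eq_integral => z _; rewrite /g2 /= ge0_integralZl//; last 2 first.
- apply/measurable_EFinP; apply: measurable_funM => //.
  by apply: (measurableT_comp mf); exact: measurable_funB.
- by move=> y _; rewrite lee_fin mulr_ge0.
congr (_ * _)%E; rewrite /conv /Rintegral fineK//.
by apply: integrable_fin_num => //; exact: integrable_conv fB.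
Qed.

End convolution.

(** * Chi-square distance between observation densities *)

Section observation_density.
Context {R : realType}.
Local Notation mu := (@lebesgue_measure R).
Variables (Q : probability R R) (fz : R -> R).
Hypothesis Qf : has_density Q fz.

Let mfz : measurable_fun [set: R] fz. Proof. by case: Qf. Qed.
Let fz0 x : 0 <= fz x. Proof. by case: Qf. Qed.
Let ifz : mu.-integrable setT (EFin \o fz). Proof. exact: density_integrable Qf. Qed.

Definition cos_part (s : R) : R := complex.Re (fourier fz s).
Definition sin_part (s : R) : R := complex.Im (fourier fz s).

Lemma trig_part_le1 (th s : R) : `|\int[mu]_y (fz y * cos (s * y + th))| <= 1.
Proof.
have ic := integrable_mul_cos s th ifz.
apply: (le_trans (le_normr_Rintegral _ ic)) => //.
have -> : 1 = \int[mu]_y fz y by rewrite /Rintegral (density_integral1 Qf).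
apply: le_Rintegral => //; first exact: integrable_norm ic.
by move=> y _; rewrite normrM (ger0_norm (fz0 y)) ler_piMr// cos_norm_le1.
Qed.

Lemma measurable_trig_part (th : R) :
  measurable_fun [set: R] (fun s => \int[mu]_y (fz y * cos (s * y + th))).
Proof.
apply: (@measurable_Rintegral_param _ _ (measurableTypeR R) (measurableTypeR R) R mu
  (fun z => fz z.2 * cos (z.1 * z.2 + th))).
apply: measurable_funM; first exact: (measurableT_comp mfz (@measurable_snd _ _ _ _)).
apply: (measurableT_comp (continuous_measurable_fun (@continuous_cos R))).
apply: measurable_funD => //; apply: measurable_funM; first exact: measurable_fst.
exact: measurable_snd.
Qed.

Lemma cos_partE : cos_part = fun s => \int[mu]_y (fz y * cos (s * y + 0)).
Proof. by apply/funext => s; apply: eq_Rintegral => y _; rewrite addr0. Qed.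

Lemma sin_partE : sin_part = fun s => \int[mu]_y (fz y * cos (s * y + - (pi / 2))).
Proof. by apply/funext => s; apply: eq_Rintegral => y _; rewrite cosBpihalf. Qed.

Lemma cos_part_le1 s : `|cos_part s| <= 1.
Proof. by rewrite cos_partE trig_part_le1. Qed.

Lemma sin_part_le1 s : `|sin_part s| <= 1.
Proof. by rewrite sin_partE trig_part_le1. Qed.

Lemma measurable_cos_part : measurable_fun [set: R] cos_part.
Proof. by rewrite cos_partE; exact: measurable_trig_part. Qed.

Lemma measurable_sin_part : measurable_fun [set: R] sin_part.
Proof. by rewrite sin_partE; exact: measurable_trig_part. Qed.

(** Fubini: convolution with the noise multiplies the amplitude of each frequency by the
    noise transform. *)
Lemma conv_wave (N z : R) : 1 <= N ->
  conv fz (wave N) z = band_wave N cos_part sin_part z.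
Proof.
move=> N1.
pose b (w : R * R) := cos (w.2 * (z - w.1) + - (pi / 2)).
have mb : measurable_fun [set: R * R] b.
  apply: (measurableT_comp (continuous_measurable_fun (@continuous_cos R))).
  apply: measurable_funD => //; apply: measurable_funM; first exact: measurable_snd.
  by apply: measurable_funB => //; exact: measurable_fst.
have b1 w : `|b w| <= 1 by exact: cos_norm_le1.
have h := @Rfubini _ _ (measurableTypeR R) (measurableTypeR R) R mu mu fz _ b
  ifz (integrable_band_bump N1) mb b1.
rewrite [LHS]h /band_wave /cosT.
have ic (ph s : R) := integrable_mul_cos s ph ifz.
have ic0 (s : R) : mu.-integrable setT (EFin \o (fun y => fz y * cos (s * y))).
  by have := ic 0 s; apply: eq_integrable => // y _; rewrite /= addr0.
have is0 (s : R) : mu.-integrable setT (EFin \o (fun y => fz y * sin (s * y))).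
  have := ic (- (pi / 2)) s; apply: eq_integrable => // y _ /=; congr (_ * _)%:E.
  by rewrite cosBpihalf.
have inner s : \int[mu]_y (fz y * b (y, s)) =
    cos (s * z + - (pi / 2)) * cos_part s + - cos (s * z + 0) * sin_part s.
  rewrite /cos_part /sin_part /=.
  rewrite -(Rintegral_scalef _ (ic0 s)) -(Rintegral_scalef _ (is0 s)).
  rewrite -(Rintegral_addf (integrable_scalef _ (ic0 s)) (integrable_scalef _ (is0 s))).
  apply: eq_Rintegral => y _; rewrite /b /=.
  rewrite (_ : s * (z - y) + - (pi / 2) = s * z + - (pi / 2) - s * y); last by ring.
  rewrite cosB addr0.
  by rewrite sinBpihalf; ring.
have split s : band N (bump N) s * (cos (s * z + - (pi / 2)) * cos_part s + - cos (s * z + 0) * sin_part s)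
   = band N (fun s0 => bump N s0 * cos_part s0) s * cos (s * z + - (pi / 2)) +
     -1 * (band N (fun s0 => bump N s0 * sin_part s0) s * cos (s * z + 0)).
  by rewrite !bandE; case: ifP => _; ring.
transitivity (\int[mu]_s (band N (fun s0 => bump N s0 * cos_part s0) s * cos (s * z + - (pi / 2)) +
     -1 * (band N (fun s0 => bump N s0 * sin_part s0) s * cos (s * z + 0)))).
  by apply: eq_Rintegral => s _; rewrite inner split.
have N0 : 0 < N by exact: lt_le_trans N1.
have mb' := continuous_measurable_fun (continuous_bump N1).
have bdd (D : R -> R) : measurable_fun [set: R] D -> (forall s, `|D s| <= 1) ->
    mu.-integrable setT (EFin \o band N (fun s => bump N s * D s)).
  move=> mD D1; apply: (integrable_band_bound N0 (B := 1)); first exact: measurable_funM.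
  by move=> s /(bump_le1 N1) hb; rewrite normrM -[leRHS]mulr1 ler_pM.
have iC := integrable_cosT_term (bdd _ measurable_cos_part cos_part_le1) (- (pi / 2)) z.
have iS := integrable_cosT_term (bdd _ measurable_sin_part sin_part_le1) 0 z.
by rewrite (Rintegral_addf iC (integrable_scalef _ iS)) (Rintegral_scalef _ iS) mulN1r.
Qed.

(** The expectation of 1 / (1 + y^2) under the noise: how much noise stays at bounded
    distance from 0. *)
Definition near_mass : R := \int[mu]_y (fz y / (1 + y ^+ 2)).

Lemma measurable_inv1Dsqr : measurable_fun [set: R] (fun y : R => (1 + y ^+ 2)^-1).
Proof. exact: continuous_measurable_fun (@continuous_oneDsqrV R). Qed.

Lemma inv1Dsqr_le1 (y : R) : 0 <= (1 + y ^+ 2)^-1 <= 1.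
Proof.
by rewrite invr_ge0 addr_ge0 ?sqr_ge0//= invf_le1 ?ltr_pwDl ?sqr_ge0// lerDl sqr_ge0.
Qed.

Lemma integrable_near_mass : mu.-integrable setT (EFin \o (fun y => fz y / (1 + y ^+ 2))).
Proof.
apply: le_integrable ifz => //.
  by apply/measurable_EFinP; apply: measurable_funM => //; exact: measurable_inv1Dsqr.
move=> y _; have /andP[h0 h1] := inv1Dsqr_le1 y.
by rewrite /= lee_fin normrM (ger0_norm h0) ler_piMr.
Qed.

(** For small [d] the expectation of exp (- d |y|) is at least 1/2, and exp (- d |y|) is
    at most a multiple of 1 / (1 + y^2). *)
Lemma near_mass_gt0 : 0 < near_mass.
Proof.
have cv := cvg_abel measurableT ifz.
rewrite [X in _ --> X](_ : _ = 1) in cv; last by rewrite /Rintegral (density_integral1 Qf).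
have [n _ /(_ n (leqnn n)) /= hn] : \forall n \near \oo,
    2^-1 <= \int[mu]_x (abel (abel_scale n) x * fz x).
  by apply: (cvgr_ge _ cv); rewrite invf_lt1// ltr1n.
set d := abel_scale n in hn.
have d0 : 0 < d := abel_scale_gt0 n.
have d1 : d <= 1 by rewrite invf_le1// ler1n.
have ia : mu.-integrable setT (EFin \o (fun x => abel d x * fz x)).
  apply: le_integrable ifz => //.
    by apply/measurable_EFinP; apply: measurable_funM => //; exact: measurable_abel.
  by move=> y _; rewrite /= lee_fin normrM (ger0_norm (abel_ge0 _ _)) ler_piMl// abel_le1.
have K0 : 0 < d ^+ 2 / 2 by rewrite divr_gt0 ?exprn_gt0.
have : d ^+ 2 / 2 * 2^-1 <= near_mass.
  apply: (@le_trans _ _ (d ^+ 2 / 2 * \int[mu]_x (abel d x * fz x))).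
    by rewrite ler_pM2l.
  rewrite -Rintegral_scalef//; apply: le_Rintegral => //.
  - exact: integrable_scalef.
  - exact: integrable_near_mass.
  move=> y _; rewrite mulrA mulrC ler_wpM2l// -[leRHS]mul1r ler_pdivlMr ?ltr_pwDl ?sqr_ge0//.
  rewrite /abel expRN mulrAC ler_pdivrMr ?expR_gt0// mul1r.
  have := expR_ge1Dxn 1 (mulr_ge0 (ltW d0) (normr_ge0 y)).
  rewrite (_ : 2`! = 2%N)// exprMn (real_normK (num_real y)).
  have : d ^+ 2 <= 1 by rewrite exprn_ile1// ltW.
  by have := sqr_ge0 d; lra.
by apply: lt_le_trans; rewrite mulr_gt0.
Qed.

Variables (lam N a t0 : R).
Hypotheses (lam1 : 1 <= lam) (N1 : 1 <= N) (a0 : 0 <= a).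

Let lam0 : 0 < lam. Proof. exact: lt_le_trans lam1. Qed.
Let N0 : 0 < N. Proof. exact: lt_le_trans N1. Qed.

(** The constant of the lower bound [conv_cdens0_ge] on the base observation density. *)
Definition floor_const : R := (2 * pi)^-1 * (2 * lam / (lam ^+ 2 + 2)) * near_mass.

Lemma floor_const_gt0 : 0 < floor_const.
Proof.
rewrite mulr_gt0 ?near_mass_gt0// mulr_gt0 ?invr_gt0 ?mulr_gt0 ?pi_gt0//.
by rewrite invr_gt0 addr_gt0 ?exprn_gt0.
Qed.

Lemma poisson_le x : `|poisson lam x| <= 2 / lam.
Proof.
rewrite ger0_norm ?poisson_ge0// ler_pdivrMr ?sqrD_gt0// mulrDr.
rewrite (_ : 2 / lam * lam ^+ 2 = 2 * lam); last by field; rewrite lt0r_neq0.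
by rewrite lerDl mulr_ge0 ?sqr_ge0// divr_ge0// ltW.
Qed.

Lemma wave_le x : `|wave N x| <= 5 * N.
Proof.
apply: (le_trans (wave_decay N1 x)); have /andP[_ h] := inv1Dsqr_le1 x.
by rewrite ler_piMr// mulr_ge0// ltW.
Qed.

Lemma cdens_bounded sg : `|sg| <= 1 -> forall x, `|cdens lam N a sg x| <=
  (2 * pi)^-1 * (2 / lam) + a * (5 * N).
Proof.
move=> sg1 x; rewrite (le_trans (ler_normD _ _))// lerD//.
  have p0 : 0 < (2 * pi : R)^-1 by rewrite invr_gt0 mulr_gt0// pi_gt0.
  by rewrite normrM (gtr0_norm p0) ler_pM2l// poisson_le.
rewrite 2!normrM (ger0_norm a0); apply: ler_pM; rewrite ?mulr_ge0//; last exact: wave_le.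
by rewrite ler_piMl.
Qed.

Lemma conv_cdens sg z : `|sg| <= 1 ->
  conv fz (cdens lam N a sg) z = conv fz (cdens lam N a 0) z + sg * a * conv fz (wave N) z.
Proof.
move=> sg1.
have n0 : `|0 : R| <= 1 by rewrite normr0.
have i0 := integrable_conv Qf z (measurable_cdens a lam1 N1 0) (cdens_bounded n0).
have i1 := integrable_conv Qf z (measurable_wave N1) wave_le.
rewrite /conv -(Rintegral_scalef _ i1) -(Rintegral_addf i0 (integrable_scalef _ i1)).
by apply: eq_Rintegral => y _; rewrite /cdens; ring.
Qed.

(** From lam^2 + (z - y)^2 <= (lam^2 + 2) (1 + z^2) (1 + y^2): a translate of the Cauchy
    density dominates a product in the two variables. *)
Lemma poisson_tensor_ge (z y : R) :
  2 * lam / (lam ^+ 2 + 2) * ((1 + z ^+ 2)^-1 * (1 + y ^+ 2)^-1) <= poisson lam (z - y).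
Proof.
have q1 : 0 < 1 + z ^+ 2 by rewrite ltr_pwDl ?sqr_ge0.
have q2 : 0 < 1 + y ^+ 2 by rewrite ltr_pwDl ?sqr_ge0.
have q3 : 0 < lam ^+ 2 + 2 by rewrite addr_gt0 ?exprn_gt0.
rewrite /poisson -mulrA ler_pM2l ?mulr_gt0// -!invfM lef_pV2 ?posrE ?sqrD_gt0//; last first.
  by rewrite !mulr_gt0.
apply: (@le_trans _ _ ((lam ^+ 2 + 2) * (1 + z ^+ 2 + y ^+ 2))).
  have := mulr_ge0 (sqr_ge0 lam) (sqr_ge0 z); have := mulr_ge0 (sqr_ge0 lam) (sqr_ge0 y).
  by have := sqr_ge0 (z + y); lra.
rewrite ler_pM2l//; have := mulr_ge0 (sqr_ge0 z) (sqr_ge0 y); lra.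
Qed.

Lemma conv_cdens0_ge z : floor_const / (1 + z ^+ 2) <= conv fz (cdens lam N a 0) z.
Proof.
have n0 : `|0 : R| <= 1 by rewrite normr0.
have i0 := integrable_conv Qf z (measurable_cdens a lam1 N1 0) (cdens_bounded n0).
rewrite /floor_const mulrAC -(Rintegral_scalef _ integrable_near_mass).
apply: le_Rintegral => //; first exact: integrable_scalef integrable_near_mass.
move=> y _; rewrite /cdens mul0r mul0r addr0.
have p0 : 0 <= (2 * pi : R)^-1 by rewrite invr_ge0 mulr_ge0// pi_ge0.
have := ler_wpM2l (mulr_ge0 (fz0 y) p0) (poisson_tensor_ge z y).
rewrite -[X in _ <= X -> _]mulrA; apply: le_trans.
by rewrite le_eqVlt; apply/orP; left; apply/eqP; move: (_ : R)^-1 => c; ring.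
Qed.

Definition obs_density (sg z : R) : R := conv fz (dens lam N a t0 sg) z.

Lemma obs_densityE sg z : obs_density sg z = conv fz (cdens lam N a sg) (z - t0).
Proof.
by apply: eq_Rintegral => y _; rewrite /dens; congr (_ * cdens _ _ _ _ _); ring.
Qed.

Lemma obs_density0_gt0 z : 0 < obs_density 0 z.
Proof.
rewrite obs_densityE; apply: lt_le_trans (conv_cdens0_ge _).
by rewrite divr_gt0 ?floor_const_gt0// ltr_pwDl ?sqr_ge0.
Qed.

Lemma measurable_obs_density sg : measurable_fun [set: R] (obs_density sg).
Proof. by apply: (measurable_conv Qf); exact: measurable_dens. Qed.

Variable M : R.
Variables (C' S' : R -> R).
Hypotheses (dC : forall s : R, is_derive s 1 cos_part (C' s))
  (dS : forall s : R, is_derive s 1 sin_part (S' s))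
  (cC' : continuous C') (cS' : continuous S')
  (CM : forall s, N <= s <= 2 * N -> `|cos_part s| <= M)
  (SM : forall s, N <= s <= 2 * N -> `|sin_part s| <= M)
  (C'M : forall s, N <= s <= 2 * N -> `|C' s| <= M)
  (S'M : forall s, N <= s <= 2 * N -> `|S' s| <= M).

(** The observation densities differ by [sg * a] times the filtered wave, and the division
    by the base density costs at most a factor 1 + z^2 ([conv_cdens0_ge]), which
    [band_wave_L2] allows for. *)
Lemma chi_square_le sg : `|sg| <= 1 ->
  (\int[mu]_z ((obs_density sg z - obs_density 0 z) ^+ 2 / obs_density 0 z)%:E <=
   (a ^+ 2 / floor_const * (80 * pi * N * M ^+ 2))%:E)%E.
Proof.
move=> sg1; set W := band_wave N cos_part sin_part.
have mW : measurable_fun [set: R] W := measurable_band_wave N1 dC dS.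
pose H z := a ^+ 2 / floor_const * (W z ^+ 2 * (1 + z ^+ 2)).
have c0 : 0 <= a ^+ 2 / floor_const by rewrite divr_ge0 ?sqr_ge0// ltW// floor_const_gt0.
have H0 z : 0 <= H z by rewrite mulr_ge0// mulr_ge0 ?addr_ge0 ?sqr_ge0.
have mH0 : measurable_fun [set: R] (fun z => W z ^+ 2 * (1 + z ^+ 2)).
  apply: measurable_funM; first exact: measurable_funX.
  by apply: measurable_funD => //; exact: measurable_funX.
apply: (@le_trans _ _ (\int[mu]_z (H (z + - t0))%:E)%E).
  apply: ge0_le_integral_nomeas => z _; rewrite lee_fin.
    by rewrite divr_ge0 ?sqr_ge0// ltW// obs_density0_gt0.
  rewrite !obs_densityE conv_cdens// addrAC subrr add0r conv_wave// -/W.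
  set x := z - t0; have h := conv_cdens0_ge x.
  have q : 0 < floor_const / (1 + x ^+ 2).
    by rewrite divr_gt0 ?floor_const_gt0// ltr_pwDl ?sqr_ge0.
  rewrite ler_pdivrMr; last exact: lt_le_trans h.
  have sg2 : sg ^+ 2 <= 1 by rewrite -(real_normK (num_real sg)) exprn_ile1.
  apply: (@le_trans _ _ (H x * (floor_const / (1 + x ^+ 2)))); last by rewrite ler_wpM2l.
  have -> : H x * (floor_const / (1 + x ^+ 2)) = a ^+ 2 * W x ^+ 2.
    have cn0 := lt0r_neq0 floor_const_gt0.
    have xn0 : 1 + x ^+ 2 != 0 by rewrite lt0r_neq0// ltr_pwDl ?sqr_ge0.
    by rewrite /H; move: floor_const cn0 => c cn0; field; rewrite ?cn0 ?xn0.
  rewrite !exprMn -mulrA ler_piMl// mulr_ge0 ?sqr_ge0//.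
rewrite (ge0_integral_addr (- t0) (f := EFin \o H)); last 2 first.
- by apply/measurable_EFinP; exact: measurable_funM.
- by move=> z; rewrite lee_fin.
under eq_integral => z _ do rewrite /= /H EFinM.
rewrite ge0_integralZl//; last 2 first.
- by apply/measurable_EFinP.
- by move=> z _; rewrite lee_fin mulr_ge0 ?addr_ge0 ?sqr_ge0.
rewrite [leRHS]EFinM; apply: lee_wpmul2l; first by rewrite lee_fin.
exact: (band_wave_L2 N1 dC dS cC' cS' CM SM C'M S'M).
Qed.

End observation_density.

(** * Change of measure for samples *)

Section product_experiment.
Context d (T : measurableType d) (R : realType) (Y : T -> R).
Hypothesis mY : measurable_fun [set: T] Y.

Definition observe n (w : n.-tuple T) : n.-tuple R := [tuple of map Y w].

Lemma measurable_observe n : measurable_fun [set: n.-tuple T] (@observe n).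
Proof.
apply/measurable_fun_tnthP => i.
rewrite (_ : _ \o _ = Y \o (fun w : n.-tuple T => tnth w i)); last first.
  by apply/funext => w /=; rewrite /observe tnth_map.
exact: (measurableT_comp mY (measurable_tnth i)).
Qed.

Lemma observe_cons n (t : T) (w : n.-tuple T) :
  observe (tcons (t, w)) = tcons (Y t, observe w).
Proof. exact/val_inj. Qed.

(** When [r] is the likelihood ratio of one observation, this is that of the sample. *)
Definition lik (r : R -> R) n (v : n.-tuple R) : R := \prod_(y <- v) r y.

Lemma lik_cons r n (y : R) (v : n.-tuple R) : lik r (tcons (y, v)) = r y * lik r v.
Proof. by rewrite /lik /tcons /= big_cons. Qed.

Variable r : R -> R.
Hypotheses (mr : measurable_fun [set: R] r) (r0 : forall y, 0 <= r y).

Lemma measurable_lik n : measurable_fun [set: n.-tuple R] (@lik r n).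
Proof.
rewrite (_ : @lik r n = fun v => \prod_(i < n) r (tnth v i)); last first.
  by apply/funext => v; rewrite /lik big_tuple.
apply: measurable_prod => i _.
exact: (measurableT_comp mr (measurable_tnth i)).
Qed.

Lemma measurable_lik_observe n :
  measurable_fun [set: n.-tuple T] (fun w => (lik r (observe w))%:E).
Proof.
apply/measurable_EFinP.
have h := measurableT_comp (@measurable_lik n) (@measurable_observe n).
exact: h.
Qed.

Lemma lik_ge0 n (v : n.-tuple R) : 0 <= lik r v.
Proof. by apply: prodr_ge0 => y _. Qed.

Lemma integral_iid_cons (P : probability T R) n (g : n.+1.-tuple T -> \bar R) :
  measurable_fun setT g -> (forall w, 0 <= g w)%E ->
  (\int[iid P n.+1]_w g w = \int[P]_t \int[iid P n]_w g (tcons (t, w)))%E.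
Proof.
move=> mg g0.
have h := @ge0_integral_distribution _ _ _ _ _ (P \x iid P n)%E (@tcons d T n) g mg g0.
rewrite [LHS]h.
rewrite (@fubini_tonelli1 _ _ _ _ _ P (iid P n) (g \o @tcons d T n))//.
  exact: (measurableT_comp mg (@measurable_tcons d T n)).
by move=> x; exact: g0.
Qed.

Lemma integral_lik (P : probability T R) n :
  (\int[iid P n]_w (lik r (observe w))%:E = (\int[P]_t (r (Y t))%:E) ^+ n)%E.
Proof.
have mry : measurable_fun [set: T] (fun t => (r (Y t))%:E).
  by apply/measurable_EFinP; exact: (measurableT_comp mr mY).
have ml m : measurable_fun [set: m.-tuple T] (fun w => (lik r (observe w))%:E).
  exact: measurable_lik_observe.
elim: n => [|n IH].
  transitivity (\int[iid P 0]_w (cst 1%E w))%E; last first.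
    by rewrite integral_cst// mul1e expe0 [LHS]probability_setT.
  by apply: eq_integral => w _; rewrite /lik (tuple0 (observe w)) big_nil.
rewrite integral_iid_cons//; last by move=> w; rewrite lee_fin lik_ge0.
rewrite expeS -IH -ge0_integralZr//; last 2 first.
- by move=> t _; rewrite lee_fin.
- by apply: integral_ge0 => w _; rewrite lee_fin lik_ge0.
apply: eq_integral => t _; rewrite -ge0_integralZl//; last 3 first.
- exact: ml.
- by move=> w _; rewrite lee_fin lik_ge0.
- by rewrite lee_fin.
by apply: eq_integral => w _; rewrite observe_cons lik_cons EFinM.
Qed.

Variables P0 P1 : probability T R.
Hypothesis change : forall k : R -> \bar R, measurable_fun setT k -> (forall y, 0 <= k y)%E ->
  (\int[P1]_t k (Y t) = \int[P0]_t (k (Y t) * (r (Y t))%:E))%E.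

(** By induction on [n], changing the law of one observation at a time. *)
Lemma change_iid n (k : n.-tuple R -> \bar R) : measurable_fun setT k -> (forall v, 0 <= k v)%E ->
  (\int[iid P1 n]_w k (observe w) =
   \int[iid P0 n]_w (k (observe w) * (lik r (observe w))%:E))%E.
Proof.
elim: n k => [k mk k0|n IH k mk k0].
  apply: eq_integral => w _.
  rewrite /lik (_ : \prod_(y <- observe w) r y = 1) ?mule1//.
  by rewrite (tuple0 (observe w)) big_nil.
have mo := measurable_observe.
have ml m : measurable_fun [set: m.-tuple T] (fun w => (lik r (observe w))%:E).
  exact: measurable_lik_observe.
rewrite integral_iid_cons//; last exact: (measurableT_comp mk (mo n.+1)).
rewrite integral_iid_cons//; last 2 first.
- apply: emeasurable_funM; last exact: measurable_lik_observe.
  exact: (measurableT_comp mk (mo n.+1)).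
- by move=> w; rewrite mule_ge0// lee_fin lik_ge0.
pose K (y : R) := (\int[iid P0 n]_w (k (tcons (y, observe w)) * (lik r (observe w))%:E))%E.
pose G (z : R * n.-tuple T) := (k (tcons (z.1, observe z.2)) * (lik r (observe z.2))%:E)%E.
have mG : measurable_fun [set: R * n.-tuple T] G.
  apply: emeasurable_funM.
    apply: (measurableT_comp mk); apply: measurable_cons; first exact: measurable_fst.
    exact: (measurableT_comp (mo n) (@measurable_snd _ _ _ _)).
  exact: (measurableT_comp (ml n) (@measurable_snd _ _ _ _)).
have G0 z : (0 <= G z)%E by rewrite mule_ge0// lee_fin lik_ge0.
have mK : measurable_fun [set: R] K.
  exact: (@measurable_fun_fubini_tonelli_F _ _ _ _ _ (iid P0 n) G).
have K0 y : (0 <= K y)%E by apply: integral_ge0 => w _; exact: (G0 (y, w)).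
transitivity (\int[P1]_t K (Y t))%E.
  apply: eq_integral => t _; rewrite /K -(IH (fun v => k (tcons (Y t, v))))//.
    by apply: eq_integral => w _; rewrite observe_cons.
  have mkt := measurableT_comp mk (@measurable_tcons _ R n).
  exact: (measurableT_comp mkt (measurable_pair1 (Y t))).
rewrite change//; apply: eq_integral => t _; rewrite -ge0_integralZr//; last 3 first.
- exact: (measurableT_comp mG (measurable_pair1 (Y t))).
- by move=> w _; exact: (G0 (Y t, w)).
- by rewrite lee_fin.
apply: eq_integral => w _; rewrite observe_cons lik_cons EFinM.
by rewrite -muleA (muleC (r (Y t))%:E).
Qed.

End product_experiment.

(** * Tests under a second moment bound *)

Section likelihood_test.
Context d (T : measurableType d) (R : realType) (Y : T -> R).
Hypothesis mY : measurable_fun [set: T] Y.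
Variable r : R -> R.
Hypotheses (mr : measurable_fun [set: R] r) (r0 : forall y, 0 <= r y).
Variables P0 P1 : probability T R.
Hypothesis change : forall k : R -> \bar R, measurable_fun setT k -> (forall y, 0 <= k y)%E ->
  (\int[P1]_t k (Y t) = \int[P0]_t (k (Y t) * (r (Y t))%:E))%E.
Variable X : R.
Hypothesis hX : (\int[P1]_t (r (Y t))%:E = X%:E)%E.

(** With l the likelihood ratio of the sample, l <= 1 + (2 kap)^-1 + kap / 2 * (l - 1)^2
    on the event and 0 <= kap / 2 * (l - 1)^2 off it.  Integrated under the first law,
    where l has mean 1 and second moment X^n, this gives the inequality. *)
Lemma likelihood_test_le n (A : set (n.-tuple R)) (kap : R) : measurable A -> 0 < kap ->
  fine (iid P1 n (@observe _ _ _ Y n @^-1` A)) + kap <=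
  kap / 2 * (X ^+ n + 1) + (1 + (2 * kap)^-1) * fine (iid P0 n (@observe _ _ _ Y n @^-1` A)).
Proof.
move=> mA kap0.
pose B := @observe _ _ _ Y n @^-1` A.
have mo := @measurable_observe _ T R Y mY n.
have mB : measurable B by rewrite -[B]setTI; exact: mo.
have ml := @measurable_lik_observe _ T R Y mY r mr n.
pose l w := lik r (@observe _ _ _ Y n w).
have l0 w : 0 <= l w by exact: lik_ge0.
have mlr : measurable_fun [set: n.-tuple T] l by exact/measurable_EFinP.
pose i w : R := \1_B w.
have mi : measurable_fun [set: n.-tuple T] i by exact: measurable_indic.
have i0 w : 0 <= i w by rewrite /i indicE.
have e1 : (\int[iid P1 n]_w (i w)%:E = iid P1 n B)%E by rewrite integral_indic// setIT.
have e0 : (\int[iid P0 n]_w (i w)%:E = iid P0 n B)%E by rewrite integral_indic// setIT.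
have E1 : (\int[iid P0 n]_w (l w * i w)%:E = iid P1 n B)%E.
  rewrite -e1 (change_iid mY mr r0 change (k := fun v => (\1_A v)%:E)).
  - by apply: eq_integral => w _; rewrite -EFinM mulrC.
  - by apply/measurable_EFinP; exact: measurable_indic.
  - by move=> v; rewrite lee_fin indicE.
have E2 : (\int[iid P0 n]_w (l w)%:E = 1)%E.
  have := change_iid mY mr r0 change (k := fun _ : n.-tuple R => 1%E).
  move=> h; transitivity (\int[iid P0 n]_w (1 * (l w)%:E))%E.
    by apply: eq_integral => w _; rewrite mul1e.
  rewrite -h//.
  by rewrite integral_cst// mul1e [LHS]probability_setT.
have E3 : (\int[iid P0 n]_w (l w ^+ 2)%:E = (X ^+ n)%:E)%E.
  rewrite EFin_expe -hX -(integral_lik mY mr r0).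
  rewrite (change_iid mY mr r0 change (k := fun v => (lik r v)%:E)).
  - by apply: eq_integral => w _; rewrite -EFinM expr2.
  - by apply/measurable_EFinP; exact: measurable_lik.
  - by move=> v; rewrite lee_fin lik_ge0.
have pt w : l w * i w + kap * l w <= kap / 2 * l w ^+ 2 + (kap / 2 + (1 + (2 * kap)^-1) * i w).
  have kn0 : kap != 0 by rewrite lt0r_neq0.
  rewrite /i indicE; case: (w \in B) => /=.
    have := sqr_ge0 (kap * (l w - 1) - 1).
    have ki : 0 < (2 * kap)^-1 by rewrite invr_gt0 mulr_gt0.
    move=> /(mulr_ge0 (ltW ki)).
    have -> : (2 * kap)^-1 * (kap * (l w - 1) - 1) ^+ 2 =
        kap / 2 * (l w - 1) ^+ 2 - (l w - 1) + (2 * kap)^-1 by field.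
    by move: (2 * kap)^-1 => c; lra.
  have := mulr_ge0 (ltW kap0) (sqr_ge0 (l w - 1)); lra.
have main : (\int[iid P0 n]_w (l w * i w + kap * l w)%:E <=
    \int[iid P0 n]_w (kap / 2 * l w ^+ 2 + (kap / 2 + (1 + (2 * kap)^-1) * i w))%:E)%E.
  apply: ge0_le_integral_nomeas => w _; rewrite lee_fin//.
  by rewrite addr_ge0 ?mulr_ge0// ltW.
have c0 : 0 <= 1 + (2 * kap)^-1 by rewrite addr_ge0// invr_ge0 mulr_ge0// ltW.
have k20 : 0 <= kap / 2 by rewrite divr_ge0// ltW.
have mEF (f : n.-tuple T -> R) : measurable_fun [set: n.-tuple T] f ->
  measurable_fun [set: n.-tuple T] (fun w => (f w)%:E) by move=> mf; exact/measurable_EFinP.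
have scale (f : n.-tuple T -> R) c : measurable_fun [set: n.-tuple T] f -> (forall w, 0 <= f w) ->
    0 <= c -> (\int[iid P0 n]_w (c * f w)%:E = c%:E * \int[iid P0 n]_w (f w)%:E)%E.
  move=> mf f0 cge0; under eq_integral => w _ do rewrite EFinM.
  by rewrite ge0_integralZl//; [exact: mEF|move=> w _; rewrite lee_fin].
have addi (f g : n.-tuple T -> R) : measurable_fun [set: n.-tuple T] f ->
    measurable_fun [set: n.-tuple T] g -> (forall w, 0 <= f w) -> (forall w, 0 <= g w) ->
    (\int[iid P0 n]_w (f w + g w)%:E = \int[iid P0 n]_w (f w)%:E + \int[iid P0 n]_w (g w)%:E)%E.
  move=> mf mg f0 g0; under eq_integral => w _ do rewrite EFinD.
  rewrite ge0_integralD//.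
  - by move=> w _; rewrite lee_fin.
  - exact: mEF.
  - by move=> w _; rewrite lee_fin.
  - exact: mEF.
have kap0' := ltW kap0.
have l20 w : 0 <= l w ^+ 2 by exact: sqr_ge0.
have ml2 : measurable_fun [set: n.-tuple T] (fun w => l w ^+ 2) by exact: measurable_funX.
have mli : measurable_fun [set: n.-tuple T] (fun w => l w * i w) by exact: measurable_funM.
rewrite addi ?scale// in main; last 3 first.
- exact: measurable_funM.
- by move=> w; rewrite mulr_ge0.
- by move=> w; rewrite mulr_ge0// ltW.
rewrite addi ?scale// in main; last 4 first.
- exact: measurable_funM.
- by apply: measurable_funD => //; exact: measurable_funM.
- by move=> w; rewrite mulr_ge0// sqr_ge0.
- by move=> w; rewrite addr_ge0// mulr_ge0.
rewrite addi ?scale// in main; last 2 first.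
- exact: measurable_funM.
- by move=> w; rewrite mulr_ge0.
have cst1 c : (\int[iid P0 n]_w c%:E = c%:E)%E.
  by rewrite integral_cst// [X in (_ * X)%E]probability_setT mule1.
rewrite E1 E2 E3 e0 cst1 in main.
have f1 : iid P1 n B \is a fin_num by exact: fin_num_measure.
have f0 : iid P0 n B \is a fin_num by exact: fin_num_measure.
rewrite -(fineK f1) -(fineK f0) mule1 -!EFinM -!EFinD lee_fin in main.
by rewrite -/B; lra.
Qed.

End likelihood_test.

Section arithmetic.
Context {R : realType}.

Lemma quartic_le (t : R) : t ^+ 3 * (1 - t) <= 27 / 256.
Proof.
(* 27 / 256 - t^3 (1 - t) is (4 t - 3)^2 (16 t^2 + 8 t + 3) / 256. *)
have h : 0 <= 16 * t ^+ 2 + 8 * t + 3.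
  by have := sqr_ge0 (4 * t + 1); lra.
have := mulr_ge0 (sqr_ge0 (4 * t - 3)) h; lra.
Qed.

(** The inequality of [likelihood_test_le] at [kap = 2 * eps].  In terms of t = eps^(1/4)
    it would imply 7/8 <= t^3 + eps / 2, whereas t^3 (1 - t) <= 27/256 and eps < 1/2. *)
Lemma no_good_test (eps E q0 q1 : R) : 0 < eps < 2^-1 ->
  E <= expR (4^-1 * ln eps^-1) ->
  q0 <= eps / 2 -> 1 - eps <= q1 ->
  q1 + 2 * eps <= 2 * eps / 2 * (E + 1) + (1 + (2 * (2 * eps))^-1) * q0 -> False.
Proof.
move=> /andP[e0 e2] hE hq0 hq1 h.
pose t := expR (4^-1 * ln eps).
have t0 : 0 < t := expR_gt0 _.
have t4 : t ^+ 4 = eps.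
  rewrite /t -expRM_natr mulrC mulrA mulfV// mul1r lnK//.
have {}hE : E <= t^-1.
  by rewrite (le_trans hE)// /t -expRN lnV ?posrE// mulrN.
have q := quartic_le t.
have h1 : eps * E <= t ^+ 3.
  rewrite -t4 exprS mulrC -[leRHS]mul1r -(mulVf (lt0r_neq0 t0)) -!mulrA.
  by rewrite ler_wpM2r// mulr_ge0 ?exprn_ge0// ltW.
have h2 : (2 * (2 * eps))^-1 * q0 <= 8^-1.
  apply: (@le_trans _ _ ((2 * (2 * eps))^-1 * (eps / 2))).
    by rewrite ler_wpM2l// invr_ge0 !mulr_ge0// ltW.
  by rewrite (_ : _ * _ = 8^-1)//; field; rewrite lt0r_neq0.
have h3 : t ^+ 3 * (1 - t) = t ^+ 3 - eps by rewrite -t4; ring.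
lra.
Qed.

End arithmetic.

(** * Lower bound from three hypotheses *)

Section three_hypotheses.
Context {R : realType}.
Local Notation mu := (@lebesgue_measure R).
Variables (Q : probability R R) (fz : R -> R).
Hypothesis Qf : has_density Q fz.
Variables (lam N a t0 : R).
Hypotheses (lam1 : 1 <= lam) (N1 : 1 <= N) (a0 : 0 < a)
  (small : a * (5 * N) <= (pi * lam)^-1).
Variable c : R.
Hypothesis chi_le : forall sg, `|sg| <= 1 ->
  (\int[mu]_z ((obs_density fz lam N a t0 sg z - obs_density fz lam N a t0 0 z) ^+ 2 /
      obs_density fz lam N a t0 0 z)%:E <= c%:E)%E.
Variable mus : R -> probability R R.
Hypothesis mus_dens : forall sg, `|sg| <= 1 -> has_density (mus sg) (dens lam N a t0 sg).

Local Notation g := (obs_density fz lam N a t0).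

Let a0' : 0 <= a. Proof. exact: ltW. Qed.

Let n0 : `|0 : R| <= 1. Proof. by rewrite normr0. Qed.

Let g0_gt0 z : 0 < g 0 z. Proof. by apply: (obs_density0_gt0 Qf). Qed.

Let mg sg : measurable_fun [set: R] (g sg). Proof. by apply: (measurable_obs_density Qf). Qed.

Let g_ge0 sg z : `|sg| <= 1 -> 0 <= g sg z.
Proof. by move=> sg1; apply: (conv_ge0 Qf) => x; apply: dens_ge0. Qed.

(** The power - 1 is the inverse on positive reals and is measurable in its base. *)
Definition obs_ratio (sg z : R) : R := g sg z * g 0 z `^ (-1).

Lemma obs_ratioE sg z : obs_ratio sg z = g sg z / g 0 z.
Proof. by rewrite /obs_ratio powR_inv1// ltW. Qed.

Let mr sg : measurable_fun [set: R] (obs_ratio sg).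
Proof.
apply: measurable_funM; first exact: mg.
exact: (measurableT_comp (@measurable_powR R (-1)) (mg 0)).
Qed.

Let r0 sg z : `|sg| <= 1 -> 0 <= obs_ratio sg z.
Proof. by move=> sg1; rewrite obs_ratioE divr_ge0 ?g_ge0// ltW. Qed.

Let Y (t : R * R) : R := t.1 + t.2.

Let mY : measurable_fun [set: R * R] Y.
Proof. by apply: measurable_funD; [exact: measurable_fst|exact: measurable_snd]. Qed.

Lemma pair_law sg (k : R -> \bar R) : `|sg| <= 1 -> measurable_fun setT k ->
  (forall y, 0 <= k y)%E ->
  (\int[mus sg \x Q]_t k (Y t) = \int[mu]_z (k z * (g sg z)%:E))%E.
Proof.
move=> sg1 mk k0.
rewrite (@fubini_tonelli1 _ _ _ _ _ (mus sg) Q (k \o Y))//; last 2 first.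
- exact: (measurableT_comp mk mY).
- by move=> x; exact: k0.
apply: (law_conv Qf (mus_dens sg1) (B := (2 * pi)^-1 * (2 / lam) + a * (5 * N))) => //.
by move=> x; apply: cdens_bounded.
Qed.

Lemma pair_change sg (k : R -> \bar R) : `|sg| <= 1 -> measurable_fun setT k ->
  (forall y, 0 <= k y)%E ->
  (\int[mus sg \x Q]_t k (Y t) = \int[mus 0 \x Q]_t (k (Y t) * (obs_ratio sg (Y t))%:E))%E.
Proof.
move=> sg1 mk k0; rewrite pair_law//.
rewrite (pair_law (k := fun y => (k y * (obs_ratio sg y)%:E)%E) n0).
- apply: eq_integral => z _; rewrite -muleA -EFinM; congr (_ * _%:E)%E.
  by rewrite obs_ratioE divfK// lt0r_neq0.
- by apply: emeasurable_funM => //; exact/measurable_EFinP.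
- by move=> y; rewrite mule_ge0// lee_fin r0.
Qed.

(** The second moment of a likelihood ratio is 1 plus the chi-square distance. *)
Lemma ratio_moment sg : `|sg| <= 1 -> exists2 X : R,
  (\int[mus sg \x Q]_t (obs_ratio sg (Y t))%:E = X%:E)%E & 0 <= X <= 1 + c.
Proof.
move=> sg1.
have mr' := mr sg; have rg0 y := r0 y sg1.
have mass s : `|s| <= 1 -> (\int[mu]_z (g s z)%:E = 1)%E.
  move=> s1; have := pair_law (k := cst 1%E) s1.
  move=> h; transitivity (\int[mu]_z (1 * (g s z)%:E))%E.
    by apply: eq_integral => z _; rewrite mul1e.
  rewrite -h//; rewrite integral_cst// mul1e [LHS]probability_setT//.
rewrite (pair_law (k := fun y => (obs_ratio sg y)%:E) sg1)//; last exact/measurable_EFinP.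
set I := (\int[mu]_z _)%E.
have I0 : (0 <= I)%E by apply: integral_ge0 => z _; rewrite -EFinM lee_fin mulr_ge0 ?g_ge0.
have mEF (f : R -> R) : measurable_fun [set: R] f ->
  measurable_fun [set: R] (fun w => (f w)%:E) by move=> mf; exact/measurable_EFinP.
pose q z := (g sg z - g 0 z) ^+ 2 / g 0 z.
have q0 z : 0 <= q z by rewrite divr_ge0 ?sqr_ge0// ltW.
have mq : measurable_fun [set: R] q.
  rewrite (_ : q = fun z => (g sg z - g 0 z) ^+ 2 * g 0 z `^ (-1)); last first.
    by apply/funext => z; rewrite /q powR_inv1// ltW.
  apply: measurable_funM; first by apply: measurable_funX; exact: measurable_funB.
  exact: (measurableT_comp (@measurable_powR R (-1)) (mg 0)).
have key : (I + 1 = (1 + 1) + \int[mu]_z (q z)%:E)%E.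
  rewrite -{1}(mass 0 n0) -(mass sg sg1) /I.
  have gs z := g_ge0 z sg1; have gz z := g_ge0 z n0.
  rewrite -!ge0_integralD//; try by [move=> z _; rewrite lee_fin|exact: mEF|
    move=> z _; rewrite adde_ge0// lee_fin|
    apply: emeasurable_funD; exact: mEF|
    move=> z _; rewrite -EFinM lee_fin mulr_ge0|
    apply: emeasurable_funM; exact: mEF].
  apply: eq_integral => z _; rewrite -EFinM -!EFinD obs_ratioE /q; congr (_%:E).
  by field; rewrite lt0r_neq0.
have h : (I + 1 <= (2 + c)%:E)%E.
  by rewrite key EFinD leeD// ?chi_le.
have Ifin : I \is a fin_num.
  rewrite ge0_fin_numE//; apply: (@le_lt_trans _ _ (2 + c)%:E); last exact: ltry.
  by apply: le_trans h; rewrite leeDl.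
exists (fine I); first by rewrite fineK.
rewrite fine_ge0//=; rewrite -(fineK Ifin) -EFinD lee_fin in h; lra.
Qed.

Lemma distr_fun_sep : exists W : R, 120^-1 <= W /\
  forall sg, `|sg| <= 1 -> distr_fun (mus sg) t0 = distr_fun (mus 0) t0 - sg * a * W.
Proof.
exists (\int[mu]_(x in `[0, +oo[) wave N x); split; first exact: wave_half_ge.
move=> sg sg1; rewrite (distr_fun_dens lam1 N1 (mus_dens sg1)).
by rewrite (distr_fun_dens lam1 N1 (mus_dens n0)); ring.
Qed.

(** The events that the estimator lies within [a / 360] of the values of the three
    hypotheses are disjoint, as these values are at least [a / 120] apart.  If each had
    probability at least [1 - eps] under its own law, one of the outer two would have
    probability at most [eps / 2] under the middle law, against [no_good_test]. *)
Lemma three_point n (eps : R) (Ft : estimator R n) : 0 < eps < 2^-1 ->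
  n%:R * c <= 4^-1 * ln eps^-1 ->
  exists2 sg : R, `|sg| <= 1 &
   (eps%:E < model Q (mus sg) n
     [set w | (a / 360 < `|Ft (observations w) - distr_fun (mus sg) t0|)%R])%E.
Proof.
move=> heps hc; have /andP[e0 e2] := heps.
apply: contrapT => hno.
have {}hno sg : `|sg| <= 1 -> (model Q (mus sg) n
     [set w | (a / 360 < `|Ft (observations w) - distr_fun (mus sg) t0|)%R] <= eps%:E)%E.
  by move=> sg1; rewrite leNgt; apply/negP => h; apply: hno; exists sg.
have [W [hW th]] := distr_fun_sep.
pose th0 := distr_fun (mus 0) t0.
pose A sg := [set v : n.-tuple R | `|Ft v - (th0 - sg * a * W)| <= a / 360].
have mA sg : measurable (A sg).
  have mF : measurable_fun [set: n.-tuple R] (fun v => `|Ft v - (th0 - sg * a * W)|).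
    by apply: measurableT_comp => //; exact: measurable_funB.
  have := mF measurableT _ (@measurable_itv R `]-oo, a / 360]).
  rewrite setTI; congr measurable; apply/seteqP; split => v /=; by rewrite in_itv.
pose B sg := @observe _ _ _ Y n @^-1` A sg.
have mo := @measurable_observe _ _ R Y mY n.
have mB sg : measurable (B sg) by rewrite -[B sg]setTI; exact: mo.
pose P s := iid (mus s \x Q)%E n.
have PB s : `|s| <= 1 -> 1 - eps <= fine (P s (B s)).
  move=> s1; have := hno s s1.
  have -> : [set w | (a / 360 < `|Ft (observations w) - distr_fun (mus s) t0|)%R] = ~` B s.
    apply/seteqP; split => w /=; rewrite th// ltNge; first by move/negP.
    by move=> /negP.
  rewrite -[model _ _ _]/(P s) probability_setC//.
  have f : P s (B s) \is a fin_num by exact: fin_num_measure.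
  by rewrite -(fineK f) -EFinB lee_fin; lra.
have aW : a / 360 < a * W / 2.
  have : a * 120^-1 <= a * W by rewrite ler_pM2l.
  by have := a0; lra.
have disj s s' : 1 <= `|s - s'| -> B s `&` B s' = set0.
  move=> ss; apply/seteqP; split => // w [] /=.
  rewrite /B /A /=; set y := Ft _ => h1 h2.
  have : `|(s - s') * (a * W)| <= a / 360 + a / 360.
    have -> : (s - s') * (a * W) = (y - (th0 - s * a * W)) - (y - (th0 - s' * a * W)) by ring.
    by rewrite (le_trans (ler_normB _ _))// lerD.
  have aW0 : 0 <= a * W by have := a0; have := aW; lra.
  rewrite normrM (ger0_norm aW0).
  have : a * W <= `|s - s'| * (a * W) by rewrite ler_peMl.
  by lra.
have n1 : `|1 : R| <= 1 by rewrite normr1.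
have nm1 : `|-1 : R| <= 1 by rewrite normrN normr1.
have P0f s : P 0 (B s) \is a fin_num by exact: fin_num_measure.
pose P0 := P 0; pose B0 := B 0; pose B1 := B 1; pose Bm := B (-1).
have sum_le : fine (P0 B1) + fine (P0 Bm) <= eps.
  have d1 : B1 `&` Bm = set0 by apply: disj; rewrite opprK ger0_norm// lerDl.
  have d0 : B0 `&` (B1 `|` Bm) = set0.
    by rewrite setIUr !disj ?setU0// sub0r ?normrN ?normr1// opprK normr1.
  have h : (P0 B0 + (P0 B1 + P0 Bm) <= 1)%E.
    rewrite -(measureU P0 (mB 1) (mB (-1)) d1).
    rewrite -(measureU P0 (mB 0) (measurableU _ _ (mB 1) (mB (-1))) d0).
    exact: probability_le1 (measurableU _ _ (mB 0) (measurableU _ _ (mB 1) (mB (-1)))).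
  rewrite -(fineK (P0f 0)) -(fineK (P0f 1)) -(fineK (P0f (-1))) -!EFinD lee_fin in h.
  by have := PB 0 n0; rewrite -/P0 -/B0; lra.
have [s s1 hs] : exists2 s : R, `|s| <= 1 & fine (P0 (B s)) <= eps / 2.
  have [h|h] := leP (fine (P0 B1)) (eps / 2); first by exists 1.
  by exists (-1) => //; rewrite -/Bm; lra.
have [X hX /andP[X0 X1]] := ratio_moment s1.
have e20 : 0 < 2 * eps by rewrite mulr_gt0.
have ti := likelihood_test_le mY (mr s) (fun y => r0 y s1)
  (fun k mk k0 => pair_change s1 mk k0) hX (mA s) e20.
apply: (@no_good_test R eps (X ^+ n) _ _ heps _ hs (PB s s1) ti).
rewrite (le_trans _ (_ : expR (n%:R * c) <= _)) ?ler_expR//.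
rewrite expRM_natl lerXn2r ?nnegrE ?expR_ge0//.
by rewrite (le_trans X1)// expR_ge1Dx.
Qed.

End three_hypotheses.

(** * Decay of the noise transform; positivity of Gamma *)

Section noise_condition.
Context {R : realType}.
Variables (beta : R) (fz : R -> R).
Hypothesis E3 : condE3 beta fz.

Lemma condE3_derive : let C' := derive1 (cos_part fz) in let S' := derive1 (sin_part fz) in
  [/\ forall s : R, is_derive s 1 (cos_part fz) (C' s),
      forall s : R, is_derive s 1 (sin_part fz) (S' s),
      continuous C' & continuous S'].
Proof.
have [h _] := E3; split.
- by move=> s; have [[h1 _] _] := h s; rewrite derive1E; exact/derivableP.
- by move=> s; have [[_ h1] _] := h s; rewrite derive1E; exact/derivableP.
- move=> s; have [_ [h1 _]] := h s.
  exact/differentiable_continuous/derivable1_diffP/h1.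
- move=> s; have [_ [_ h1]] := h s.
  exact/differentiable_continuous/derivable1_diffP/h1.
Qed.

Lemma cmod_Re_le (z : R[i]) : `|complex.Re z| <= cmod z.
Proof.
rewrite /cmod -sqrtr_sqr ler_sqrt ?addr_ge0 ?sqr_ge0//.
by rewrite lerDl sqr_ge0.
Qed.

Lemma cmod_Im_le (z : R[i]) : `|complex.Im z| <= cmod z.
Proof.
rewrite /cmod -sqrtr_sqr ler_sqrt ?addr_ge0 ?sqr_ge0//.
by rewrite lerDr sqr_ge0.
Qed.

Lemma condE3_bound : exists Cz ws : R, [/\ 0 < Cz, 0 < ws &
  forall N s, 1 <= N -> ws <= N -> N <= s <= 2 * N ->
   [/\ `|cos_part fz s| <= Cz * N `^ (- beta), `|sin_part fz s| <= Cz * N `^ (- beta),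
       `|derive1 (cos_part fz) s| <= Cz * N `^ (- beta) &
       `|derive1 (sin_part fz) s| <= Cz * N `^ (- beta)]].
Proof.
have [_ [b2 [Cz [ws [Cz0 [ws0 h]]]]]] := E3.
exists Cz, ws; split => // N s N1 wsN /andP[Ns _].
have N0 : 0 < N by exact: lt_le_trans N1.
have s0 : 0 < s by exact: lt_le_trans Ns.
have {}h := h s (le_trans wsN (le_trans Ns (ler_norm s))).
have key j : (j < 3)%N -> cmod (iter j (@cderive1 R) (fourier fz) s) <= Cz * N `^ (- beta).
  move=> j3; rewrite powRN ler_pdivlMr ?powR_gt0// mulrC.
  apply: le_trans h; apply: ler_pM.
  - exact: powR_ge0.
  - exact: sqrtr_ge0.
  - have -> : N `^ beta = (N ^+ 2) `^ (beta / 2).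
      by rewrite -powR_mulrn ?(ltW N0)// -powRrM; congr (_ `^ _); field.
    apply: ge0_ler_powR; rewrite ?nnegrE ?addr_ge0 ?sqr_ge0//.
      by rewrite divr_ge0// (le_trans _ (ltW b2)).
    have : N ^+ 2 <= s ^+ 2 by rewrite ler_sqr ?nnegrE ?(ltW N0) ?(ltW s0).
    by lra.
  - exact: (@le_bigmax _ _ _ 0 (fun j : 'I_3 => cmod (iter j (@cderive1 R) (fourier fz) s)) (Ordinal j3)).
have k0 := key 0%N isT; have k1 := key 1%N isT.
split.
- exact: le_trans (cmod_Re_le _) k0.
- exact: le_trans (cmod_Im_le _) k0.
- exact: le_trans (cmod_Re_le _) k1.
- exact: le_trans (cmod_Im_le _) k1.
Qed.

End noise_condition.

Section gamma_positive.
Context {R : realType}.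
Local Notation mu := (@lebesgue_measure R).

(** The integral over [[1, 2]] is at least exp (- 2).  Integrability on the half-line is
    established first, because [Gamma] is a real-valued integral. *)
Lemma Gamma_gt0 (alpha : R) : 0 < alpha -> 0 < Gamma (2 * alpha + 1).
Proof.
move=> al0; rewrite /Gamma.
pose f (x : R) := x `^ (2 * alpha + 1 - 1) * expR (- x).
have f0 x : 0 <= f x by rewrite mulr_ge0 ?powR_ge0 ?expR_ge0.
have mf : measurable_fun [set: R] f.
  apply: measurable_funM; first exact: measurable_powR.
  by apply: measurableT_comp => //; exact: measurable_funN.
have fi : mu.-integrable `[0, +oo[ (EFin \o f).
  have h2 : 0 < (2^-1 : R) by rewrite invr_gt0.
  have mI : measurable (`[0, +oo[ : set (measurableTypeR R)) by [].
  have := integrableZl mI ((8 * alpha ^+ 2) `^ alpha) (integrable_expR_half h2).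
  apply: le_integrable => //; first by apply/measurable_EFinP; exact: measurable_funTS.
  move=> x /=; rewrite in_itv/= andbT => x0.
  rewrite lee_fin (ger0_norm (f0 x)) (le_trans _ (ler_norm _))// /f.
  have -> : expR (- (2^-1 * x)) = expR (2^-1 * x) * expR (- x).
    by rewrite -expRD; congr expR; field.
  rewrite mulrA ler_wpM2r ?expR_ge0// addrK.
  have w := sobolev_weight_le (x / (2 * alpha)) (ltW al0).
  have a2 : 0 < 2 * alpha by rewrite mulr_gt0.
  have -> : x `^ (2 * alpha) = (4 * alpha ^+ 2) `^ alpha * ((x / (2 * alpha)) ^+ 2) `^ alpha.
    rewrite (powRrM x 2 alpha) powR_mulrn// -powRM ?mulr_ge0 ?invr_ge0 ?mulr_ge0 ?(ltW al0)//.
    by congr (_ `^ _); field; rewrite lt0r_neq0.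
  have -> : (8 * alpha ^+ 2) `^ alpha = (4 * alpha ^+ 2) `^ alpha * 2 `^ alpha.
    by rewrite -powRM ?mulr_ge0 ?(ltW al0)//; congr (_ `^ _); ring.
  rewrite -mulrA ler_wpM2l ?powR_ge0//.
  rewrite ger0_norm in w; last by rewrite divr_ge0// ltW.
  rewrite (_ : alpha * (x / (2 * alpha)) = 2^-1 * x) in w; last by field; rewrite lt0r_neq0.
  apply: le_trans w; apply: ge0_ler_powR; rewrite ?nnegrE ?addr_ge0 ?sqr_ge0 ?(ltW al0)//.
  by rewrite lerDr.
apply: (@lt_le_trans _ _ (expR (-2))); first exact: expR_gt0.
have -> : expR (-2) = \int[mu]_(x in `[1, 2]) (cst (expR (-2)) x).
  transitivity (expR (-2) * fine (mu `[1, 2])); last by symmetry; exact: Rintegral_cst.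
  have -> : mu `[1, 2] = (2%:E - 1%:E)%E.
    transitivity (if ((1 : R)%:E < 2%:E)%E then ((2 : R)%:E - 1%:E)%E else 0%E).
      exact: lebesgue_measure_itv.
    by rewrite lte_fin ltr1n.
  by rewrite -EFinB/=; ring.
have iD : mu.-integrable `[1, 2] (EFin \o cst (expR (-2) : R)).
  apply: continuous_compact_integrable; first exact: segment_compact.
  by apply: continuous_subspaceT => x; exact: cvg_cst.
have fiD : mu.-integrable `[1, 2] (EFin \o f).
  by apply: integrableS fi => //; apply: subset_itv; rewrite bnd_simp.
apply: (@le_trans _ _ (\int[mu]_(x in `[1, 2]) f x)).
  apply: le_Rintegral => // x /=; rewrite in_itv/= => /andP[x1 x2].
  rewrite /f -[leLHS]mul1r ler_pM ?expR_ge0//; last by rewrite ler_expR lerN2.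
  rewrite addrK [leLHS](_ : 1 = 1 `^ (2 * alpha)); last by rewrite powR1.
  apply: ge0_ler_powR; rewrite ?nnegrE//.
    by rewrite mulr_ge0// ltW.
  by rewrite (le_trans ler01 x1).
rewrite [leLHS]Rintegral_mkcond [leRHS]Rintegral_mkcond.
apply: le_Rintegral => //.
- by rewrite -restrict_EFin; apply/integrable_restrict => //; rewrite setTI.
- by rewrite -restrict_EFin; apply/integrable_restrict => //; rewrite setTI.
move=> x _; rewrite !patchE !mem_setE !in_itv/= andbT.
case: ifPn => [/andP[h _]|_]; first by rewrite (le_trans ler01 h).
by case: ifP => _ //; exact: f0.
Qed.

End gamma_positive.

(** * Choice of frequency and amplitude *)

Section calibrated_hypotheses.
Context {R : realType}.
Variables (beta : R) (Q : probability R R) (fz : R -> R).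
Hypothesis Qf : has_density Q fz.
Hypothesis E3 : condE3 beta fz.

(** Assembles the construction for given frequency and amplitude; the remaining hypotheses
    are numerical conditions on [N], [a] and [lam]. *)
Lemma three_point_class (Cz lam N a t0 alpha L eps : R) n (Ft : estimator R n) :
  1 <= lam -> 1 <= N -> 0 < a -> a * (5 * N) <= (pi * lam)^-1 ->
  0 < alpha -> alpha < 2 * lam ->
  (2 * pi)^-1 * (16 * expR 2 * 2 `^ alpha * (2 / (2 * lam - alpha)) +
    16 * (pi * a) ^+ 2 * (5 * N ^+ 2) `^ alpha * (4 * N)) <= L ^+ 2 ->
  (forall s, N <= s <= 2 * N ->
   [/\ `|cos_part fz s| <= Cz * N `^ (- beta), `|sin_part fz s| <= Cz * N `^ (- beta),
       `|derive1 (cos_part fz) s| <= Cz * N `^ (- beta) &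
       `|derive1 (sin_part fz) s| <= Cz * N `^ (- beta)]) ->
  0 < eps < 2^-1 ->
  n%:R * (a ^+ 2 / floor_const fz lam * (80 * pi * N * (Cz * N `^ (- beta)) ^+ 2))
    <= 4^-1 * ln eps^-1 ->
  exists2 P, sobolev_class alpha L P &
    (eps%:E < model Q P n
      [set w | (a / 360 < `|Ft (observations w) - distr_fun P t0|)%R])%E.
Proof.
move=> lam1 N1 a0 small al0 al2 hL hM heps hn.
have [dC dS cC cS] := condE3_derive E3.
have a0' := ltW a0.
have chi := chi_square_le Qf t0 lam1 N1 a0' dC dS cC cS
  (fun s hs => let: And4 h _ _ _ := hM s hs in h)
  (fun s hs => let: And4 _ h _ _ := hM s hs in h)
  (fun s hs => let: And4 _ _ h _ := hM s hs in h)
  (fun s hs => let: And4 _ _ _ h := hM s hs in h).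
have /choice[mus hmus] (sg : R) : exists P : probability R R,
    `|sg| <= 1 -> has_density P (dens lam N a t0 sg).
  have [sg1|sg1] := boolP (`|sg| <= 1); last by exists Q.
  by have [P hP] := dens_prob t0 lam1 N1 a0' small sg1; exists P.
have [sg sg1 h] := three_point Qf lam1 N1 a0 small chi hmus Ft heps hn.
exists (mus sg) => //.
exact: (sobolev_dens lam1 N1 a0' sg1 al0 al2 (hmus sg sg1) hL).
Qed.

End calibrated_hypotheses.

Section rates.
Context {R : realType}.

Lemma sqr_powR (x y : R) : 0 < x -> (x `^ y) ^+ 2 = x `^ (2 * y).
Proof. by move=> x0; rewrite -powR_mulrn ?powR_ge0// -powRrM mulrC. Qed.

(** The powers of [N] cancel, and [k1] is the constant for which the wave takes half of
    the Sobolev budget [L ^+ 2]. *)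
Lemma wave_sobolev_budget (alpha k1 L N : R) : 0 < N -> 0 < L ->
  k1 = (64 * pi * 5 `^ alpha) `^ (- 2^-1) ->
  (2 * pi)^-1 * (16 * (pi * (L * k1 * N `^ (- (alpha + 2^-1)))) ^+ 2 *
    (5 * N ^+ 2) `^ alpha * (4 * N)) = L ^+ 2 / 2.
Proof.
move=> N0 L0 k1E; have pi0 := pi_gt0 R.
have b0 : 0 < 64 * pi * (5 : R) `^ alpha by rewrite !mulr_gt0// powR_gt0.
have k2 : k1 ^+ 2 = (64 * pi * 5 `^ alpha)^-1.
  by rewrite k1E sqr_powR// (_ : 2 * - 2^-1 = - 1) ?powR_inv1 ?(ltW b0)//; field.
have hN : (N `^ (- (alpha + 2^-1))) ^+ 2 * (N `^ (2 * alpha) * N) = 1.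
  rewrite sqr_powR// -[X in _ * (_ * X)]powRr1 ?(ltW N0)//.
  by rewrite -!powRD ?lt0r_neq0 ?implybT// (_ : _ + _ = 0) ?powRr0//; field.
rewrite powRM ?sqr_ge0// -(powR_mulrn 2 (ltW N0)) -(powRrM N 2).
rewrite (exprMn _ pi) (exprMn _ (L * k1)) (exprMn _ L) k2.
transitivity ((2 * pi)^-1 * (64 * pi ^+ 2 * L ^+ 2 * (64 * pi * 5 `^ alpha)^-1 * 5 `^ alpha)
   * ((N `^ (- (alpha + 2^-1))) ^+ 2 * (N `^ (2 * alpha) * N))); first by ring.
rewrite hN; move: (5 `^ alpha) (powR_gt0 alpha (ltr0Sn R 4)) (pi) pi0 {b0 k1E k2} => u u0 q q0.
by field; rewrite !lt0r_neq0.
Qed.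

Lemma chi_square_scaling (alpha beta k1 fc Cz L N : R) : 0 < N -> 0 < fc ->
  (L * k1 * N `^ (- (alpha + 2^-1))) ^+ 2 / fc * (80 * pi * N * (Cz * N `^ (- beta)) ^+ 2) =
  k1 ^+ 2 * (80 * pi) * Cz ^+ 2 / fc * L ^+ 2 * N `^ (- (2 * alpha + 2 * beta)).
Proof.
move=> N0 fc0.
have hN : (N `^ (- (alpha + 2^-1))) ^+ 2 * (N * (N `^ (- beta)) ^+ 2) = N `^ (- (2 * alpha + 2 * beta)).
  rewrite !sqr_powR// -[X in _ * (X * _)]powRr1 ?(ltW N0)//.
  by rewrite -!powRD ?lt0r_neq0 ?implybT//; congr (_ `^ _); field.
by rewrite -hN !exprMn; ring.
Qed.

(** The frequency that balances the chi-square distance against the sample size turns the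
    amplitude into the rate of the theorem. *)
Lemma amplitude_rate (alpha beta k1 K L x N : R) : 0 < K -> 0 < L -> 0 < x -> 0 < alpha -> 0 < beta ->
  N = (K * L ^+ 2 * x) `^ (2 * alpha + 2 * beta)^-1 ->
  L * k1 * N `^ (- (alpha + 2^-1)) =
  k1 * K `^ (- ((2 * alpha + 1) / (4 * alpha + 4 * beta))) *
   L `^ ((2 * beta - 1) / (2 * alpha + 2 * beta)) * phi alpha beta x.
Proof.
move=> K0 L0 x0 al0 be0 ->; rewrite /phi.
set r := (2 * alpha + 1) / (4 * alpha + 4 * beta).
have d0 : 4 * alpha + 4 * beta != 0 by rewrite lt0r_neq0// addr_gt0// mulr_gt0.
have d1 : 2 * alpha + 2 * beta != 0 by rewrite lt0r_neq0// addr_gt0// mulr_gt0.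
have d2 : alpha + beta != 0 by rewrite lt0r_neq0// addr_gt0.
rewrite -powRrM (_ : _^-1 * _ = - r); last by rewrite /r; field; rewrite d0 d1.
rewrite !powRM ?sqr_ge0 ?mulr_ge0 ?(ltW K0) ?(ltW x0) ?(ltW L0)//.
rewrite (_ : (2 * beta - 1) / (2 * alpha + 2 * beta) = 1 + (- r + - r)); last first.
  by rewrite /r; field; rewrite d0 d1.
by rewrite !powRD ?lt0r_neq0 ?implybT// powRr1 ?(ltW L0)//; ring.
Qed.

Lemma amplitude_small (alpha lam k1 L N : R) : 2^-1 < alpha -> 0 < lam -> 0 < k1 -> 0 < L -> 0 < N ->
  (5 * L * k1 * (pi * lam)) `^ (alpha - 2^-1)^-1 <= N ->
  L * k1 * N `^ (- (alpha + 2^-1)) * (5 * N) <= (pi * lam)^-1.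
Proof.
move=> al0 lam0 k10 L0 N0 hN; have pi0 := pi_gt0 R.
have g0 : 0 < alpha - 2^-1 by rewrite subr_gt0.
have c0 : 0 < 5 * L * k1 * (pi * lam) by rewrite !mulr_gt0.
have h : 5 * L * k1 * (pi * lam) <= N `^ (alpha - 2^-1).
  rewrite -[leLHS](powRr1 (ltW c0)) -[X in _ `^ X <= _](mulVf (lt0r_neq0 g0)) powRrM.
  by apply: ge0_ler_powR; rewrite ?nnegrE ?powR_ge0 ?(ltW g0) ?(ltW N0).
rewrite (_ : N `^ (- (alpha + 2^-1)) = N `^ (- (alpha - 2^-1)) * N^-1); last first.
  rewrite -(powR_inv1 (ltW N0)) -powRD ?lt0r_neq0 ?implybT//.
  by congr (_ `^ _); field.
rewrite powRN [leLHS](_ : _ = 5 * L * k1 / N `^ (alpha - 2^-1)); last first.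
  by have := powR_gt0 (alpha - 2^-1) N0; move: (N `^ _) => u u0; field; rewrite !lt0r_neq0.
rewrite ler_pdivrMr ?powR_gt0// -ler_pdivrMl ?invr_gt0 ?mulr_gt0// invrK mulrC.
exact: h.
Qed.

End rates.

(** * Uniform lower bound for exceedance probabilities *)

Section uniform_lower_bound.
Context {R : realType}.
Variables (alpha beta : R) (Q : probability R R) (fz : R -> R).
Hypothesis Qf : has_density Q fz.
Hypothesis E3 : condE3 beta fz.
Hypothesis halpha : 2^-1 < alpha.

(** The Cauchy part of the Sobolev norm tends to 0 as [lam] grows, while [L ^+ 2] is
    bounded below by a positive constant: some [lam] leaves half of the budget to the wave
    for all admissible [L]. *)
Lemma base_scale_exists : exists lam : R, [/\ 1 <= lam, alpha < 2 * lam &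
  forall L : R, pi^-1 * 2 `^ (1 + Num.max (alpha - 1) 0) * Gamma (2 * alpha + 1) <= L ^+ 2 ->
  (2 * pi)^-1 * (16 * expR 2 * 2 `^ alpha * (2 / (2 * lam - alpha))) <= L ^+ 2 / 2].
Proof.
have pi0 := pi_gt0 R; have al0 : 0 < alpha by apply: lt_trans halpha; rewrite invr_gt0.
set G := _ * Gamma _.
have G0 : 0 < G by rewrite !mulr_gt0 ?Gamma_gt0 ?powR_gt0// invr_gt0.
pose K := (2 * pi)^-1 * (16 * expR 2 * 2 `^ alpha * 2).
have K0 : 0 < K by rewrite !mulr_gt0 ?invr_gt0 ?mulr_gt0 ?expR_gt0 ?powR_gt0.
have KG : 0 < 2 * K / G by rewrite divr_gt0// mulr_gt0.
exists (1 + alpha + 2 * K / G); split; [by lra|by lra|move=> L GL].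
set lam := 1 + alpha + 2 * K / G.
have d0 : 2 * K / G <= 2 * lam - alpha by rewrite /lam; lra.
have d1 : 0 < 2 * lam - alpha by exact: lt_le_trans d0.
rewrite [leLHS](_ : _ = K / (2 * lam - alpha)); last by rewrite /K; ring.
rewrite ler_pdivrMr//; apply: (@le_trans _ _ (L ^+ 2 / 2 * (2 * K / G))).
  rewrite (_ : _ * (2 * K / G) = L ^+ 2 * (K / G)); last by field; rewrite lt0r_neq0.
  apply: (@le_trans _ _ (G * (K / G))).
    by rewrite mulrC divfK// lt0r_neq0.
  by rewrite ler_pM2r// divr_gt0.
by rewrite ler_wpM2l// divr_ge0 ?sqr_ge0.
Qed.

(** The constant [k1] comes from [wave_sobolev_budget]; [K] is chosen so that [n] times the
    chi-square distance is exactly [ln eps^-1 / 4].  Large [n] makes the frequency [N]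
    exceed the thresholds of [condE3_bound] and [amplitude_small]. *)
Lemma uniform_lower_bound : exists2 c2 : R, 0 < c2 & forall t0 L : R, 0 < L ->
  pi^-1 * 2 `^ (1 + Num.max (alpha - 1) 0) * Gamma (2 * alpha + 1) <= L ^+ 2 ->
  forall eps : R, 0 < eps < 2^-1 -> \forall n \near \oo,
  forall Ft : estimator R n, exists2 P, sobolev_class alpha L P &
    (eps%:E < model Q P n [set w |
      (c2 * L `^ ((2 * beta - 1) / (2 * alpha + 2 * beta)) *
        phi alpha beta (n%:R / ln eps^-1) <
       `|Ft (observations w) - distr_fun P t0|)%R])%E.
Proof.
have pi0 := pi_gt0 R; have al0 : 0 < alpha by apply: lt_trans halpha; rewrite invr_gt0.
have be0 : 0 < beta by have [_ [b _]] := E3; apply: lt_trans b; rewrite invr_gt0.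
have [lam [lam1 al2 hlam]] := base_scale_exists.
have lam0 : 0 < lam by exact: lt_le_trans lam1.
have [Cz [ws [Cz0 ws0 hCz]]] := condE3_bound E3.
pose k1 : R := (64 * pi * 5 `^ alpha) `^ (- 2^-1).
have k10 : 0 < k1 by rewrite powR_gt0// !mulr_gt0// powR_gt0.
pose fc := floor_const fz lam.
have fc0 : 0 < fc := floor_const_gt0 Qf lam1.
pose K2 : R := k1 ^+ 2 * (80 * pi) * Cz ^+ 2 / fc.
have K20 : 0 < K2 by rewrite divr_gt0// !mulr_gt0// exprn_gt0.
pose K : R := 4 * K2.
have K0 : 0 < K by rewrite mulr_gt0.
pose r : R := (2 * alpha + 1) / (4 * alpha + 4 * beta).
exists (k1 * K `^ (- r) / 360).
  apply: divr_gt0; last by rewrite ltr0n.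
  by apply: mulr_gt0 => //; exact: powR_gt0.
move=> t0 L L0 GL eps /andP[e0 e2].
set l := ln eps^-1.
have l0 : 0 < l.
  by rewrite ln_gt0// -[ltLHS]invr1 ltf_pV2 ?posrE// (lt_trans e2)// invf_lt1// ltr1n.
pose p := 2 * alpha + 2 * beta.
have p0 : 0 < p by rewrite addr_gt0// mulr_gt0.
pose B : R := Num.max (Num.max 1 ws) ((5 * L * k1 * (pi * lam)) `^ (alpha - 2^-1)^-1).
have B1 : 1 <= B by rewrite /B !le_max lexx.
have Bws : ws <= B by rewrite /B !le_max lexx orbT.
have Bs : (5 * L * k1 * (pi * lam)) `^ (alpha - 2^-1)^-1 <= B by rewrite /B !le_max lexx !orbT.
have B0 : 0 < B by exact: lt_le_trans B1.
near=> n => Ft.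
have hn : l * B `^ p / (K * L ^+ 2) <= n%:R by near: n; exact: nbhs_infty_ger.
have KL0 : 0 < K * L ^+ 2 by rewrite mulr_gt0// exprn_gt0.
have p'0 : 0 <= p^-1 by rewrite invr_ge0 ltW.
pose x := n%:R / l.
have hx : B `^ p <= K * L ^+ 2 * x.
  by rewrite /x mulrA ler_pdivlMr// mulrC (mulrC _ n%:R) -ler_pdivrMr.
have x0 : 0 < x by rewrite -(pmulr_rgt0 _ KL0) (lt_le_trans _ hx)// powR_gt0.
pose N := (K * L ^+ 2 * x) `^ p^-1.
have BN : B <= N.
  rewrite -(powRr1 (ltW B0)) -[X in _ `^ X <= _](mulfV (lt0r_neq0 p0)) powRrM.
  by apply: ge0_ler_powR => //; rewrite nnegrE ?powR_ge0// (le_trans (powR_ge0 _ _) hx).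
have N1 : 1 <= N := le_trans B1 BN.
have N0 : 0 < N by exact: lt_le_trans N1.
pose a := L * k1 * N `^ (- (alpha + 2^-1)).
have a0 : 0 < a by rewrite !mulr_gt0// powR_gt0.
have small : a * (5 * N) <= (pi * lam)^-1.
  by apply: amplitude_small => //; exact: le_trans Bs BN.
have hL : (2 * pi)^-1 * (16 * expR 2 * 2 `^ alpha * (2 / (2 * lam - alpha)) +
    16 * (pi * a) ^+ 2 * (5 * N ^+ 2) `^ alpha * (4 * N)) <= L ^+ 2.
  by rewrite mulrDr (wave_sobolev_budget N0 L0 erefl); have := hlam L GL; lra.
have hc : n%:R * (a ^+ 2 / fc * (80 * pi * N * (Cz * N `^ (- beta)) ^+ 2)) <= 4^-1 * l.
  rewrite chi_square_scaling// -/K2 powRN -powRrM mulVf ?powRr1 ?(ltW p0) ?lt0r_neq0//; last first.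
    by rewrite mulr_ge0 ?(ltW x0) ?(ltW KL0).
  have nE : n%:R = x * l by rewrite /x divfK// lt0r_neq0.
  rewrite nE /K le_eqVlt; apply/orP; left; apply/eqP.
  clearbody K2 x l; field.
  by rewrite !lt0r_neq0.
have heps : 0 < eps < 2^-1 by rewrite e0.
have aE : a / 360 = k1 * K `^ (- r) / 360 *
    L `^ ((2 * beta - 1) / (2 * alpha + 2 * beta)) * phi alpha beta x.
  rewrite /a (amplitude_rate _ K0 L0 x0 al0 be0 erefl).
  by rewrite -!mulrA; congr (_ * (_ * _)); rewrite mulrCA mulrC mulrCA !mulrA.
have [P PL hP] := three_point_class Qf E3 t0 Ft lam1 N1 a0 small al0 al2 hL
  (fun s => hCz N s N1 (le_trans Bws BN)) heps hc.
by exists P => //; rewrite -[n%:R / l]/x -aE.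
Unshelve. all: by end_near.
Qed.

End uniform_lower_bound.

(** * From exceedance probabilities to risks *)

Section risk_lower_bounds.
Context {R : realType}.
Variables (Q : probability R R) (n : nat) (Ft : estimator R n).

Lemma measurable_deviation (th : R) :
  measurable_fun [set: n.-tuple (R * R)] (fun w => `|Ft (observations w) - th|).
Proof.
apply: measurableT_comp => //; apply: measurable_funB => //.
apply: (measurableT_comp (f := Ft)) => //.
apply: (measurable_observe (Y := fun t : R * R => t.1 + t.2)).
by apply: measurable_funD; [exact: measurable_fst|exact: measurable_snd].
Qed.

Lemma measurable_deviation_gt (d th : R) :
  measurable [set w : n.-tuple (R * R) | d < `|Ft (observations w) - th|].
Proof.
have := measurable_deviation th measurableT (@measurable_itv R `]d, +oo[).
by rewrite setTI; congr measurable; apply/seteqP; split => w /=; rewrite in_itv/= andbT.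
Qed.

Lemma Risk_eps_ge (t0 eps d : R) FF P : FF P ->
  (eps%:E < model Q P n [set w | (d < `|Ft (observations w) - distr_fun P t0|)%R])%E ->
  (d%:E <= Risk_eps Q t0 eps Ft FF)%E.
Proof.
move=> FP hP; apply: le_ereal_inf_tmp => _ [d' /= hd' <-]; rewrite lee_fin leNgt.
apply/negP => d'd; move: hP; rewrite ltNge => /negP; apply.
apply: le_trans hd'; apply: le_trans (ereal_sup_ubound _); last by exists P.
apply: le_measure; rewrite ?inE; try exact: measurable_deviation_gt.
by move=> w /=; exact: lt_trans.
Qed.

Lemma Risk2_ge (t0 eps d : R) FF P : FF P -> 0 <= d -> 0 <= eps ->
  (eps%:E < model Q P n [set w | (d < `|Ft (observations w) - distr_fun P t0|)%R])%E ->
  ((d * eps `^ 2^-1)%:E <= Risk2 Q t0 Ft FF)%E.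
Proof.
move=> FP d0 eps0 hP; apply: le_trans (ereal_sup_ubound _); last by exists P.
have -> : d * eps `^ 2^-1 = (d ^+ 2 * eps) `^ 2^-1.
  by rewrite powRM ?sqr_ge0// -(powR_mulrn 2 d0) -(powRrM d 2) mulfV// powRr1.
rewrite -poweR_EFin.
set A := [set w | _] in hP; set th := distr_fun P t0 in A hP *.
have mA : measurable A := measurable_deviation_gt d th.
have E0 : (0 <= 'E_(model Q P n)[fun w => (`|Ft (observations w) - th| ^+ 2)%R])%E.
  by apply: expectation_ge0 => w; exact: sqr_ge0.
apply: gt0_ler_poweR => //.
- by rewrite in_itv/= leey andbT lee_fin mulr_ge0 ?sqr_ge0.
- by rewrite in_itv/= leey andbT.
apply: (@le_trans _ _ ((d ^+ 2)%:E * model Q P n A)%E).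
  by rewrite EFinM; apply: lee_wpmul2l; rewrite ?lee_fin ?sqr_ge0 ?(ltW hP).
rewrite -[A]setIT -integral_indic// -ge0_integralZl//; last 2 first.
- by apply/measurable_EFinP; exact: measurable_indic.
- by rewrite lee_fin sqr_ge0.
rewrite unlock; apply: ge0_le_integral_nomeas => w _.
  by rewrite -EFinM lee_fin mulr_ge0 ?sqr_ge0.
rewrite -EFinM lee_fin indicE; case: (boolP (w \in A)) => [|_]; last by rewrite mulr0 sqr_ge0.
by rewrite inE mulr1 /A/= => h; rewrite ler_sqr ?nnegrE ?(ltW h).
Qed.

End risk_lower_bounds.

Theorem theorem2p2 (R : realType) (alpha beta : R)
    (fzeta : R -> R) (Q : probability R R)
    (Qdensity : has_density Q fzeta)
    (fhat_neq0 : forall omega : R, cmod (fourier fzeta omega) != 0)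
    (E3 : condE3 beta fzeta)
    (halpha : 2^-1 < alpha) :
  exists c1 c2 : R, 0 < c1 /\ 0 < c2 /\
    forall (t0 L : R), 0 < L ->
      pi^-1 * 2 `^ (1 + Num.max (alpha - 1) 0) * Gamma (2 * alpha + 1)
        <= L ^+ 2 ->
      (\forall n \near \oo,
        ((c1 * L `^ ((2 * beta - 1) / (2 * alpha + 2 * beta))
             * phi alpha beta n%:R)%:E
         <= ereal_inf [set Risk2 Q t0 Ft (sobolev_class alpha L)
                      | Ft in [set: estimator R n]])%E) /\
      (forall eps : R, 0 < eps < 2^-1 ->
        \forall n \near \oo,
          ((c2 * L `^ ((2 * beta - 1) / (2 * alpha + 2 * beta))
               * phi alpha beta (n%:R / ln (eps^-1)))%:E
           <= ereal_inf [set Risk_eps Q t0 eps Ft (sobolev_class alpha L)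
                        | Ft in [set: estimator R n]])%E).
Proof.
have [c2 c20 hc] := uniform_lower_bound Qdensity E3 halpha.
exists (c2 * expR (-1) `^ 2^-1), c2; split.
  by rewrite mulr_gt0// powR_gt0 ?expR_gt0.
split => // t0 L L0 GL; split => [|eps heps].
(* For eps = 1 / e the logarithm of 1 / eps is 1. *)
- have he : 0 < (expR (- (1 : R)) : R) < (2 : R)^-1.
    rewrite expR_gt0 expRN ltf_pV2 ?posrE ?expR_gt0//.
    exact: expR_gt1Dx.
  apply: filterS (hc t0 L L0 GL _ he) => n h.
  apply: le_ereal_inf_tmp => _ [Ft _ <-]; have [P PL hP] := h Ft.
  rewrite expRN invrK expRK divr1 -expRN in hP.
  rewrite [leLHS](_ : _ = (c2 * L `^ ((2 * beta - 1) / (2 * alpha + 2 * beta)) *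
    phi alpha beta n%:R * expR (-1) `^ 2^-1)%:E); last by congr EFin; ring.
  apply: Risk2_ge PL _ (expR_ge0 _) hP.
  by rewrite !mulr_ge0 ?powR_ge0// ltW.
- apply: filterS (hc t0 L L0 GL _ heps) => n h.
  apply: le_ereal_inf_tmp => _ [Ft _ <-]; have [P PL hP] := h Ft.
  exact: Risk_eps_ge PL hP.
Qed.
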